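(* There is an essentially unique, generically invertible, algebraic intertwining operator from the family $\mathcal{S}$ of singular solutions to the family $\mathcal{R}$ of regular solutions. Precisely: there is a morphism $\mathcal{A}\colon\mathcal{S}\to\mathcal{R}$ of algebraic families of Harish-Chandra modules for $(\mathfrak{g},K)$ that is generically invertible (it becomes an isomorphism after tensoring over $\mathcal{O}=\mathbb{C}[T]$ with $\mathbb{C}(T)$) and induces a nonzero map $\mathcal{S}|_\lambda\to\mathcal{R}|_\lambda$ for every $\lambda\in\mathbb{C}$; and any morphism of algebraic families $\mathcal{S}\to\mathcal{R}$ that is nonzero in every fiber is a nonzero complex scalar multiple of $\mathcal{A}$.
   Context: Fix a real constant $\gamma>0$. Put $\mathbb{R}^3_0=\mathbb{R}^3\setminus\{0\}$, $r=\|x\|$, and $T=-\Delta-2\gamma/r$, viewed in the algebra of linear partial differential operators on $\mathbb{R}^3_0$ with smooth coefficients. Let $\mathcal{O}=\mathbb{C}[T]$ (viewed as polynomial functions of $\lambda\in\mathbb{C}$). Let $L_1=x_2\partial_3-x_3\partial_2$, $L_2=x_3\partial_1-x_1\partial_3$, $L_3=x_1\partial_2-x_2\partial_1$, and let the Runge-Lenz operators be $R_1=\sqrt{-1}(L_3\partial_2-L_2\partial_3-\partial_1+\gamma x_1/r)$, $R_2=\sqrt{-1}(L_1\partial_3-L_3\partial_1-\partial_2+\gamma x_2/r)$, $R_3=\sqrt{-1}(L_2\partial_1-L_1\partial_2-\partial_3+\gamma x_3/r)$. All commute with $T$. $\mathfrak{g}$ is the $\mathcal{O}$-linear span of the $L_i,R_i$;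 it is a Lie algebra over $\mathcal{O}$ under the commutator, free on these six elements, with $[L_i,L_j]=-\varepsilon_{ijk}L_k$, $[R_i,R_j]=\varepsilon_{ijk}TL_k$, $[L_i,R_j]=-\varepsilon_{ijk}R_k$. $K=O(3,\mathbb{C})$ (compact form $O(3)$). $O(3)$ acts on $\mathbb{R}^3_0$ by $A\colon v\mapsto\det(A)^{-1}Av$, hence on functions and, by conjugation, on $\mathfrak{g}$; this extends algebraically to $K$. The infinitesimal action identifies $\mathfrak{k}=\mathfrak{so}(3,\mathbb{C})$ with the span of the $L_i$. An algebraic family of Harish-Chandra modules for $(\mathfrak{g},K)$ is a free $\mathcal{O}$-module $\mathcal{F}$ with a locally finite-dimensional algebraic representation of $K$ by $\mathcal{O}$-module automorphisms, with finitely generated free isotypical summands, and with a $K$-equivariant $\mathcal{O}$-linear Lie algebra action of $\mathfrak{g}$ whose restriction to $\mathfrak{k}$ is the infinitesimal form of the $K$-action. Morphisms (intertwining operators) are $\mathcal{O}$-linear, $K$-equivariant and $\mathfrak{g}$-equivariant maps. The fiber is $\mathcal{F}|_\lambda=\mathcal{F}/(T-\lambda)\mathcal{F}$. For $\lambda\in\mathbb{C}$, $\mathrm{Sol}(\lambda)=\{\psi\in C^\infty(\mathbb{R}^3_0)_{\mathrm{fin}}: T\psi=\lambda\psi\}$ (fin denotes $K$-finite functions). The radial equation is $r^2\psi''+2r\psi'-\ell(\ell+1)\psi+2\gamma r\psi+\lambda r^2\psi=0$. $F_{\ell,\lambda}$ is its unique solution extending to an entire function of $r$ with $F_{\ell,\lambda}(r)=r^\ell+\text{higher-order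 terms}$. $G_{\ell,\lambda}$ is a second solution of the form $H_{\ell,\lambda}+C_{\ell,\lambda}\log(r)F_{\ell,\lambda}$, with $H_{\ell,\lambda}$ meromorphic with a pole of order $\ell+1$ at $0$, normalized so that the coefficient of $r^{-(\ell+1)}$ is $1$ (well defined modulo multiples of $F_{\ell,\lambda}$). $\mathrm{RegSol}(\lambda)\subseteq\mathrm{Sol}(\lambda)$ is the span of the functions $F_{\ell,\lambda}(r)Y_\ell$, $Y_\ell$ a spherical harmonic of degree $\ell$, $\ell\ge0$; it is $\mathfrak{g}$- and $K$-invariant; $\mathrm{SingSol}(\lambda)=\mathrm{Sol}(\lambda)/\mathrm{RegSol}(\lambda)$. $\mathcal{R}$ is the span of the sections $\lambda\mapsto p(\lambda)F_{\ell,\lambda}Y_\ell\in\mathrm{RegSol}(\lambda)$, and $\mathcal{S}$ is the span of the sections $\lambda\mapsto[p(\lambda)G_{\ell,\lambda}Y_\ell]\in\mathrm{SingSol}(\lambda)$, $p$ polynomial. $T$ acts as multiplication by $\lambda$; $\mathfrak{g}$ and $K$ act pointwise in $\lambda$ through their actions on functions on $\mathbb{R}^3_0$. Both $\mathcal{R}$ and $\mathcal{S}$ are algebraic families of Harish-Chandra modules, with $\mathcal{R}|_\lambda\cong\mathrm{RegSol}(\lambda)$, $\mathcal{S}|_\lambda\cong\mathrm{SingSol}(\lambda)$. *)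

(* Defs.v *)
From HB Require Import structures.
From mathcomp Require Import all_boot all_order all_algebra.
From mathcomp Require Import generic_quotient ring_quotient fraction.
From mathcomp Require Import all_classical all_reals all_analysis.
From mathcomp Require Import complex ring.
From mathcomp Require mpoly.
(* The notations of mpoly clash with those of the analysis library. *)
Import (canonicals, coercions) mpoly.
Import Order.TTheory GRing.Theory Num.Theory.
Import numFieldNormedType.Exports.
Set Implicit Arguments.
Unset Strict Implicit.
Unset Printing Implicit Defensive.
Local Open Scope ring_scope.
Local Open Scope quotient_scope.
Local Open Scope classical_set_scope.

Section LinearSpan.
Variables (K : pzRingType) (V : lmodType K) (A : set V).

Definition linspan : {pred V} := fun v =>
  `[< exists n (a : 'I_n -> V) (c : 'I_n -> K),
        (forall i, A (a i)) /\ v = \sum_(i < n) c i *: a i >].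

Fact linspan_submod_closed : GRing.submod_closed linspan.
Proof.
split=> [|k u v /asboolP[m [a [c [Aa ->]]]] /asboolP[n [b [d [Ab ->]]]]].
  by apply/asboolP; exists 0, (fun=> 0), (fun=> 0); split=> [[]|]; rewrite ?big_ord0.
apply/asboolP; exists (m + n)%N.
exists (fun i => match fintype.split i with inl j => a j | inr j => b j end).
exists (fun i => match fintype.split i with inl j => k * c j | inr j => d j end).
split=> [i|]; first by case: splitP.
rewrite big_split_ord /= scaler_sumr; congr (_ + _); apply: eq_bigr => i _.
  by rewrite (unsplitK (inl i)) scalerA.
by rewrite (unsplitK (inr i)).
Qed.

HB.instance Definition _ :=
  GRing.isSubmodClosed.Build K V linspan linspan_submod_closed.

Lemma linspan_gen v : A v -> v \in linspan.
Proof.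
move=> Av; apply/asboolP; exists 1%N, (fun=> v), (fun=> 1); split=> //.
by rewrite big_ord1 scale1r.
Qed.

Record submod := Submod { subval :> V; subvalP : subval \in linspan }.
HB.instance Definition _ := [isSub for subval].
HB.instance Definition _ := [Choice of submod by <:].
HB.instance Definition _ := [SubChoice_isSubLmodule of submod by <:].

Definition quotmod := @Quotient.quot V linspan.
HB.instance Definition _ := EqQuotient.on quotmod.
HB.instance Definition _ := ZmodQuotient.on quotmod.

Definition qscale (k : K) := lift_op1 quotmod ( *:%R k).
Lemma pi_qscale k : {morph \pi_quotmod : v / k *: v >-> qscale k v}.
Proof.
move=> v; unlock qscale; apply/eqP; rewrite piE Quotient.equivE -scalerBr.
by rewrite rpredZ // Quotient.idealrBE reprK.
Qed.
Canonical pi_qscale_morph k := PiMorph1 (pi_qscale k).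

Fact qscaleA a b v : qscale a (qscale b v) = qscale (a * b) v.
Proof. by rewrite -[v]reprK !piE scalerA. Qed.
Fact qscale1 : left_id 1 qscale.
Proof. by move=> v; rewrite -[v]reprK !piE scale1r. Qed.
Fact qscaleDr : right_distributive qscale +%R.
Proof. by move=> a u v; rewrite -[v]reprK -[u]reprK !piE scalerDr. Qed.
Fact qscaleDl v : {morph qscale^~ v : a b / a + b}.
Proof. by move=> a b; rewrite -[v]reprK !piE scalerDl. Qed.
HB.instance Definition _ :=
  GRing.Zmodule_isLmodule.Build K quotmod qscaleA qscale1 qscaleDr qscaleDl.

Definition qproj (v : V) : quotmod := \pi_quotmod v.
Fact qproj_linear : linear qproj.
Proof. by move=> a u v; rewrite /qproj !piE. Qed.
HB.instance Definition _ := GRing.isLinear.Build K V quotmod _ qproj qproj_linear.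

Lemma qproj_eq u v : (qproj u == qproj v) = (u - v \in linspan).
Proof. by rewrite Quotient.idealrBE. Qed.

End LinearSpan.

(* genmod M is M tensored over the domain D with its fraction field, in the
   form of the module of fractions m / d with d != 0. *)
Section GenericFibre.
Variables (D : idomainType) (M : lmodType D).

Record mfrac := MFrac { mfrac_val :> M * D; _ : mfrac_val.2 != 0 }.
HB.instance Definition _ := [isSub for mfrac_val].
HB.instance Definition _ := [Choice of mfrac by <:].

Definition mfrac_equiv (x y : mfrac) : bool :=
  `[< exists2 s : D, s != 0 & (s * y.2) *: x.1 = (s * x.2) *: y.1 >].

Lemma mfrac_den (x : mfrac) : x.2 != 0. Proof. by case: x. Qed.

Fact mfrac_equiv_class : equiv_class_of mfrac_equiv.
Proof.
split=> [x|x y|y x z].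
- by apply/asboolP; exists 1; rewrite ?oner_eq0.
- by apply/asboolP/asboolP => -[s s0 e]; exists s.
- move=> /asboolP[s s0 e] /asboolP[t t0 f]; apply/asboolP.
  exists (s * t * y.2); first by rewrite !mulf_neq0 ?mfrac_den.
  have -> : s * t * y.2 * z.2 = t * z.2 * (s * y.2) by ring.
  rewrite -scalerA e scalerA.
  have -> : t * z.2 * (s * x.2) = s * x.2 * (t * z.2) by ring.
  by rewrite -scalerA f scalerA; congr (_ *: _); ring.
Qed.

Canonical mfrac_equiv_rel := EquivRelPack mfrac_equiv_class.
Canonical mfrac_enc := defaultEncModRel mfrac_equiv.

Definition genmod := {eq_quot mfrac_equiv}.
HB.instance Definition _ := EqQuotient.on genmod.
HB.instance Definition _ := Choice.on genmod.

Definition genmk (m : M) (d : D) (d0 : d != 0) : genmod :=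
  \pi_genmod (@MFrac (m, d) d0).

Lemma genmk_eq m d d0 m' d' d0' :
  (exists2 s : D, s != 0 & (s * d') *: m = (s * d) *: m') ->
  @genmk m d d0 = @genmk m' d' d0'.
Proof. by move=> e; apply/eqmodP; apply/asboolP. Qed.

Lemma genmk_eqP m d d0 m' d' d0' :
  @genmk m d d0 = @genmk m' d' d0' ->
  exists2 s : D, s != 0 & (s * d') *: m = (s * d) *: m'.
Proof. by move=> /eqmodP/asboolP. Qed.

Lemma genW (P : genmod -> Prop) : (forall m d d0, P (@genmk m d d0)) -> forall x, P x.
Proof. by move=> h x; elim/quotW: x => -[[m d] d0]; apply: h. Qed.

Lemma genrepr (x : genmod) : x = genmk (repr x).1 (mfrac_den (repr x)).
Proof.
by rewrite -[LHS]reprK /genmk; congr (\pi _); apply: val_inj; rewrite /= -surjective_pairing.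
Qed.

Definition gen0 : genmod := @genmk 0 1 (oner_neq0 _).
Definition genopp (x : genmod) : genmod := genmk (- (repr x).1) (mfrac_den (repr x)).
Definition genadd (x y : genmod) : genmod :=
  genmk ((repr y).2 *: (repr x).1 + (repr x).2 *: (repr y).1)
        (mulf_neq0 (mfrac_den (repr x)) (mfrac_den (repr y))).
Definition genscale (f : {fraction D}) (x : genmod) : genmod :=
  genmk ((repr f).1 *: (repr x).1)
        (mulf_neq0 (denom_ratioP (repr f)) (mfrac_den (repr x))).

Lemma genoppE m d d0 : genopp (@genmk m d d0) = genmk (- m) d0.
Proof.
have [s s0 e] := genmk_eqP (genrepr (genmk m d0)).
by apply: genmk_eq; exists s => //; rewrite !scalerN e.
Qed.

Lemma genaddE m d d0 m' d' d0' : genadd (@genmk m d d0) (@genmk m' d' d0') =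
  genmk (d' *: m + d *: m') (mulf_neq0 d0 d0').
Proof.
have [s s0 e] := genmk_eqP (genrepr (genmk m d0)).
have [t t0 f] := genmk_eqP (genrepr (genmk m' d0')).
rewrite /genadd; set x := repr _ in e *; set y := repr _ in f *.
apply: genmk_eq; exists (s * t); first by rewrite mulf_neq0.
rewrite !scalerDr !scalerA; congr (_ + _).
  have -> : s * t * (d * d') * y.2 = t * d' * y.2 * (s * d) by ring.
  by rewrite -scalerA -e scalerA; congr (_ *: _); ring.
have -> : s * t * (d * d') * x.2 = s * d * x.2 * (t * d') by ring.
by rewrite -scalerA -f scalerA; congr (_ *: _); ring.
Qed.

Lemma genscaleE (f : {ratio D}) m d d0 :
  genscale (\pi_({fraction D}) f) (@genmk m d d0) =
  genmk (f.1 *: m) (mulf_neq0 (denom_ratioP f) d0).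
Proof.
have [s s0 e] := genmk_eqP (genrepr (genmk m d0)).
rewrite /genscale; set x := repr _ in e *.
have := FracField.equivf_l f; set g := repr _ => eg.
apply: genmk_eq; exists s => //; rewrite !scalerA.
have -> : s * (f.2 * d) * g.1 = (g.1 * f.2) * (s * d) by ring.
rewrite -[LHS]scalerA -e !scalerA; congr (_ *: _).
have -> : g.1 * f.2 * (s * x.2) = (s * x.2) * (g.1 * f.2) by ring.
by rewrite eg; ring.
Qed.

Fact genaddA : associative genadd.
Proof.
elim/genW=> m d d0; elim/genW=> m' d' d0'; elim/genW=> m'' d'' d0''.
rewrite !genaddE; apply: genmk_eq; exists 1; rewrite ?oner_eq0 // !mul1r.
rewrite !scalerDr !scalerA addrA.
by congr (_ *: _ + _ *: _ + _ *: _); ring.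
Qed.

Fact genaddC : commutative genadd.
Proof.
elim/genW=> m d d0; elim/genW=> m' d' d0'; rewrite !genaddE.
apply: genmk_eq; exists 1; rewrite ?oner_eq0 // addrC.
by congr (_ *: _); ring.
Qed.

Fact gen0D : left_id gen0 genadd.
Proof.
elim/genW=> m d d0; rewrite /gen0 genaddE; apply: genmk_eq; exists 1.
  by rewrite oner_eq0.
by rewrite scaler0 add0r !scalerA !mul1r mulr1.
Qed.

Fact genND : left_inverse gen0 genopp genadd.
Proof.
elim/genW=> m d d0; rewrite genoppE genaddE; apply: genmk_eq; exists 1.
  by rewrite oner_eq0.
by rewrite scalerN addNr !scaler0.
Qed.

HB.instance Definition _ := GRing.isZmodule.Build genmod genaddA genaddC gen0D genND.

Fact genscaleA a b x : genscale a (genscale b x) = genscale (a * b) x.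
Proof.
elim/quotW: a => a; elim/quotW: b => b; elim/genW: x => m d d0.
have -> : \pi_({fraction D}) a * \pi_({fraction D}) b = \pi_({fraction D}) (FracField.mulf a b) by rewrite -[LHS]FracField.pi_mul.
rewrite (genscaleE b) !genscaleE; apply: genmk_eq; exists 1.
  by rewrite oner_eq0.
rewrite !scalerA /FracField.mulf !numden_Ratio ?mulf_neq0 ?denom_ratioP //.
by congr (_ *: _); ring.
Qed.

Fact genscale1 : left_id 1 genscale.
Proof.
elim/genW=> m d d0.
have -> : 1 = \pi_({fraction D}) (Ratio 1 1) by rewrite -[LHS]tofrac1; unlock FracField.tofrac.
rewrite genscaleE; apply: genmk_eq; exists 1; rewrite ?oner_eq0 //.
by rewrite !numden_Ratio ?oner_eq0 // !scalerA; congr (_ *: _); ring.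
Qed.

Fact genscaleDr : right_distributive genscale +%R.
Proof.
elim/quotW=> a; elim/genW=> m d d0; elim/genW=> m' d' d0'.
rewrite -[X in genscale _ X]/(genadd _ _) -[RHS]/(genadd _ _) genaddE !genscaleE genaddE.
apply: genmk_eq; exists 1; rewrite ?oner_eq0 //.
by rewrite !scalerDr !scalerA; congr (_ *: _ + _ *: _); ring.
Qed.

Fact genscaleDl x : {morph genscale^~ x : a b / a + b}.
Proof.
elim/quotW=> a; elim/quotW=> b; elim/genW: x => m d d0.
have -> : \pi_({fraction D}) a + \pi_({fraction D}) b = \pi_({fraction D}) (FracField.addf a b) by rewrite -[LHS]FracField.pi_add.
rewrite -[RHS]/(genadd _ _) !genscaleE genaddE.
apply: genmk_eq; exists 1; rewrite ?oner_eq0 //.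
rewrite /FracField.addf !numden_Ratio ?mulf_neq0 ?denom_ratioP //.
by rewrite !scalerDr !scalerA -scalerDl; congr (_ *: _); ring.
Qed.

HB.instance Definition _ := GRing.Zmodule_isLmodule.Build {fraction D} genmod
  genscaleA genscale1 genscaleDr genscaleDl.

End GenericFibre.

Section GenericMap.
Variables (D : idomainType) (M N : lmodType D) (A : {linear M -> N}).

Definition genmap (x : genmod M) : genmod N :=
  genmk (A (repr x).1) (mfrac_den (repr x)).

Lemma genmapE m d d0 : genmap (@genmk D M m d d0) = genmk (A m) d0.
Proof.
have [s s0 e] := genmk_eqP (genrepr (genmk m d0)).
by apply: genmk_eq; exists s => //; rewrite -!linearZ /= e.
Qed.

Fact genmap_linear : linear genmap.
Proof.
elim/quotW=> a; elim/genW=> m d d0; elim/genW=> m' d' d0'.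
have genE (V : lmodType D) (u v : V) :
    \pi_({fraction D}) a *: genmk u d0 + genmk v d0' =
    genmk (d' *: (a.1 *: u) + (a.2 * d) *: v)
          (mulf_neq0 (mulf_neq0 (denom_ratioP a) d0) d0').
  by rewrite -[LHS]/(genadd (genscale _ _) _) genscaleE genaddE.
rewrite genE !genmapE genE; apply: genmk_eq; exists 1; rewrite ?oner_eq0 //.
by congr (_ *: _); rewrite (linearD A) !(linearZ_LR A).
Qed.
HB.instance Definition _ :=
  GRing.isLinear.Build {fraction D} (genmod M) (genmod N) _ genmap genmap_linear.

End GenericMap.

(* M / (T - z) M, where the variable T of the coefficient ring is 'X. *)
Section Fibre.
Variables (K : comNzRingType).

Definition fibre (M : lmodType {poly K}) (z : K) : lmodType {poly K} :=
  quotmod (range (fun m : M => ('X - z%:P) *: m)).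

Variables (M N : lmodType {poly K}) (A : {linear M -> N}) (z : K).

Definition fibre_map (x : fibre M z) : fibre N z := qproj _ (A (repr x)).

Lemma fibre_mapE m : fibre_map (qproj _ m) = qproj _ (A m).
Proof.
apply/eqP; rewrite /fibre_map qproj_eq -linearB.
set u := _ - m; have : u \in linspan (range (fun m : M => ('X - z%:P) *: m)).
  by rewrite -qproj_eq /qproj reprK.
move=> /asboolP[n [a [c [ha ->]]]]; rewrite linear_sum.
apply: rpred_sum => i _; rewrite linearZ; apply: rpredZ; apply: linspan_gen.
by have [m' _ <-] := ha i; exists (A m') => //; rewrite linearZ.
Qed.

Fact fibre_map_linear : linear fibre_map.
Proof.
move=> p; elim/quotW=> x; elim/quotW=> y; rewrite -!/(qproj _ _).
by rewrite -linearP !fibre_mapE !linearP.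
Qed.
HB.instance Definition _ := GRing.isLinear.Build {poly K} (fibre M z) (fibre N z)
  _ fibre_map fibre_map_linear.

End Fibre.
Arguments fibre_map {K M N} A z x.

(* Sections z |-> s z of a family of vector spaces over the affine line: T acts
   as multiplication by z, hence p acts as multiplication by p.[z]. *)
Section Sections.
Variables (K : comNzRingType) (E : K -> lmodType K).

Definition sections : Type := forall z, E z.
HB.instance Definition _ := gen_eqMixin sections.
HB.instance Definition _ := gen_choiceMixin sections.
Implicit Types s t : sections.

Let sec0 : sections := fun=> 0.
Let secN s : sections := fun z => - s z.
Let secD s t : sections := fun z => s z + t z.
Let secZ (p : {poly K}) s : sections := fun z => p.[z] *: s z.

Let secE s t : (forall z, s z = t z) -> s = t.
Proof. by move=> e; apply: functional_extensionality_dep. Qed.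

Fact secDA : associative secD.
Proof. by move=> s t u; apply: secE => z; rewrite /secD addrA. Qed.
Fact secDC : commutative secD.
Proof. by move=> s t; apply: secE => z; rewrite /secD addrC. Qed.
Fact sec0D : left_id sec0 secD.
Proof. by move=> s; apply: secE => z; rewrite /secD add0r. Qed.
Fact secND : left_inverse sec0 secN secD.
Proof. by move=> s; apply: secE => z; rewrite /secD addNr. Qed.
HB.instance Definition _ := GRing.isZmodule.Build sections secDA secDC sec0D secND.

Fact secZA p q s : secZ p (secZ q s) = secZ (p * q) s.
Proof. by apply: secE => z; rewrite /secZ scalerA hornerM. Qed.
Fact sec1Z : left_id 1 secZ.
Proof. by move=> s; apply: secE => z; rewrite /secZ hornerC scale1r. Qed.
Fact secZDr : right_distributive secZ +%R.
Proof. by move=> p s t; apply: secE => z; rewrite /secZ scalerDr. Qed.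
Fact secZDl s : {morph secZ^~ s : p q / p + q}.
Proof. by move=> p q; apply: secE => z; rewrite /secZ hornerD scalerDl. Qed.
HB.instance Definition _ :=
  GRing.Zmodule_isLmodule.Build {poly K} sections secZA sec1Z secZDr secZDl.

End Sections.

Section HarishChandra.
Variable K : fieldType.

Definition orthogonal_mx {F : comUnitRingType} : pred 'M[F]_3 :=
  [pred k | k^T *m k == 1%:M].

(* 'I_3 carries the cyclic addition, so (i, i + 1, i + 2) runs through the even
   permutations of the three indices. *)
Definition cross (F : comNzRingType) (a b : 'cV[F]_3) : 'cV[F]_3 :=
  \col_i (a (i + 1) 0 * b (i + 2) 0 - a (i + 2) 0 * b (i + 1) 0).

(* (a, b) stands for \sum_i (a i *: L_i + b i *: R_i): g is O-free on the L_i
   and R_i. The bracket encodes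
     [L_i, L_j] = - eps_ijk L_k,  [R_i, R_j] = eps_ijk T L_k,
     [L_i, R_j] = - eps_ijk R_k. *)
Definition lie_g : Type := ('cV[{poly K}]_3 * 'cV[{poly K}]_3)%type.
HB.instance Definition _ := GRing.Lmodule.on lie_g.

Definition bracket (X Y : lie_g) : lie_g :=
  (- cross X.1 Y.1 + 'X *: cross X.2 Y.2, - cross X.1 Y.2 - cross X.2 Y.1).

(* Conjugation by the operator f |-> f \o B^-1, B = (\det k)^-1 *: k, maps L_i
   to \sum_j B j i *: L_j and R_i to \sum_j B j i *: R_j; the same polynomial
   formula defines the action of the complex group. *)
Definition Ad (k : 'M[K]_3) (X : lie_g) : lie_g :=
  let B := map_mx polyC ((\det k)^-1 *: k) in (B *m X.1, B *m X.2).

Definition so3 : pred 'M[K]_3 := [pred x | x^T == - x].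

(* The derivative at t = 0 of f |-> f \o exp(- t x) is the vector field
   - \sum_(i, j) x i j * x_j d_i, which is
   x 1 2 *: L_0 + x 2 0 *: L_1 + x 0 1 *: L_2. *)
Definition so3_lie (x : 'M[K]_3) : lie_g :=
  (\col_i (x (i + 1) (i + 2))%:P, 0).

Definition mxpoly_eval (p : mpoly.mpoly (3 * 3) K) (k : 'M[K]_3) : K :=
  mpoly.meval (fun i => mxvec k 0 i) p.

(* The differential of p at the identity matrix, in the direction x. *)
Definition mxpoly_diff1 (p : mpoly.mpoly (3 * 3) K) (x : 'M[K]_3) : K :=
  \sum_i mxvec x 0 i * mxpoly_eval (mpoly.mderiv i p) 1%:M.

Definition free_basis (O : pzRingType) (M : lmodType O) (U : set M)
    (I : Type) (b : I -> M) : Prop :=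
  [/\ forall i, U (b i),
      forall m, U m -> exists n (i : 'I_n -> I) (c : 'I_n -> O),
        m = \sum_j c j *: b (i j) &
      forall n (i : 'I_n -> I) (c : 'I_n -> O),
        injective i -> \sum_j c j *: b (i j) = 0 -> forall j, c j = 0].

Section Actions.
Variables (M : lmodType {poly K}) (act : 'M[K]_3 -> M -> M).

Definition acts_by n (e : 'I_n -> M) (rho : 'M[K]_3 -> 'M[K]_n) : Prop :=
  forall k, orthogonal_mx k -> forall j, act k (e j) = \sum_i (rho k i j)%:P *: e i.

Definition algebraic_mx n (rho : 'I_n -> 'I_n -> mpoly.mpoly (3 * 3) K)
    (k : 'M[K]_3) : 'M[K]_n := \matrix_(i, j) mxpoly_eval (rho i j) k.

Definition locally_algebraic : Prop := forall m : M,
  exists n (e : 'I_n -> M) (rho : 'I_n -> 'I_n -> mpoly.mpoly (3 * 3) K),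
    acts_by e (algebraic_mx rho) /\
    exists c : 'I_n -> K, m = \sum_i (c i)%:P *: e i.

Definition irreducible_rep n (tau : 'M[K]_3 -> 'M[K]_n) : Prop :=
  [/\ (0 < n)%N, tau 1%:M = 1%:M,
      {in orthogonal_mx &, forall k k', tau (k *m k') = tau k *m tau k'} &
      forall U : 'M[K]_n, {in orthogonal_mx, forall k, stablemx U (tau k)^T} ->
        U = 0 \/ row_full U].

(* The images of the equivariant maps from tau to M are spanned by the families
   e on which K acts through the matrices tau k. *)
Definition isotypical n (tau : 'M[K]_3 -> 'M[K]_n) : set M :=
  [set m | m \in linspan [set m' | exists e : 'I_n -> M,
             acts_by e tau /\ exists j, m' = e j]].

End Actions.

Record HCfamily (M : lmodType {poly K}) := {
  kact : 'M[K]_3 -> M -> M;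
  gact : lie_g -> M -> M;
  hc_free : exists (I : Type) (b : I -> M), free_basis setT b;
  kact_linear : {in orthogonal_mx, forall k, linear (kact k)};
  kact1 : forall m, kact 1%:M m = m;
  kactM : {in orthogonal_mx &, forall k k' m, kact (k *m k') m = kact k (kact k' m)};
  kact_algebraic : locally_algebraic kact;
  isotypical_free : forall n (tau : 'I_n -> 'I_n -> mpoly.mpoly (3 * 3) K),
    irreducible_rep (algebraic_mx tau) ->
    exists d (b : 'I_d -> M), free_basis (isotypical kact (algebraic_mx tau)) b;
  gact_linearl : forall m, linear (gact^~ m);
  gact_linearr : forall X, linear (gact X);
  gact_bracket : forall X Y m,
    gact (bracket X Y) m = gact X (gact Y m) - gact Y (gact X m);
  gact_kact : {in orthogonal_mx, forall k X m,
    kact k (gact X m) = gact (Ad k X) (kact k m)};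
  (* the restriction of gact to so(3) is the differential of kact *)
  gact_so3 : forall n (e : 'I_n -> M) rho, acts_by kact e (algebraic_mx rho) ->
    {in so3, forall x j,
      gact (so3_lie x) (e j) = \sum_i (mxpoly_diff1 (rho i j) x)%:P *: e i} }.

Definition intertwining (M N : lmodType {poly K}) (hM : HCfamily M)
    (hN : HCfamily N) (A : {linear M -> N}) : Prop :=
  {in orthogonal_mx, forall k m, A (kact hM k m) = kact hN k (A m)} /\
  (forall X m, A (gact hM X m) = gact hN X (A m)).

End HarishChandra.

Section Functions.
Variable R : realType.
Notation C := R[i].
Implicit Types (i : 'I_3).

Definition punctured : Type := {x : 'cV[R]_3 | x != 0}.
Notation Fun := (punctured -> C).
Implicit Types f g : Fun.

(* Extension by 0 at the origin, to differentiate functions on the punctured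
   space with the library's derivative; only values near points x != 0 matter. *)
Definition extend0 f (x : 'cV[R]_3) : C := oapp f 0 (insub x).

Definition pderiv i f : Fun := fun x =>
  ('D_(delta_mx i 0) (fun y => complex.Re (extend0 f y)) (val x) +i*
   'D_(delta_mx i 0) (fun y => complex.Im (extend0 f y)) (val x))%C.

Definition smooth f : Prop := forall (s : seq 'I_3) (x : punctured),
  differentiable (fun y => complex.Re (extend0 (foldr pderiv f s) y)) (val x) /\
  differentiable (fun y => complex.Im (extend0 (foldr pderiv f s) y)) (val x).

Definition enorm (x : 'cV[R]_3) : R := Num.sqrt (\sum_i x i 0 ^+ 2).

Definition coordmul i f : Fun := fun x => (val x i 0)%:C%C * f x.

Definition angmom i f : Fun :=
  coordmul (i + 1) (pderiv (i + 2) f) - coordmul (i + 2) (pderiv (i + 1) f).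

Variable gamma : R.

(* With 0-based cyclic indices, R_i = sqrt(-1) (L_(i+2) d_(i+1) - L_(i+1) d_(i+2)
   - d_i + gamma x_i / r). *)
Definition rungelenz i f : Fun :=
  'i%C *: (angmom (i + 2) (pderiv (i + 1) f) - angmom (i + 1) (pderiv (i + 2) f)
          - pderiv i f
          + (fun x => (gamma * val x i 0 / enorm (val x))%:C%C * f x)).

Definition laplacian f : Fun := \sum_i pderiv i (pderiv i f).

Definition schrodinger f : Fun := fun x =>
  - laplacian f x - (2 * gamma / enorm (val x))%:C%C * f x.

(* The operator of X on functions f with T f = z f: p(T) acts as p.[z]. *)
Definition gop (X : lie_g C) (z : C) f : Fun :=
  \sum_i ((X.1 i 0).[z] *: angmom i f + (X.2 i 0).[z] *: rungelenz i f).

Definition point_act (A : 'M[R]_3) (v : 'cV[R]_3) : 'cV[R]_3 :=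
  (\det A)^-1 *: (A *m v).

Definition fun_act (A : 'M[R]_3) f : Fun :=
  fun x => extend0 f (point_act (invmx A) (val x)).

Definition Kfinite f : Prop := exists n (g : 'I_n -> Fun),
  forall A, orthogonal_mx A -> exists c : 'I_n -> C, fun_act A f = \sum_i c i *: g i.

Lemma extend0D f g y : extend0 (f + g) y = extend0 f y + extend0 g y.
Proof. by rewrite /extend0; case: insub => //=; rewrite addr0. Qed.

Lemma extend0Z (c : C) f y : extend0 (c *: f) y = c * extend0 f y.
Proof. by rewrite /extend0; case: insub => //=; rewrite mulr0. Qed.

Lemma extend0_Re c f g : (fun y => complex.Re (extend0 (c *: f + g) y)) =
  complex.Re c *: (fun y => complex.Re (extend0 f y)) +
  (- complex.Im c) *: (fun y => complex.Im (extend0 f y)) +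
  (fun y => complex.Re (extend0 g y)) :> ('cV[R]_3 -> R).
Proof.
apply/funext => y; rewrite extend0D extend0Z !fctE /GRing.scale /= mulNr.
by case: c => a b; case: (extend0 f y) => u v; case: (extend0 g y).
Qed.

Lemma extend0_Im c f g : (fun y => complex.Im (extend0 (c *: f + g) y)) =
  complex.Re c *: (fun y => complex.Im (extend0 f y)) +
  complex.Im c *: (fun y => complex.Re (extend0 f y)) +
  (fun y => complex.Im (extend0 g y)) :> ('cV[R]_3 -> R).
Proof.
apply/funext => y; rewrite extend0D extend0Z !fctE /GRing.scale /=.
by case: c => a b; case: (extend0 f y) => u v; case: (extend0 g y).
Qed.

Lemma derive_comb (a b : R) (u v w : 'cV[R]_3 -> R) x d :
  derivable u x d -> derivable v x d -> derivable w x d ->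
  'D_d (a *: u + b *: v + w) x = a * 'D_d u x + b * 'D_d v x + 'D_d w x.
Proof.
move=> du dv dw; have dau := derivableZ (k := a) du.
have dbv := derivableZ (k := b) dv; have dab := derivableD dau dbv.
by rewrite (deriveD dab dw) (deriveD dau dbv) (deriveZ _ du) (deriveZ _ dv).
Qed.

Lemma differentiable_comb (a b : R) (u v w : 'cV[R]_3 -> R) x :
  differentiable u x -> differentiable v x -> differentiable w x ->
  differentiable (a *: u + b *: v + w) x.
Proof.
move=> du dv dw; have dau := differentiableZ a du.
have dbv := differentiableZ b dv; have dab := differentiableD dau dbv.
exact: (differentiableD dab dw).
Qed.

Lemma pderiv_linear i c f g : smooth f -> smooth g ->
  pderiv i (c *: f + g) = c *: pderiv i f + pderiv i g.
Proof.
move=> sf sg; apply/funext => x.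
have [/diff_derivable df1 /diff_derivable df2] := sf [::] x.
have [/diff_derivable dg1 /diff_derivable dg2] := sg [::] x.
rewrite /pderiv extend0_Re extend0_Im.
rewrite (derive_comb _ _ (df1 _) (df2 _) (dg1 _)).
rewrite (derive_comb _ _ (df2 _) (df1 _) (dg2 _)).
by rewrite !fctE mulNr; case: c.
Qed.

Lemma iter_pderiv_linear s c f g : smooth f -> smooth g ->
  foldr pderiv (c *: f + g) s = c *: foldr pderiv f s + foldr pderiv g s.
Proof.
move=> sf sg; elim: s => //= i s ->; rewrite pderiv_linear // => t.
- by rewrite -foldr_cat; apply: sf.
- by rewrite -foldr_cat; apply: sg.
Qed.

Lemma smooth_linear c f g : smooth f -> smooth g -> smooth (c *: f + g).
Proof.
move=> sf sg s x; rewrite iter_pderiv_linear // extend0_Re extend0_Im.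
have [df1 df2] := sf s x; have [dg1 dg2] := sg s x.
split; first exact: (differentiable_comb _ _ df1 df2 dg1).
exact: (differentiable_comb _ _ df2 df1 dg2).
Qed.

Lemma smooth_pderiv i f : smooth f -> smooth (pderiv i f).
Proof.
by move=> sf s; rewrite -[pderiv i f]/(foldr pderiv f [:: i]) -foldr_cat; apply: sf.
Qed.

Lemma extend0_0 : extend0 (0 : Fun) = cst 0.
Proof. by apply/funext => y; rewrite /extend0; case: insub. Qed.

Lemma smooth0 : smooth (0 : Fun).
Proof.
have e : forall s, foldr pderiv (0 : Fun) s = 0.
  elim=> //= i s ->; apply/funext => x; rewrite /pderiv extend0_0 /=.
  by rewrite !derive_cst.
by move=> s x; rewrite e extend0_0 /=; split; apply: differentiable_cst.
Qed.

Lemma laplacian_linear c f g : smooth f -> smooth g ->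
  laplacian (c *: f + g) = c *: laplacian f + laplacian g.
Proof.
move=> sf sg; rewrite /laplacian scaler_sumr -big_split; apply: eq_bigr => i _ /=.
rewrite (pderiv_linear i c sf sg).
exact: (pderiv_linear i c (smooth_pderiv i sf) (smooth_pderiv i sg)).
Qed.

Lemma schrodinger_linear c f g : smooth f -> smooth g ->
  schrodinger (c *: f + g) = c *: schrodinger f + schrodinger g.
Proof.
move=> sf sg; apply/funext => x.
have e := congr1 (fun h : Fun => h x) (laplacian_linear c sf sg).
transitivity (- (c * laplacian f x + laplacian g x)
  - (2 * gamma / enorm (val x))%:C%C * (c * f x + g x)).
  by rewrite -[c * _ + _]e.
transitivity (c * (- laplacian f x - (2 * gamma / enorm (val x))%:C%C * f x)
  + (- laplacian g x - (2 * gamma / enorm (val x))%:C%C * g x)); last by [].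
by move: (f x) (g x) (laplacian _ x) (laplacian _ x) (_%:C)%C => fx gx v w q; ring.
Qed.

Lemma fun_act_linear A c f g :
  fun_act A (c *: f + g) = c *: fun_act A f + fun_act A g.
Proof. by apply/funext => x; rewrite /fun_act extend0D extend0Z. Qed.

Lemma Kfinite_linear c f g : Kfinite f -> Kfinite g -> Kfinite (c *: f + g).
Proof.
move=> [m [u hu]] [n [v hv]]; exists (m + n)%N.
exists (fun h => match fintype.split h with inl j => u j | inr j => v j end).
move=> A oA; have [a ea] := hu A oA; have [b eb] := hv A oA.
exists (fun h => match fintype.split h with inl j => c * a j | inr j => b j end).
rewrite fun_act_linear ea eb big_split_ord /= scaler_sumr.
congr (_ + _); apply: eq_bigr => h _.
  by rewrite (unsplitK (inl h)) scalerA.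
by rewrite (unsplitK (inr h)).
Qed.

Lemma Kfinite0 : Kfinite (0 : Fun).
Proof.
exists 0%N, (fun=> 0) => A _; exists (fun=> 0); rewrite big_ord0.
by apply/funext => x; rewrite /fun_act extend0_0.
Qed.

Section Solutions.
Variable z : C.

Definition is_solution : {pred Fun} := fun f =>
  `[< [/\ smooth f, Kfinite f & schrodinger f = z *: f] >].

Fact is_solution_submod : GRing.submod_closed is_solution.
Proof.
split=> [|c f g /asboolP[sf kf ef] /asboolP[sg kg eg]]; apply/asboolP.
  split; [exact: smooth0|exact: Kfinite0|].
  have := schrodinger_linear 0 smooth0 smooth0.
  rewrite scaler0 addr0 scale0r add0r scaler0 => h.
  have := schrodinger_linear 1 smooth0 smooth0; rewrite scaler0 addr0 scale1r.
  by move=> /eqP; rewrite -subr_eq0 opprD addNKr oppr_eq0 => /eqP.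
split; [exact: smooth_linear|exact: Kfinite_linear|].
by rewrite schrodinger_linear // ef eg scalerDr !scalerA mulrC.
Qed.
HB.instance Definition _ :=
  GRing.isSubmodClosed.Build C Fun is_solution is_solution_submod.

Record Sol := MkSol { Sol_fun :> Fun; SolP : Sol_fun \in is_solution }.
HB.instance Definition _ := [isSub for Sol_fun].
HB.instance Definition _ := [Choice of Sol by <:].
HB.instance Definition _ := [SubChoice_isSubLmodule of Sol by <:].

End Solutions.

Definition cderiv (u : R -> C) (r : R) : C :=
  (((fun t => complex.Re (u t))^`()) r +i* ((fun t => complex.Im (u t))^`()) r)%C.

Definition cderivable (u : R -> C) (r : R) : Prop :=
  derivable (fun t => complex.Re (u t)) r 1 /\
  derivable (fun t => complex.Im (u t)) r 1.

Definition power_sum (a : nat -> C) (w s : C) : Prop :=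
  series (fun k => complex.Re (a k * w ^+ k)) @ \oo --> complex.Re s /\
  series (fun k => complex.Im (a k * w ^+ k)) @ \oo --> complex.Im s.

Definition entire_coef (a : nat -> C) : Prop :=
  forall w : C, exists s : C, power_sum a w s.

Definition radial_solution (l : nat) (z : C) (u : R -> C) : Prop :=
  forall r : R, 0 < r ->
  [/\ cderivable u r, cderivable (cderiv u) r &
      (r%:C ^+ 2 * cderiv (cderiv u) r + 2 * r%:C * cderiv u r
       - (l * l.+1)%:R * u r + 2 * gamma%:C * r%:C * u r
       + z * r%:C ^+ 2 * u r = 0)%C].

(* F extends to the entire function with Taylor coefficients a, and
   F(r) = r ^+ l + higher order terms. *)
Definition regular_radial (l : nat) (z : C) (F : R -> C) : Prop :=
  radial_solution l z F /\
  exists a : nat -> C,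
    [/\ entire_coef a,
        forall k, (k < l)%N -> a k = 0,
        a l = 1 &
        forall r : R, 0 < r -> power_sum a r%:C%C (F r)].

(* H(r) = r ^- l.+1 * \sum_k b_k r ^+ k is meromorphic, with a pole of order
   l.+1 at 0 of leading coefficient b_0 = 1. G is determined up to multiples
   of F. *)
Definition singular_radial (l : nat) (z : C) (G : R -> C) : Prop :=
  radial_solution l z G /\
  exists (F H : R -> C) (c : C) (b : nat -> C),
    [/\ regular_radial l z F,
        entire_coef b,
        b 0%N = 1,
        forall r : R, 0 < r -> power_sum b r%:C%C (r%:C%C ^+ l.+1 * H r) &
        forall r : R, 0 < r -> G r = H r + c * (ln r)%:C%C * F r].

Definition harmonic_poly (l : nat) (P : mpoly.mpoly 3 C) : Prop :=
  P \is mpoly.ishomog1 l (@mpoly.mdeg 3) /\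
  \sum_(i < 3) mpoly.mderiv i (mpoly.mderiv i P) = 0.

(* The spherical harmonic x |-> P (x / r) of degree l, for P harmonic and
   homogeneous of degree l. *)
Definition spherical (P : mpoly.mpoly 3 C) : Fun := fun x =>
  mpoly.meval (fun i => (val x i 0 / enorm (val x))%:C%C) P.

Definition separated_fun (u : R -> C) (P : mpoly.mpoly 3 C) : Fun := fun x =>
  u (enorm (val x)) * spherical P x.

Definition reg_gen (z : C) : set (Sol z) :=
  [set psi | exists l F P, [/\ regular_radial l z F, harmonic_poly l P &
                              Sol_fun psi = separated_fun F P]].

Definition RegSol (z : C) : lmodType C := submod (@reg_gen z).
Definition SingSol (z : C) : lmodType C := quotmod (@reg_gen z).

Definition regular_family : lmodType {poly C} := submod
  [set s : sections RegSol | exists (p : {poly C}) l P, harmonic_poly l P /\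
    forall z, exists2 F, regular_radial l z F &
      Sol_fun (subval (s z)) = p.[z] *: separated_fun F P].

Definition singular_family : lmodType {poly C} := submod
  [set s : sections SingSol | exists (p : {poly C}) l P, harmonic_poly l P /\
    forall z, exists G (psi : Sol z), [/\ singular_radial l z G,
      Sol_fun psi = separated_fun G P & s z = p.[z] *: qproj _ psi]].

(* f is a function on the punctured space representing the vector e. *)
Definition reg_rep z (e : RegSol z) f : Prop := Sol_fun (subval e) = f.
Definition sing_rep z (e : SingSol z) f : Prop :=
  exists2 psi : Sol z, Sol_fun psi = f & e = qproj _ psi.

(* g acts on sections pointwise in z through its action on functions, and so do
   the real points O(3) of K. This determines the action of K, which is
   algebraic, since O(3) is Zariski dense in K. *)
Definition pointwise (E : C -> lmodType C) (rep : forall z, E z -> Fun -> Prop)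
    (U : set (sections E)) (h : HCfamily (submod U)) : Prop :=
  forall (s : submod U) z f, rep z (subval s z) f ->
    (forall X, rep z (subval (gact h X s) z) (gop X z f)) /\
    (forall A : 'M[R]_3, orthogonal_mx A ->
       rep z (subval (kact h (map_mx (real_complex R) A) s) z) (fun_act A f)).

Definition regular_actions (h : HCfamily regular_family) : Prop :=
  pointwise reg_rep h.
Definition singular_actions (h : HCfamily singular_family) : Prop :=
  pointwise sing_rep h.

End Functions.

(* Main.v *)
(* The Runge-Lenz operators map u(r) Y, with Y a spherical harmonic of degree l, to
   functions of degrees l + 1 and l - 1 whose radial factors are first order
   operators applied to u. On the normalized solutions these factors are, with
   a_l = gamma^2 + z (l + 1)^2,
     F_l |-> - a_l / ((2 l + 3) (l + 1)) F_(l+1),  F_(l+1) |-> (l + 1) (2 l + 3) F_l,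
     G_l |-> - (l + 1) (2 l + 1) G_(l+1),          G_(l+1) |-> a_l / ((2 l + 1) (l + 1)) G_l,
   the last two modulo regular solutions. Hence [G_l Y] |-> c_l F_l Y commutes with
   g and with O(3) when c_0 = 1 and c_(l+1) = c_l a_l / ((2 l + 1) (2 l + 3) (l + 1)^2);
   it commutes with K because O(3) is Zariski dense in K. The c_l are nonzero
   polynomials in z and c_0 = 1, so this operator is generically invertible and
   nonzero in every fibre.
   Conversely the vector [G_0] generates the singular family over C[T] and g,
   since sum_i R_i [G_l d_i P] is a nonzero multiple of [G_(l+1) P]. The image of
   [G_0] under an intertwining operator is killed by the L_i, hence is p(T) F_0 for
   some polynomial p, so the operator is p(T) times the one above; if it is nonzero
   in every fibre, p has no root. *)
From HB Require Import structures.
Require Import Defs.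
From mathcomp Require Import all_boot all_order all_algebra.
From mathcomp Require Import all_classical all_reals all_analysis.
From mathcomp Require Import complex.
From mathcomp Require Import ring lra zify.
From mathcomp Require mpoly.
Import (canonicals, coercions) mpoly.
Import Order.TTheory GRing.Theory Num.Theory.
Import numFieldNormedType.Exports.
Set Implicit Arguments.
Unset Strict Implicit.
Unset Printing Implicit Defensive.
Local Open Scope ring_scope.
Local Open Scope classical_set_scope.

(** * Complex-valued functions and power series *)

(** Nothing is assumed about how F_l and G_l depend on z: [Freg] and [Gsing] are picked separately
    at every z, and only the ladder constants are polynomials in z. These constants do not come from
    explicit solutions. The radial operators [rup] and [rdown] send solutions of one radial equation
    to solutions of the neighbouring one, and a solution with given leading behaviour at 0 is unique
    (modulo F_l in the singular case). So each constant is a leading coefficient, read off from at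
    most three Frobenius coefficients. The prescription on generators must also be shown to define a
    map, since no basis of either family is at hand. A finite formal combination of generators
    vanishes in one family exactly when it vanishes in the other: both conditions mean that its
    harmonic component of each degree vanishes on the unit sphere, at each z. This rests on two
    independence facts: different degrees are told apart by the Casimir operator of so(3), and G_l
    is never proportional to F_l. *)

Section ComplexDerivative.
Variables (R : realType) (V : normedModType R).
Notation C := R[i].
Implicit Types (f g : V -> C) (x v : V).

Definition is_cd f x v (d : C) : Prop :=
  is_derive x v (fun y => complex.Re (f y)) (complex.Re d) /\
  is_derive x v (fun y => complex.Im (f y)) (complex.Im d).

Definition cdiff f x : Prop :=
  differentiable (fun y => complex.Re (f y)) x /\
  differentiable (fun y => complex.Im (f y)) x.

Lemma is_cd_near f g x v d : (\near x, f x = g x) -> is_cd f x v d -> is_cd g x v d.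
Proof.
move=> fg [df1 df2]; split; first apply: near_eq_is_derive df1; last apply: near_eq_is_derive df2.
  by near do congr (complex.Re _).
by near do congr (complex.Im _).
Unshelve. all: by end_near. Qed.

Lemma is_cd_inj f x v d d' : is_cd f x v d -> is_cd f x v d' -> d = d'.
Proof.
move=> [[_ e1] [_ e2]] [[_ e3] [_ e4]].
by apply/eqP; rewrite eq_complex -e1 -e2 e3 e4 !eqxx.
Qed.

Lemma is_cd_cst (c : C) x v : is_cd (fun=> c) x v 0.
Proof. by split; apply: is_derive_cst. Qed.

Lemma is_cd_eq f x v d d' : is_cd f x v d -> d = d' -> is_cd f x v d'.
Proof. by move=> ? <-. Qed.

Lemma complexReD (a b : C) : complex.Re (a + b) = complex.Re a + complex.Re b.
Proof. by case: a => ? ?; case: b. Qed.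

Lemma complexImD (a b : C) : complex.Im (a + b) = complex.Im a + complex.Im b.
Proof. by case: a => ? ?; case: b. Qed.

Lemma is_cdD f g x v d e : is_cd f x v d -> is_cd g x v e ->
  is_cd (fun y => f y + g y) x v (d + e).
Proof.
move=> [a b] [c h]; split.
  have := is_deriveD a c; rewrite -raddfD /=; congr (is_derive _ _ _ _).
  by apply/funext => y; rewrite raddfD.
have := is_deriveD b h; rewrite -raddfD /=; congr (is_derive _ _ _ _).
by apply/funext => y; rewrite raddfD.
Qed.

Lemma complexReM (a b : C) :
  complex.Re (a * b) = complex.Re a * complex.Re b - complex.Im a * complex.Im b.
Proof. by case: a => ? ?; case: b. Qed.

Lemma complexImM (a b : C) :
  complex.Im (a * b) = complex.Re a * complex.Im b + complex.Im a * complex.Re b.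
Proof. by case: a => ? ?; case: b. Qed.

Lemma is_cdM f g x v d e : is_cd f x v d -> is_cd g x v e ->
  is_cd (fun y => f y * g y) x v (f x * e + d * g x).
Proof.
move=> [a b] [c h]; split.
  have := is_deriveB (is_deriveM a c) (is_deriveM b h).
  congr (is_derive _ _ _ _).
    by apply/funext => y; rewrite complexReM.
  by rewrite complexReD !complexReM /GRing.scale /=; ring.
have := is_deriveD (is_deriveM a h) (is_deriveM b c).
congr (is_derive _ _ _ _).
  by apply/funext => y; rewrite complexImM.
by rewrite complexImD !complexImM /GRing.scale /=; ring.
Qed.

Lemma is_cdZ (c : C) f x v d : is_cd f x v d -> is_cd (fun y => c * f y) x v (c * d).
Proof.
by move=> df; apply: is_cd_eq (is_cdM (is_cd_cst c x v) df) _; rewrite mul0r addr0.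
Qed.

Lemma is_cd_real (h : V -> R) x v d : is_derive x v h d ->
  is_cd (fun y => (h y)%:C%C) x v d%:C%C.
Proof. by move=> dh; split=> //; apply: is_derive_cst. Qed.

(** The zero map is a differential with zero remainder near [x]. Through differences this transfers
    full differentiability, not only directional derivatives, between functions that agree near a
    point. *)
Lemma near0_differentiable (h : V -> R) x : (\near x, h x = 0) -> differentiable h x.
Proof.
move=> h0; have hx : h x = 0 by exact: nbhs_singleton h0.
apply/diffP => /=.
apply: (@getPex _ (fun (df : {linear V -> R}) => continuous df /\
  forall y, h y = h (lim (nbhs x)) + df (y - lim (nbhs x))
                  +o_(y \near x) (y - lim (nbhs x)))).
exists (\0 : {linear V -> R}); split; first by move=> y; exact: cst_continuous.
apply: eqaddoEx => y; rewrite lim_id // hx /= !add0r.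
rewrite littleoE //= => e e0; near=> t.
have -> : h t = 0 by near: t.
by rewrite normr0 mulr_ge0 // ltW.
Unshelve. all: by end_near. Qed.

Lemma near_differentiable (u w : V -> R) x :
  (\near x, u x = w x) -> differentiable u x -> differentiable w x.
Proof.
move=> uw du; have -> : w = u + (w - u) by apply/funext => y; rewrite !fctE addrC subrK.
apply: differentiableD => //; apply: near0_differentiable.
near=> t; rewrite !fctE; apply/eqP; rewrite subr_eq0 eq_sym; apply/eqP.
by near: t.
Unshelve. all: by end_near. Qed.

Lemma cdiff_near f g x : (\near x, f x = g x) -> cdiff f x -> cdiff g x.
Proof.
move=> fg [df1 df2]; split; first apply: near_differentiable df1; last apply: near_differentiable df2.
  by near do congr (complex.Re _).
by near do congr (complex.Im _).
Unshelve. all: by end_near. Qed.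

Lemma cdiff_cst (c : C) x : cdiff (fun=> c) x.
Proof. by split; apply: differentiable_cst. Qed.

Lemma cdiffD f g x : cdiff f x -> cdiff g x -> cdiff (fun y => f y + g y) x.
Proof.
move=> [a b] [c h]; split.
  have := differentiableD a c; congr (differentiable _ _).
  by apply/funext => y; rewrite complexReD.
have := differentiableD b h; congr (differentiable _ _).
by apply/funext => y; rewrite complexImD.
Qed.

Lemma cdiffM f g x : cdiff f x -> cdiff g x -> cdiff (fun y => f y * g y) x.
Proof.
move=> [a b] [c h]; split.
  have := differentiableB (differentiableM a c) (differentiableM b h).
  congr (differentiable _ _).
  by apply/funext => y; rewrite complexReM.
have := differentiableD (differentiableM a h) (differentiableM b c).
congr (differentiable _ _).
by apply/funext => y; rewrite complexImM.
Qed.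

Lemma cdiff_real (h : V -> R) x : differentiable h x -> cdiff (fun y => (h y)%:C%C) x.
Proof. by move=> dh; split=> //; apply: differentiable_cst. Qed.

End ComplexDerivative.

Section ChainRule.
Variables (R : realType) (V : normedModType R).
Notation C := R[i].

Lemma is_derive_comp1 (u : R -> R) (h : V -> R) x v d e :
  is_derive (h x) 1 u d -> is_derive x v h e -> differentiable h x ->
  is_derive x v (u \o h) (d * e).
Proof.
move=> [du1 du2] [dh1 dh2] dh; have du := iffLR (derivable1_diffP u (h x)) du1.
have duh := differentiable_comp dh du.
apply: DeriveDef; first exact: diff_derivable.
rewrite (deriveE _ duh) (diff_comp dh du) /=.
have -> : 'd h x v = e *: 1 by rewrite -dh2 (deriveE _ dh) /GRing.scale /= mulr1.
by rewrite linearZ -du2 (deriveE _ du) /GRing.scale /= mulrC.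
Qed.

Lemma is_cd_comp (u : R -> C) (h : V -> R) x v d e :
  is_cd u (h x) 1 d -> is_derive x v h e -> differentiable h x ->
  is_cd (fun y => u (h y)) x v (e%:C%C * d).
Proof.
move=> [a b] dh dfh; split.
  rewrite complexReM /= mul0r subr0 mulrC; exact: (is_derive_comp1 a).
rewrite complexImM /= mul0r addr0 mulrC; exact: (is_derive_comp1 b).
Qed.

Lemma cdiff_comp (u : R -> C) (h : V -> R) x d :
  is_cd u (h x) 1 d -> differentiable h x -> cdiff (fun y => u (h y)) x.
Proof.
move=> [[a _] [b _]] dfh; move/derivable1_diffP in a; move/derivable1_diffP in b.
split.
  exact: (@differentiable_comp _ _ _ _ h (fun t => complex.Re (u t)) x dfh a).
exact: (@differentiable_comp _ _ _ _ h (fun t => complex.Im (u t)) x dfh b).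
Qed.

Lemma is_cd_derive (u : R -> C) r d : is_cd u r 1 d -> cderivable u r /\ cderiv u r = d.
Proof.
move=> [[a1 a2] [b1 b2]]; split; first by split.
by rewrite /cderiv (derive1E (fun t => complex.Re (u t))) a2 (derive1E (fun t => complex.Im (u t))) b2; case: (d).
Qed.

Lemma derive_is_cd (u : R -> C) r : cderivable u r -> is_cd u r 1 (cderiv u r).
Proof. move=> [a b]; split; rewrite /cderiv /=.
  by rewrite (derive1E (fun t => complex.Re (u t))); apply: derivableP.
by rewrite (derive1E (fun t => complex.Im (u t))); apply: derivableP.
Qed.

End ChainRule.

Section ComplexNorm.
Variable R : realType.
Notation C := R[i].

(* A norm on the complex numbers with values in R, rather than in R[i]. *)
Definition cn (a : C) : R := `|complex.Re a| + `|complex.Im a|.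

Lemma cn_ge0 a : 0 <= cn a. Proof. by rewrite addr_ge0. Qed.

Lemma cnD a b : cn (a + b) <= cn a + cn b.
Proof.
rewrite /cn complexReD complexImD.
have := ler_normD (complex.Re a) (complex.Re b).
by have := ler_normD (complex.Im a) (complex.Im b); lra.
Qed.

Lemma cnM a b : cn (a * b) <= cn a * cn b.
Proof.
rewrite /cn complexReM complexImM.
have := ler_normB (complex.Re a * complex.Re b) (complex.Im a * complex.Im b).
have := ler_normD (complex.Re a * complex.Im b) (complex.Im a * complex.Re b).
by rewrite !normrM; lra.
Qed.

Lemma cn_real (x : R) a : cn (x%:C%C * a) = `|x| * cn a.
Proof. by rewrite /cn complexReM complexImM /= !mul0r subr0 addr0 !normrM mulrDr. Qed.

Lemma cnX a n : cn (a ^+ n.+1) <= cn a ^+ n.+1.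
Proof.
elim: n => [|n IH]; first by rewrite !expr1.
rewrite exprS [leRHS]exprS; apply: (le_trans (cnM _ _)).
by rewrite ler_pM ?cn_ge0.
Qed.

Lemma Re_le_cn a : `|complex.Re a| <= cn a. Proof. by rewrite lerDl. Qed.
Lemma Im_le_cn a : `|complex.Im a| <= cn a. Proof. by rewrite lerDr. Qed.

End ComplexNorm.

(** * Entire power series evaluated at real points *)

Section EntireSeries.
Variable R : realType.
Notation C := R[i].
Implicit Types (a b : nat -> C) (r : R).

(* Equivalent to entire_coef, but stable under index shifts at sight. *)
Definition ent a : Prop :=
  forall p : R, 0 < p -> exists M : R, forall k, cn (a k) * p ^+ k <= M.

Definition cps a r : C :=
  (limn (pseries (fun k => complex.Re (a k)) r) +i*
   limn (pseries (fun k => complex.Im (a k)) r))%C.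

(** Comparison with the geometric series of ratio [|x| / p]. *)
Lemma rapid_cvg (u : nat -> R) p M x : `|x| < p -> (forall k, `|u k| * p ^+ k <= M) ->
  cvgn (series (fun k => u k * x ^+ k)).
Proof.
move=> xp h; have p0 : 0 < p by exact: le_lt_trans xp.
apply: normed_cvg; apply: (@series_le_cvg _ _ (geometric M (`|x| / p))) => [n|n|n|].
- exact: normr_ge0.
- rewrite /geometric /=; apply: mulr_ge0; last by rewrite exprn_ge0 // divr_ge0 // ltW.
  by apply: le_trans (h 0%N); rewrite expr0 mulr1.
- rewrite /= expr_div_n mulrA ler_pdivlMr ?exprn_gt0 // normrM normrX mulrAC.
  by rewrite ler_wpM2r ?exprn_ge0.
- apply: is_cvg_geometric_series.
  by rewrite ger0_norm ?divr_ge0 // ?(ltW p0) // ltr_pdivrMr // mul1r.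
Qed.

Lemma ent_rapid a : ent a -> forall x : R, exists M p, `|x| < p /\ forall k, cn (a k) * p ^+ k <= M.
Proof.
move=> ea x; have p0 : 0 < `|x| + 1 by rewrite ltr_wpDl.
by have [M hM] := ea _ p0; exists M, (`|x| + 1); rewrite ltrDl.
Qed.

Lemma ent_cvg_Re a r : ent a -> cvgn (pseries (fun k => complex.Re (a k)) r).
Proof.
move=> /ent_rapid/(_ r)[M [p [rp h]]]; apply: (rapid_cvg rp) => k; apply: le_trans (h k).
by rewrite ler_wpM2r ?Re_le_cn // exprn_ge0 // (le_trans _ (ltW rp)).
Qed.

Lemma ent_cvg_Im a r : ent a -> cvgn (pseries (fun k => complex.Im (a k)) r).
Proof.
move=> /ent_rapid/(_ r)[M [p [rp h]]]; apply: (rapid_cvg rp) => k; apply: le_trans (h k).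
by rewrite ler_wpM2r ?Im_le_cn // exprn_ge0 // (le_trans _ (ltW rp)).
Qed.

Lemma real_complexX r k : (r%:C ^+ k = (r ^+ k)%:C)%C.
Proof. by rewrite rmorphXn. Qed.

Lemma Re_realX (c : C) r k : complex.Re (c * r%:C%C ^+ k) = complex.Re c * r ^+ k.
Proof. by rewrite real_complexX complexReM /= mulr0 subr0. Qed.

Lemma Im_realX (c : C) r k : complex.Im (c * r%:C%C ^+ k) = complex.Im c * r ^+ k.
Proof. by rewrite real_complexX complexImM /= mulr0 add0r. Qed.

Lemma cps_power_sum a r : ent a -> power_sum a r%:C%C (cps a r).
Proof.
move=> ea; split; rewrite /cps /=.
  by under eq_fun do rewrite Re_realX; apply: ent_cvg_Re.
by under eq_fun do rewrite Im_realX; apply: ent_cvg_Im.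
Qed.

Lemma power_sum_cps a r s : power_sum a r%:C%C s -> s = cps a r.
Proof.
move=> [h1 h2]; apply/eqP; rewrite eq_complex; apply/andP; split; apply/eqP.
  by rewrite -(cvg_lim _ h1) //; under eq_fun do rewrite Re_realX.
by rewrite -(cvg_lim _ h2) //; under eq_fun do rewrite Im_realX.
Qed.

Lemma ent_entire a : ent a -> entire_coef a.
Proof.
(* A radius of at least twice the size of w leaves a factor 2^-k in the terms at w; the summand 1
   keeps the radius positive when w = 0. *)
move=> ea w; have p0 : 0 < 2 * cn w + 1 by have := cn_ge0 w; lra.
have [M h] := ea _ p0.
have b k : cn (a k * w ^+ k) * 2 ^+ k <= M.
  apply: le_trans (h k); apply: (@le_trans _ _ (cn (a k) * cn w ^+ k * 2 ^+ k)).
    rewrite ler_wpM2r ?exprn_ge0 //; case: k => [|k]; first by rewrite !expr0 !mulr1.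
    by apply: (le_trans (cnM _ _)); rewrite ler_wpM2l ?cn_ge0 ?cnX.
  rewrite -mulrA -exprMn ler_wpM2l ?cn_ge0 // lerXn2r ?nnegrE ?mulr_ge0 ?cn_ge0 //.
    exact: ltW.
  by rewrite mulrC; lra.
have c (u : nat -> R) : (forall k, `|u k| <= cn (a k * w ^+ k)) -> cvgn (series u).
  move=> hu; have -> : u = fun k => u k * 1 ^+ k by apply/funext => k; rewrite expr1n mulr1.
  apply: (@rapid_cvg _ 2 M); first by rewrite normr1; lra.
  by move=> k; apply: le_trans (b k); rewrite ler_wpM2r ?exprn_ge0.
exists ((limn (series (fun k => complex.Re (a k * w ^+ k)))) +i*
   limn (series (fun k => complex.Im (a k * w ^+ k))))%C.
by split; apply: c => k; rewrite ?Re_le_cn ?Im_le_cn.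
Qed.

(** The terms of a convergent series are bounded, so convergence at the real point p yields the
    bound of radius p. *)
Lemma entire_ent a : entire_coef a -> ent a.
Proof.
move=> ea p p0; have [s [h1 h2]] := ea p%:C%C.
have bd (u : nat -> R) : cvgn (series u) -> exists M, forall k, `|u k| <= M.
  move=> /cvg_series_bounded[M [_ hM]]; exists (M + 1) => k.
  by apply: (hM (M + 1)) => //; rewrite ltrDl.
have [M hM] := bd _ (cvgP _ h1); have [N hN] := bd _ (cvgP _ h2).
exists (M + N) => k; have := hM k; have := hN k.
rewrite Re_realX Im_realX !normrM !(ger0_norm (exprn_ge0 k (ltW p0))) /cn mulrDl.
by move=> ? ?; lra.
Qed.

Lemma ent_le a b (K : R) : (forall k, cn (b k) <= K * cn (a k)) -> 0 <= K -> ent a -> ent b.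
Proof.
move=> h K0 ea p p0; have [M hM] := ea p p0; exists (K * M) => k.
apply: (@le_trans _ _ (K * cn (a k) * p ^+ k)).
  by rewrite ler_wpM2r ?exprn_ge0 // ltW.
by rewrite -mulrA ler_wpM2l.
Qed.

Lemma ent0 : ent (fun=> 0).
Proof. by move=> p p0; exists 0 => k; rewrite /cn /= normr0 addr0 mul0r. Qed.

Lemma entD a b : ent a -> ent b -> ent (fun k => a k + b k).
Proof.
move=> ea eb p p0; have [M hM] := ea p p0; have [N hN] := eb p p0.
exists (M + N) => k; apply: le_trans (lerD (hM k) (hN k)).
by rewrite -mulrDl ler_wpM2r ?cnD ?exprn_ge0 // ltW.
Qed.

Lemma entZ (c : C) a : ent a -> ent (fun k => c * a k).
Proof. by apply: (@ent_le _ _ (cn c)) => [k|]; rewrite ?cnM ?cn_ge0. Qed.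

(** On series these three operations are the derivative, multiplication by r, and removal of the
    constant term followed by division by r. *)
Definition dseq a (k : nat) : C := k.+1%:R * a k.+1.
Definition xseq a (k : nat) : C := if k is k'.+1 then a k' else 0.
Definition tseq a (k : nat) : C := a k.+1.

Lemma ent_tseq a : ent a -> ent (tseq a).
Proof.
move=> ea p p0; have [M hM] := ea p p0; exists (M / p) => k.
by rewrite ler_pdivlMr // -mulrA -exprSr; apply: (hM k.+1).
Qed.

Lemma ent_xseq a : ent a -> ent (xseq a).
Proof.
move=> ea p p0; have [M hM] := ea p p0; exists (M * p) => -[|k] /=.
  rewrite /cn /= normr0 addr0 mul0r mulr_ge0 ?(ltW p0) //.
  by apply: le_trans (hM 0%N); rewrite expr0 mulr1 cn_ge0.
by rewrite exprSr mulrA ler_wpM2r //; apply: ltW.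
Qed.

Lemma cn_natr (n : nat) (c : C) : cn (n%:R * c) = n%:R * cn c.
Proof.
by rewrite -(rmorph_nat (real_complex R)) cn_real ger0_norm ?ler0n.
Qed.

(** The bound at radius 2p absorbs the factor k, since k <= 2^k. *)
Lemma ent_natr a : ent a -> ent (fun k => k%:R * a k).
Proof.
move=> ea p p0; have [M hM] := ea (2 * p) (mulr_gt0 (ltr0n _ 2) p0); exists M => k.
apply: le_trans (hM k); rewrite cn_natr exprMn mulrA ler_wpM2r ?exprn_ge0 ?(ltW p0) //.
rewrite mulrC ler_wpM2l ?cn_ge0 // -natrX ler_nat.
by apply: ltnW; apply: ltn_expl.
Qed.

Lemma ent_dseq a : ent a -> ent (dseq a).
Proof. by move=> /ent_natr/ent_tseq. Qed.

Lemma is_cd_cps a r : ent a -> is_cd (cps a) r 1 (cps (dseq a) r).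
Proof.
move=> ea; have ed := ent_dseq ea; have edd := ent_dseq ed.
have reE b : (fun k => complex.Re (dseq b k)) = pseries_diffs (fun k => complex.Re (b k)).
  apply/funext => k; rewrite /pseries_diffs /dseq -(rmorph_nat (real_complex R)).
  by rewrite complexReM /= mul0r subr0.
have imE b : (fun k => complex.Im (dseq b k)) = pseries_diffs (fun k => complex.Im (b k)).
  apply/funext => k; rewrite /pseries_diffs /dseq -(rmorph_nat (real_complex R)).
  by rewrite complexImM /= mul0r addr0.
have rK : `|r| < `| `|r| + 1 | by rewrite [ltRHS]ger0_norm ?ltrDl // addr_ge0.
split; rewrite /cps /=.
  rewrite reE; apply: (@pseries_snd_diffs _ _ (`|r| + 1)) => //; rewrite -?reE.
  - exact: ent_cvg_Re.
  - exact: ent_cvg_Re.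
  - exact: ent_cvg_Re.
rewrite imE; apply: (@pseries_snd_diffs _ _ (`|r| + 1)) => //; rewrite -?imE.
- exact: ent_cvg_Im.
- exact: ent_cvg_Im.
- exact: ent_cvg_Im.
Qed.

Lemma cpsD a b r : ent a -> ent b -> cps (fun k => a k + b k) r = cps a r + cps b r.
Proof.
move=> ea eb; apply/esym/power_sum_cps.
have [a1 a2] := cps_power_sum r ea; have [b1 b2] := cps_power_sum r eb; split.
  rewrite complexReD (_ : (fun k => _) = (fun k => complex.Re (a k * r%:C%C ^+ k)) +
    (fun k => complex.Re (b k * r%:C%C ^+ k))) ?seriesD; first exact: cvgD.
  by apply/funext => k; rewrite fctE -complexReD mulrDl.
rewrite complexImD (_ : (fun k => _) = (fun k => complex.Im (a k * r%:C%C ^+ k)) +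
  (fun k => complex.Im (b k * r%:C%C ^+ k))) ?seriesD; first exact: cvgD.
by apply/funext => k; rewrite fctE -complexImD mulrDl.
Qed.

Lemma cpsZ (c : C) a r : ent a -> cps (fun k => c * a k) r = c * cps a r.
Proof.
move=> ea; apply/esym/power_sum_cps; have [a1 a2] := cps_power_sum r ea; split.
  rewrite complexReM (_ : series _ =
    (fun n => complex.Re c * series (fun k => complex.Re (a k * r%:C%C ^+ k)) n) -
    (fun n => complex.Im c * series (fun k => complex.Im (a k * r%:C%C ^+ k)) n)).
    by apply: cvgB; [exact: cvgMl_tmp a1|exact: cvgMl_tmp a2].
  apply/funext => n; rewrite /series !fctE !mulr_sumr -sumrB; apply: eq_bigr => k _.
  by rewrite -complexReM mulrA.
rewrite complexImM (_ : series _ =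
  (fun n => complex.Re c * series (fun k => complex.Im (a k * r%:C%C ^+ k)) n) +
  (fun n => complex.Im c * series (fun k => complex.Re (a k * r%:C%C ^+ k)) n)).
  by apply: cvgD; [exact: cvgMl_tmp a2|exact: cvgMl_tmp a1].
apply/funext => n; rewrite /series !fctE !mulr_sumr -big_split; apply: eq_bigr => k _ /=.
by rewrite -complexImM mulrA.
Qed.

Lemma cps_xseq a r : ent a -> cps (xseq a) r = r%:C%C * cps a r.
Proof.
move=> ea; apply/esym/power_sum_cps; have [a1 a2] := cps_power_sum r ea; split.
  rewrite complexReM /= mul0r subr0 -cvg_shiftS (_ : (fun n => _) =
    (fun n => r * series (fun k => complex.Re (a k * r%:C%C ^+ k)) n)).
    exact: cvgMl_tmp a1.
  apply/funext => n; rewrite /series /= big_nat_recl //= !mul0r ?oppr0 !add0r.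
  rewrite mulr_sumr; apply: eq_bigr => k _.
  by rewrite !Re_realX exprS mulrCA.
rewrite complexImM /= mul0r addr0 -cvg_shiftS (_ : (fun n => _) =
  (fun n => r * series (fun k => complex.Im (a k * r%:C%C ^+ k)) n)).
  exact: cvgMl_tmp a2.
apply/funext => n; rewrite /series /= big_nat_recl //= !mul0r ?oppr0 !add0r.
rewrite mulr_sumr; apply: eq_bigr => k _.
by rewrite !Im_realX exprS mulrCA.
Qed.

Let is_cvg_eq_cst (u : nat -> R) l : (forall n, u n = l) -> u @ \oo --> l.
Proof. by move=> ul; have -> : u = fun=> l by [apply/funext]; apply: cvg_cst. Qed.

Lemma cps0 r : cps (fun=> 0) r = 0.
Proof. by have := cpsZ 0 r ent0; under eq_fun do rewrite mul0r; rewrite mul0r. Qed.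

Lemma cps_at0 a : cps a 0 = a 0%N.
Proof.
apply/esym/power_sum_cps; split.
  rewrite -cvg_shiftS; apply: is_cvg_eq_cst => n.
  rewrite /series /= big_nat_recl //= expr0 mulr1 big1 ?addr0 // => i _.
  by rewrite expr0n mulr0.
rewrite -cvg_shiftS; apply: is_cvg_eq_cst => n.
rewrite /series /= big_nat_recl //= expr0 mulr1 big1 ?addr0 // => i _.
by rewrite expr0n mulr0.
Qed.

Lemma cps_split a r : ent a -> cps a r = a 0%N + r%:C%C * cps (tseq a) r.
Proof.
move=> ea; have et := ent_tseq ea; rewrite -(cps_xseq _ et).
pose d (k : nat) : C := a 0%N * (k == 0)%:R.
have ed : ent d.
  move=> p p0; exists (cn (a 0%N)) => -[|k]; first by rewrite /d /= !mulr1.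
  by rewrite /d /= mulr0 /cn /= normr0 addr0 mul0r addr_ge0.
transitivity (cps (fun k => d k + xseq (tseq a) k) r).
  congr (cps _ r).
  by apply/funext => -[|k]; rewrite /d /= ?mulr1 ?mulr0 ?addr0 ?add0r.
rewrite cpsD //; last exact: ent_xseq.
congr (_ + _); apply/esym/power_sum_cps; split.
  rewrite -cvg_shiftS; apply: is_cvg_eq_cst => n.
  rewrite /series /= big_nat_recl //= expr0 /d /= !mulr1 ?addr0 big1 ?addr0 // => i _.
  by rewrite mulr0 mul0r.
rewrite -cvg_shiftS; apply: is_cvg_eq_cst => n.
rewrite /series /= big_nat_recl //= expr0 /d /= !mulr1 ?addr0 big1 ?addr0 // => i _.
by rewrite mulr0 mul0r.
Qed.

Lemma cps_continuous_Re a : ent a -> continuous (fun r => complex.Re (cps a r)).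
Proof.
move=> ea r; have [[/derivable1_diffP d _] _] := is_cd_cps r ea.
exact: differentiable_continuous d.
Qed.

Lemma cps_continuous_Im a : ent a -> continuous (fun r => complex.Im (cps a r)).
Proof.
move=> ea r; have [_ [/derivable1_diffP d _]] := is_cd_cps r ea.
exact: differentiable_continuous d.
Qed.

Lemma right_limit_eq0 (h : R -> R) : {for 0, continuous h} ->
  (forall r, 0 < r -> h r = 0) -> h 0 = 0.
Proof.
move=> hc h0; have /cvg_at_right_filter c : h r @[r --> 0] --> h 0 by [].
have : h r @[r --> 0^'+] --> (0 : R).
  by apply: cvg_near_cst; near=> t; apply: h0; near: t; exact: nbhs_right_gt.
by move=> /(cvg_unique _ c) -> //; apply: norm_hausdorff.
Unshelve. all: by end_near. Qed.

Lemma cps_eq0_head a : ent a -> (forall r, 0 < r -> cps a r = 0) -> a 0%N = 0.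
Proof.
move=> ea ha; rewrite -cps_at0.
have h1 : complex.Re (cps a 0) = 0.
  by apply: (@right_limit_eq0 (fun r => complex.Re (cps a r))) => [|r /ha-> //]; apply: cps_continuous_Re.
have h2 : complex.Im (cps a 0) = 0.
  by apply: (@right_limit_eq0 (fun r => complex.Im (cps a r))) => [|r /ha-> //]; apply: cps_continuous_Im.
by apply/eqP; rewrite eq_complex h1 h2 !eqxx.
Qed.

(** Identity theorem from the half-line: the constant coefficient is the limit at 0 from the right,
    and once it vanishes division by r gives the same hypothesis for the shifted series. *)
Lemma cps_eq0 a : ent a -> (forall r, 0 < r -> cps a r = 0) -> forall k, a k = 0.
Proof.
move=> ea ha k; elim: k a ea ha => [|k IH] a ea ha; first exact: cps_eq0_head.
apply: (IH (tseq a) (ent_tseq ea)) => r r0.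
have := cps_split r ea; rewrite ha // (cps_eq0_head ea ha) add0r => /esym/eqP.
by rewrite mulf_eq0 => /orP[|/eqP//]; rewrite eq_complex /= eqxx andbT gt_eqF.
Qed.

End EntireSeries.

(** * The radial equation *)

Section LaurentAlgebra.
Variables (K : fieldType) (g : K).
Implicit Types (l : nat) (z s u : K) (p q : {poly K}).

(* (p, q) stands for p(1/r) u + q(1/r) u', with s = 1/r; if u solves the radial
   equation, the derivative of (p, q) is (laup p q, lauq p q). *)
Definition lauW l z : {poly K} := (l%:R * l.+1%:R) *: 'X^2 - (2 * g) *: 'X - z%:P.
Definition laup l z p q : {poly K} := - 'X^2 * p^`() + q * lauW l z.
Definition lauq p q : {poly K} := - 'X^2 * q^`() + p - 2 *: ('X * q).
Definition lauv p q s u u' : K := p.[s] * u + q.[s] * u'.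

Lemma horner_inv_deriv s p c :
  p.[s] * (- s ^+ 2) + - s ^+ 2 * p^`().[s] * s + 0 = - s ^+ 2 * (p * 'X + c%:P)^`().[s].
Proof. by rewrite derivD derivM derivX derivC !hornerE /=; ring. Qed.

Lemma lauv_deriv l z p q s u u' :
  p.[s] * u' + - s ^+ 2 * p^`().[s] * u +
  (q.[s] * ((l%:R * l.+1%:R * s ^+ 2 - 2 * g * s - z) * u - 2 * s * u') +
   - s ^+ 2 * q^`().[s] * u') = lauv (laup l z p q) (lauq p q) s u u'.
Proof. by rewrite /lauv /laup /lauq /lauW !hornerE /=; ring. Qed.

Lemma radial_solve r l z u u' u'' : r != 0 ->
  r ^+ 2 * u'' + 2 * r * u' - (l * l.+1)%:R * u + 2 * g * r * u + z * r ^+ 2 * u = 0 ->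
  u'' = (l%:R * l.+1%:R * r^-1 ^+ 2 - 2 * g * r^-1 - z) * u - 2 * r^-1 * u'.
Proof.
move=> r1 e; apply: (mulfI (expf_neq0 2 r1)); apply/eqP; rewrite -subr_eq0 -[X in _ == X]e natrM.
apply/eqP; field; exact: r1.
Qed.

Definition rup_p l : {poly K} := g%:P - (l%:R * l.+1%:R) *: 'X.
Definition rup_q l : {poly K} := l.+1%:R%:P.
Definition rdown_p l : {poly K} := (l%:R * l.+1%:R) *: 'X - g%:P.
Definition rdown_q l : {poly K} := l%:R%:P.

(** The first order operator (l+1) d/dr - l(l+1)/r + g carries the radial equation of degree l to
    that of degree l + 1. Once u'' is eliminated, the coefficients of u and of u' vanish separately,
    so both may be free variables here. *)
Lemma rup_ode l z r u u' : r != 0 ->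
  let p1 := laup l z (rup_p l) (rup_q l) in let q1 := lauq (rup_p l) (rup_q l) in
  r ^+ 2 * lauv (laup l z p1 q1) (lauq p1 q1) r^-1 u u' + 2 * r * lauv p1 q1 r^-1 u u'
  - (l.+1 * l.+2)%:R * lauv (rup_p l) (rup_q l) r^-1 u u'
  + 2 * g * r * lauv (rup_p l) (rup_q l) r^-1 u u'
  + z * r ^+ 2 * lauv (rup_p l) (rup_q l) r^-1 u u' = 0.
Proof.
move=> r1; rewrite /= /lauv /laup /lauq /lauW /rup_p /rup_q !(poly.derivE, hornerE) /= natrM.
rewrite -[l.+2]addn2 -[l.+1]addn1 !natrD; field.
exact: r1.
Qed.

Lemma rdown_ode l z r u u' : r != 0 ->
  let p1 := laup l.+1 z (rdown_p l.+1) (rdown_q l.+1) in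
  let q1 := lauq (rdown_p l.+1) (rdown_q l.+1) in
  r ^+ 2 * lauv (laup l.+1 z p1 q1) (lauq p1 q1) r^-1 u u' + 2 * r * lauv p1 q1 r^-1 u u'
  - (l * l.+1)%:R * lauv (rdown_p l.+1) (rdown_q l.+1) r^-1 u u'
  + 2 * g * r * lauv (rdown_p l.+1) (rdown_q l.+1) r^-1 u u'
  + z * r ^+ 2 * lauv (rdown_p l.+1) (rdown_q l.+1) r^-1 u u' = 0.
Proof.
move=> r1; rewrite /= /lauv /laup /lauq /lauW /rdown_p /rdown_q !(poly.derivE, hornerE) /= natrM.
rewrite -[l.+2]addn2 -[l.+1]addn1 !natrD; field.
exact: r1.
Qed.

Lemma lauv_rup l s u u' :
  lauv (rup_p l) (rup_q l) s u u' = l.+1%:R * u' - l%:R * l.+1%:R * s * u + g * u.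
Proof. by rewrite /lauv /rup_p /rup_q !hornerE /=; ring. Qed.

Lemma lauv_rdown l s u u' :
  lauv (rdown_p l) (rdown_q l) s u u' = l%:R * u' + l%:R * l.+1%:R * s * u - g * u.
Proof. by rewrite /lauv /rdown_p /rdown_q !hornerE /=; ring. Qed.

End LaurentAlgebra.

Section RadialSolutions.
Variables (R : realType) (gamma : R).
Notation C := R[i].
Notation g := (gamma%:C%C : C).
Implicit Types (u v F G : R -> C) (l : nat) (z c : C) (r : R).

Lemma near_pos r : 0 < r -> \near r, 0 < r.
Proof.
rewrite -oppr_lt0 => /Nlt_nbhsl; apply: filterS => t; rewrite oppr_lt0; exact.
Qed.

Lemma rc_neq0 r : 0 < r -> r%:C%C != 0 :> C.
Proof. by move=> r0; rewrite eq_complex /= eqxx andbT gt_eqF. Qed.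

Lemma rcV r : ((r^-1)%:C = r%:C^-1)%C.
Proof. by rewrite fmorphV. Qed.

Lemma is_cd_eqpos u v r d : 0 < r -> (forall t, 0 < t -> u t = v t) ->
  is_cd u r 1 d -> is_cd v r 1 d.
Proof.
move=> r0 uv; apply: is_cd_near; have := near_pos r0.
by apply: filterS => t; apply: uv.
Qed.

Lemma radial_intro l z u u1 u2 :
  (forall r, 0 < r -> is_cd u r 1 (u1 r)) -> (forall r, 0 < r -> is_cd u1 r 1 (u2 r)) ->
  (forall r, 0 < r -> (r%:C ^+ 2 * u2 r + 2 * r%:C * u1 r
       - (l * l.+1)%:R * u r + 2 * g * r%:C * u r + z * r%:C ^+ 2 * u r = 0)%C) ->
  radial_solution gamma l z u.
Proof.
move=> h1 h2 e r r0; have [c1 e1] := is_cd_derive (h1 r r0).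
have h3 : is_cd (cderiv u) r 1 (u2 r).
  apply: (is_cd_eqpos r0 _ (h2 r r0)) => t t0.
  by have [_ ->] := is_cd_derive (h1 t t0).
by have [c2 e2] := is_cd_derive h3; split=> //; rewrite e1 e2 e.
Qed.

Lemma radial_cd1 l z u r : radial_solution gamma l z u -> 0 < r -> is_cd u r 1 (cderiv u r).
Proof. by move=> h r0; have [d _ _] := h r r0; apply: derive_is_cd. Qed.

Lemma radial_cd2 l z u r : radial_solution gamma l z u -> 0 < r ->
  is_cd (cderiv u) r 1 (((l%:R * l.+1%:R) * (r^-1)%:C ^+ 2 - 2 * g * (r^-1)%:C - z) * u r
     - 2 * (r^-1)%:C * cderiv u r)%C.
Proof.
move=> h r0; have [_ /derive_is_cd d e] := h r r0; apply: is_cd_eq d _.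
by rewrite rcV; apply: (radial_solve (rc_neq0 r0)).
Qed.

Lemma radial_near l z u v : (forall r, 0 < r -> u r = v r) ->
  radial_solution gamma l z u -> radial_solution gamma l z v.
Proof.
move=> uv h; apply: (@radial_intro _ _ _ (cderiv u) (cderiv (cderiv u))) => r r0.
- exact: (is_cd_eqpos r0 uv (radial_cd1 h r0)).
- by have [_ /derive_is_cd d _] := h r r0.
- by have [_ _] := h r r0; rewrite uv.
Qed.

Lemma radial_lin l z c u v : radial_solution gamma l z u -> radial_solution gamma l z v ->
  radial_solution gamma l z (fun r => u r + c * v r).
Proof.
move=> hu hv; apply: (@radial_intro _ _ _ (fun r => cderiv u r + c * cderiv v r)
   (fun r => cderiv (cderiv u) r + c * cderiv (cderiv v) r)) => r r0.
- by apply: is_cdD; [exact: radial_cd1 hu r0|apply: is_cdZ; exact: radial_cd1 hv r0].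
- have [_ /derive_is_cd d _] := hu r r0; have [_ /derive_is_cd d' _] := hv r r0.
  by apply: is_cdD => //; apply: is_cdZ.
- have [_ _ e1] := hu r r0; have [_ _ e2] := hv r r0.
  have aux (K : comPzRingType) (k a b n d w u0 u1 u2 v0 v1 v2 : K) :
      a * u2 + b * u1 - n * u0 + d * u0 + w * u0 = 0 ->
      a * v2 + b * v1 - n * v0 + d * v0 + w * v0 = 0 ->
      a * (u2 + k * v2) + b * (u1 + k * v1) - n * (u0 + k * v0) + d * (u0 + k * v0)
      + w * (u0 + k * v0) = 0.
    move=> h1 h2; rewrite -[RHS](addr0 0) -[X in _ = X + _]h1 -[X in _ = _ + X](mulr0 k).
    by rewrite -[X in _ = _ + k * X]h2; ring.
  exact: aux e1 e2.
Qed.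

Lemma radial0 l z : radial_solution gamma l z (fun=> 0).
Proof.
apply: (@radial_intro _ _ _ (fun=> 0) (fun=> 0)) => r r0; [exact: is_cd_cst|exact: is_cd_cst|].
by rewrite !mulr0 !addr0 subr0.
Qed.

Definition inv_horner (p : {poly C}) r : C := p.[(r^-1)%:C%C].

Definition lau (p q : {poly C}) u r : C := lauv p q (r^-1)%:C%C (u r) (cderiv u r).

Lemma is_cd_inv_horner p r : 0 < r ->
  is_cd (inv_horner p) r 1 (- (r^-1)%:C%C ^+ 2 * inv_horner p^`() r).
Proof.
move=> r0; elim/poly_ind: p => [|p c IH].
  apply: (is_cd_eq (d := 0)); last by rewrite /inv_horner deriv0 horner0 mulr0.
  by have -> : inv_horner 0 = fun=> 0 by [apply/funext => t; rewrite /inv_horner horner0]; apply: is_cd_cst.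
have -> : inv_horner (p * 'X + c%:P) = fun t => inv_horner p t * (t^-1)%:C%C + c.
  by apply/funext => t; rewrite /inv_horner hornerD hornerMX hornerC.
have dV : is_derive r 1 (fun t : R => t^-1) (- r ^- 2).
  have r1 : id r != 0 by rewrite gt_eqF.
  by have := is_deriveV r1 (is_derive_id r 1); rewrite /GRing.scale /= mulr1.
apply: is_cd_eq (is_cdD (is_cdM IH (is_cd_real dV)) (is_cd_cst c r 1)) _.
rewrite rmorphN -exprVn rmorphXn; exact: horner_inv_deriv.
Qed.

Lemma is_cd_lau l z p q u r : radial_solution gamma l z u -> 0 < r ->
  is_cd (lau p q u) r 1 (lau (laup g l z p q) (lauq p q) u r).
Proof.
move=> hu r0; apply: is_cd_eq (is_cdD (is_cdM (is_cd_inv_horner p r0) (radial_cd1 hu r0))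
   (is_cdM (is_cd_inv_horner q r0) (radial_cd2 hu r0))) _.
exact: lauv_deriv.
Qed.

(* R_i maps u(r) P(x/r), with P harmonic of degree l, to a function with radial
   factor rup l u in degree l + 1 and, up to a constant, rdown l u in degree
   l - 1: see rungelenz_sep. *)
Definition rup l u r : C := l.+1%:R * cderiv u r - l%:R * l.+1%:R * (r^-1)%:C%C * u r + g * u r.
Definition rdown l u r : C := l%:R * cderiv u r + l%:R * l.+1%:R * (r^-1)%:C%C * u r - g * u r.

Lemma rup_lau l u : rup l u = lau (rup_p g l) (rup_q _ l) u.
Proof. by apply/funext => r; rewrite /lau lauv_rup. Qed.

Lemma rdown_lau l u : rdown l u = lau (rdown_p g l) (rdown_q _ l) u.
Proof. by apply/funext => r; rewrite /lau lauv_rdown. Qed.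

Lemma rup_radial l z u : radial_solution gamma l z u -> radial_solution gamma l.+1 z (rup l u).
Proof.
move=> hu; rewrite rup_lau; set p := rup_p _ _; set q := rup_q _ _.
apply: (@radial_intro _ _ _ (lau (laup g l z p q) (lauq p q) u)
  (lau (laup g l z (laup g l z p q) (lauq p q)) (lauq (laup g l z p q) (lauq p q)) u)) => r r0.
- exact: is_cd_lau.
- exact: is_cd_lau.
by rewrite /lau rcV; apply: rup_ode; apply: rc_neq0.
Qed.

Lemma rdown_radial l z u : radial_solution gamma l.+1 z u -> radial_solution gamma l z (rdown l.+1 u).
Proof.
move=> hu; rewrite rdown_lau; set p := rdown_p _ _; set q := rdown_q _ _.
apply: (@radial_intro _ _ _ (lau (laup g l.+1 z p q) (lauq p q) u)
  (lau (laup g l.+1 z (laup g l.+1 z p q) (lauq p q)) (lauq (laup g l.+1 z p q) (lauq p q)) u)) => r r0.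
- exact: is_cd_lau.
- exact: is_cd_lau.
by rewrite /lau rcV; apply: rdown_ode; apply: rc_neq0.
Qed.

End RadialSolutions.

(** * Frobenius forms with a logarithmic term, and their recursions *)

Section FormAlgebra.
Variable K : fieldType.
Implicit Types (l n : nat).

Lemma powr_deriv_eq n (r f : K) : r != 0 ->
  r * (n%:R * f * r^-1) + f = n.+1%:R * (r * f) * r^-1.
Proof. by move=> r1; rewrite -[n.+1]addn1 natrD; field. Qed.

Lemma form1_deriv_eq l (s p c b b1 b2 F F1 F2 L : K) :
  - l.+1%:R * (s * (s * p) * b1 + - l.+2%:R * (s * (s * (s * p))) * b) +
    (s * p * b2 + - l.+1%:R * (s * (s * p)) * b1) +
    c * (s * F1 + - 1 * (s * s) * F + (L * F2 + s * F1)) =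
  l.+1%:R * l.+2%:R * (s * (s * (s * p))) * b - 2 * l.+1%:R * (s * (s * p)) * b1
    + s * p * b2 + c * (- s ^+ 2 * F + 2 * s * F1 + L * F2).
Proof. by ring. Qed.

Lemma form_ode_eq l (r g z p c b b1 b2 F F1 F2 L : K) : r != 0 -> 
  r ^+ 2 * F2 + 2 * r * F1 - (l * l.+1)%:R * F + 2 * g * r * F + z * r ^+ 2 * F = 0 ->
  r ^+ 2 * (l.+1%:R * l.+2%:R * (r^-1 * (r^-1 * (r^-1 * p))) * b
    - 2 * l.+1%:R * (r^-1 * (r^-1 * p)) * b1 + r^-1 * p * b2
    + c * (- r^-1 ^+ 2 * F + 2 * r^-1 * F1 + L * F2))
   + 2 * r * (- l.+1%:R * (r^-1 * (r^-1 * p)) * b + r^-1 * p * b1 + c * (r^-1 * F + L * F1))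
   - (l * l.+1)%:R * (r^-1 * p * b + c * L * F) + 2 * g * r * (r^-1 * p * b + c * L * F)
   + z * r ^+ 2 * (r^-1 * p * b + c * L * F) =
  r^-1 * p * (r ^+ 2 * b2 - (l + l)%:R * r * b1 + 2 * g * r * b + z * r ^+ 2 * b)
   + c * (F + 2 * r * F1).
Proof.
move=> r1 e; apply/eqP; rewrite -subr_eq0; apply/eqP.
rewrite -[RHS](mulr0 (c * L)) -[in RHS]e natrM -[l.+2]addn2 -[l.+1]addn1 !natrD; field.
exact: r1.
Qed.

Lemma form_log_eq l (r rl p c f f1 : K) : r != 0 -> r^-1 * p * (r * rl) = 1 ->
  c * (rl * f + 2 * r * (l%:R * rl * r^-1 * f + rl * f1)) =
  r^-1 * p * (c * (r * rl * rl) * ((l + l).+1%:R * f + 2 * r * f1)).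
Proof.
move=> r1 e; rewrite -[LHS]mul1r -[X in X * _ = _]e -[(l + l).+1]addn1 !natrD; field.
exact: r1.
Qed.

Lemma formrec_eq (n r b b1 b2 g z c f f1 rn N : K) :
  r * b1 + r ^+ 2 * b2 + (- (n + 1) * (r * b1) + (2 * g * (r * b) + (z * (r * (r * b)) +
    c * (rn * (N * f + 2 * (r * f1)))))) =
  r ^+ 2 * b2 - n * r * b1 + 2 * g * r * b + z * r ^+ 2 * b + c * rn * (N * f + 2 * r * f1).
Proof. by ring. Qed.

End FormAlgebra.

Section Forms.
Variables (R : realType) (gamma : R).
Notation C := R[i].
Notation g := (gamma%:C%C : C).
Implicit Types (u v F G : R -> C) (l : nat) (z c : C) (r : R) (a b f : nat -> C).

Definition nseq a (k : nat) : C := k%:R * a k.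

Lemma ent_nseq a : ent a -> ent (nseq a). Proof. exact: ent_natr. Qed.

Lemma cps_nseq a r : ent a -> cps (nseq a) r = r%:C%C * cps (dseq a) r.
Proof.
move=> ea; rewrite -cps_xseq; last exact: ent_dseq.
congr (cps _ r); apply/funext => -[|k] /=; rewrite /nseq ?mul0r //.
Qed.

Lemma cps_nseq2 a r : ent a ->
  cps (nseq (nseq a)) r = r%:C%C * cps (dseq a) r + r%:C%C ^+ 2 * cps (dseq (dseq a)) r.
Proof.
move=> ea; rewrite cps_nseq; last exact: ent_nseq.
have ed := ent_dseq ea.
have -> : dseq (nseq a) = fun k => dseq a k + nseq (dseq a) k.
  by apply/funext => k; rewrite /dseq /nseq -[k.+1]addn1 natrD; ring.
rewrite cpsD ?cps_nseq //; last exact: ent_nseq.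
by ring.
Qed.

Lemma ent_iter_xseq n a : ent a -> ent (iter n (@xseq R) a).
Proof. by move=> ea; elim: n => //= n; apply: ent_xseq. Qed.

Lemma cps_iter_xseq n a r : ent a -> cps (iter n (@xseq R) a) r = r%:C%C ^+ n * cps a r.
Proof.
move=> ea; elim: n => [|n IH] /=; first by rewrite mul1r.
by rewrite cps_xseq ?IH ?exprS ?mulrA //; apply: ent_iter_xseq.
Qed.

Lemma iter_xseqE n a k : iter n (@xseq R) a k = if (k < n)%N then 0 else a (k - n)%N.
Proof.
by elim: n k => [|n IH] [|k] //=.
Qed.

Lemma iter_xseqD n a k : iter n (@xseq R) a (k + n)%N = a k.
Proof. by rewrite iter_xseqE ltnNge leq_addl addnK. Qed.

Lemma iter_xseq_at n a : iter n (@xseq R) a n = a 0%N.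
Proof. by rewrite iter_xseqE ltnn subnn. Qed.

Lemma iter_xseq_low n a k : (k < n)%N -> iter n (@xseq R) a k = 0.
Proof. by rewrite iter_xseqE => ->. Qed.

(** The Frobenius ansatz at the singular point 0, where the exponents are l and -(l+1). With [c = 0]
    and [b] shifted by the gap 2l+1 it also covers r^l times a power series. *)
Definition formv l b c F : R -> C := fun r =>
  (r^-1)%:C%C ^+ l.+1 * cps b r + c * (ln r)%:C%C * F r.

(** Coefficients of r^-l (F + 2 r F') for F = r^l f, which is what remains of the radial operator on
    log(r) F where the logarithm itself is differentiated. *)
Definition logterm l f (k : nat) : C := (l + l).+1%:R * f k + 2 * nseq f k.

(* The coefficients of r ^ l.+1 times the radial operator applied to formv; no
   logarithm remains when F solves the radial equation. *)
Definition formrec l z b c f (k : nat) : C :=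
  nseq (nseq b) k + (- (l + l).+1%:R * nseq b k + (2 * g * xseq b k +
  (z * xseq (xseq b) k + c * iter (l + l).+1 (@xseq R) (logterm l f) k))).

Lemma ent_logterm l f : ent f -> ent (logterm l f).
Proof. by move=> ef; apply: entD; apply: entZ => //; apply: ent_nseq. Qed.

Lemma ent_formrec l z b c f : ent b -> ent f -> ent (formrec l z b c f).
Proof.
move=> eb ef; apply: entD; first by do 2 apply: ent_nseq.
apply: entD; first by apply: entZ; apply: ent_nseq.
apply: entD; first by apply: entZ; apply: ent_xseq.
apply: entD; first by apply: entZ; do 2 apply: ent_xseq.
by apply: entZ; apply: ent_iter_xseq; apply: ent_logterm.
Qed.

Lemma is_cd_powV n r : 0 < r ->
  is_cd (fun t : R => (t^-1)%:C%C ^+ n : C) r 1 (- n%:R * (r^-1)%:C%C ^+ n.+1).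
Proof.
move=> r0; have := is_cd_inv_horner 'X^n r0.
have -> : inv_horner 'X^n = fun t : R => (t^-1)%:C%C ^+ n :> C.
  by apply/funext => t; rewrite /inv_horner hornerXn.
move/is_cd_eq; apply; rewrite /inv_horner derivXn hornerMn hornerXn -mulr_natl.
by case: n => [|n]; rewrite ?(mul0r, mulr0, oppr0) // /= -[n.+2]add2n exprD; ring.
Qed.

Lemma is_cd_powr n r : 0 < r ->
  is_cd (fun t : R => t%:C%C ^+ n : C) r 1 (n%:R * r%:C%C ^+ n * (r^-1)%:C%C).
Proof.
move=> r0; have r1 := rc_neq0 r0.
elim: n => [|n IH].
  by rewrite !mul0r; under eq_fun do rewrite expr0; apply: is_cd_cst.
have h : is_cd (fun t : R => t%:C%C : C) r 1 1 by apply: is_cd_real; apply: is_derive_id.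
under eq_fun do rewrite exprS.
apply: is_cd_eq (is_cdM h IH) _; rewrite mul1r rcV exprS; exact: powr_deriv_eq.
Qed.

Lemma is_cd_ln r : 0 < r -> is_cd (fun t : R => (ln t)%:C%C : C) r 1 (r^-1)%:C%C.
Proof. by move=> r0; apply: is_cd_real; apply: is_derive1_ln. Qed.

Definition form1 l b c F : R -> C := fun r =>
  - l.+1%:R * (r^-1)%:C%C ^+ l.+2 * cps b r + (r^-1)%:C%C ^+ l.+1 * cps (dseq b) r
  + c * ((r^-1)%:C%C * F r + (ln r)%:C%C * cderiv F r).

Lemma is_cd_form l z b c F r : ent b -> radial_solution gamma l z F -> 0 < r ->
  is_cd (formv l b c F) r 1 (form1 l b c F r).
Proof.
move=> eb hF r0; rewrite /formv; under eq_fun do rewrite -mulrA.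
apply: is_cd_eq (is_cdD (is_cdM (is_cd_powV l.+1 r0) (is_cd_cps r eb))
  (is_cdZ c (is_cdM (is_cd_ln r0) (radial_cd1 hF r0)))) _.
by rewrite /form1; ring.
Qed.

Lemma is_cd_form1 l z b c F r : ent b -> radial_solution gamma l z F -> 0 < r ->
  is_cd (form1 l b c F) r 1
   (l.+1%:R * l.+2%:R * (r^-1)%:C%C ^+ l.+3 * cps b r
    - 2 * l.+1%:R * (r^-1)%:C%C ^+ l.+2 * cps (dseq b) r
    + (r^-1)%:C%C ^+ l.+1 * cps (dseq (dseq b)) r
    + c * (- (r^-1)%:C%C ^+ 2 * F r + 2 * (r^-1)%:C%C * cderiv F r
           + (ln r)%:C%C * cderiv (cderiv F) r)).
Proof.
move=> eb hF r0; rewrite /form1; under eq_fun do rewrite -mulrA.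
have [_ /derive_is_cd hF2 _] := hF r r0.
have h1 := is_cd_powV 1 r0.
apply: is_cd_eq (is_cdD (is_cdD (is_cdZ (- l.+1%:R) (is_cdM (is_cd_powV l.+2 r0) (is_cd_cps r eb)))
   (is_cdM (is_cd_powV l.+1 r0) (is_cd_cps r (ent_dseq eb))))
  (is_cdZ c (is_cdD (is_cdM h1 (radial_cd1 hF r0)) (is_cdM (is_cd_ln r0) hF2)))) _.
rewrite !(exprS _ l.+2) !(exprS _ l.+1) !(exprS _ l) !expr1; exact: form1_deriv_eq.
Qed.

Lemma cps_formrec l z b c f r : ent b -> ent f -> 
  cps (formrec l z b c f) r = (r%:C ^+ 2 * cps (dseq (dseq b)) r
    - (l + l)%:R * r%:C * cps (dseq b) r + 2 * g * r%:C * cps b r + z * r%:C ^+ 2 * cps b r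
    + c * r%:C ^+ (l + l).+1 * ((l + l).+1%:R * cps f r + 2 * r%:C * cps (dseq f) r))%C.
Proof.
move=> eb ef; have en := ent_nseq eb; have enn := ent_nseq en.
have ex := ent_xseq eb; have exx := ent_xseq ex.
have nf := ent_nseq ef.
have el := ent_logterm l ef; have eil := ent_iter_xseq (l + l).+1 el.
have t4 := entZ c eil; have t3 := entD (entZ z exx) t4.
have t2 := entD (entZ (2 * g) ex) t3; have t1 := entD (entZ (- (l + l).+1%:R) en) t2.
rewrite /formrec (cpsD _ enn t1) (cpsD _ (entZ _ en) t2) (cpsD _ (entZ _ ex) t3).
rewrite (cpsD _ (entZ _ exx) t4) !cpsZ // cps_nseq2 // cps_nseq // (cps_iter_xseq (l + l).+1 _ el).
rewrite !cps_xseq // /logterm cpsD; try exact: entZ.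
rewrite !cpsZ // cps_nseq // -{1}[(l + l).+1]addn1 natrD. exact: formrec_eq.
Qed.

Lemma form_ode l z b c f F r : ent b -> ent f -> radial_solution gamma l z F ->
  (forall r, 0 < r -> F r = r%:C%C ^+ l * cps f r) -> 0 < r ->
  (r%:C ^+ 2 * (l.+1%:R * l.+2%:R * (r^-1)%:C%C ^+ l.+3 * cps b r
    - 2 * l.+1%:R * (r^-1)%:C%C ^+ l.+2 * cps (dseq b) r
    + (r^-1)%:C%C ^+ l.+1 * cps (dseq (dseq b)) r
    + c * (- (r^-1)%:C%C ^+ 2 * F r + 2 * (r^-1)%:C%C * cderiv F r
           + (ln r)%:C%C * cderiv (cderiv F) r))
   + 2 * r%:C * form1 l b c F r
   - (l * l.+1)%:R * formv l b c F r + 2 * g * r%:C * formv l b c F r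
   + z * r%:C ^+ 2 * formv l b c F r = (r^-1)%:C%C ^+ l.+1 * cps (formrec l z b c f) r)%C.
Proof.
move=> eb ef hF Ff r0; have r1 := rc_neq0 r0.
have eF' : cderiv F r = l%:R * r%:C%C ^+ l * (r^-1)%:C%C * cps f r + r%:C%C ^+ l * cps (dseq f) r.
  have h := is_cdM (is_cd_powr l r0) (is_cd_cps r ef).
  have h' : is_cd F r 1 (r%:C%C ^+ l * cps (dseq f) r + l%:R * r%:C%C ^+ l * (r^-1)%:C%C * cps f r).
    by apply: (is_cd_eqpos r0 _ h) => t t0; rewrite Ff.
  by rewrite (is_cd_inj (radial_cd1 hF r0) h') addrC.
have [_ _ eF] := hF r r0.
rewrite cps_formrec // [RHS]mulrDr.
rewrite /formv /form1 rcV !(exprS _ l.+2) !(exprS _ l.+1) !(exprS _ l); apply: (etrans (form_ode_eq _ _ _ _ _ _ (rc_neq0 r0) eF)).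
congr (_ + _); rewrite eF' Ff // rcV.
have -> : (r%:C ^+ (l + l).+1 = r%:C * r%:C ^+ l * r%:C ^+ l :> C)%C.
  by rewrite exprS exprD mulrA.
by apply: form_log_eq => //; rewrite mulrACA mulVf // mul1r -exprMn mulVf // expr1n.
Qed.

End Forms.

Section Frobenius.
Variable R : realType.
Notation C := R[i].
Implicit Types (b d : nat -> C).

(** Once k + 2 exceeds A + B + D, a bound M >= 1 on two consecutive terms passes to the next; M >= 1
    lets the inhomogeneous term D be absorbed into D M. *)
Lemma bounded_recursion (x : nat -> R) (A B D : R) (K : nat) : 0 <= A -> 0 <= B -> 0 <= D ->
  (forall k, 0 <= x k) ->
  (forall k, (K <= k)%N -> k.+2%:R * x k.+2 <= A * x k.+1 + B * x k + D) ->
  exists M, forall k, x k <= M.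
Proof.
move=> A0 B0 D0 x0 h; pose K' := maxn K (Num.truncn (A + B + D)).+1.
pose M := 1 + \sum_(j < K'.+2) x j.
have M1 : 1 <= M by rewrite lerDl sumr_ge0.
have low k : (k < K'.+2)%N -> x k <= M.
  move=> kK; rewrite /M (bigD1 (Ordinal kK)) //= addrCA lerDl addr_ge0 // sumr_ge0 //.
exists M; suff s k : x k <= M /\ x k.+1 <= M by move=> k; have [] := s k.
elim: k => [|k [IH1 IH2]]; first by split; apply: low.
split=> //; case: (ltnP k.+2 K'.+2) => [/low//|Kk].
have KK : (K <= k)%N by apply: leq_trans (leq_maxl _ _) _; exact: Kk.
have ABD : A + B + D <= k.+2%:R.
  apply: ltW; apply: lt_le_trans (truncnS_gt _) _; rewrite ler_nat.
  by apply: leq_trans (leq_maxr K _) _; apply: (leq_trans _ Kk); rewrite -addn2 leq_addr.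
have k0 : 0 < k.+2%:R :> R by rewrite ltr0n.
rewrite -(ler_pM2l k0); apply: le_trans (h k KK) _.
apply: (@le_trans _ _ ((A + B + D) * M)); last by rewrite ler_wpM2r // (le_trans ler01).
rewrite !mulrDl !lerD // ?ler_wpM2l // -[leLHS]mulr1 ler_wpM2l //.
Qed.

(* A solution of D k * x_k + A * x_(k-1) + B * x_(k-2) + d k = 0, with free
   values be k at the indices where D k = 0. *)
Section Construction.
Variables (D : nat -> R) (be d : nat -> C) (A B : C).

Let step k (x y : C) : C :=
  if D k == 0 then be k else - (A * x + B * y + d k) / (D k)%:C%C.

Fixpoint frob_pair k : C * C :=
  if k is k'.+1 then (step k (frob_pair k').1 (frob_pair k').2, (frob_pair k').1)
  else (step 0 0 0, 0).

Definition frob k : C := (frob_pair k).1.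

Lemma frob_pair2 k : (frob_pair k).2 = xseq frob k. Proof. by case: k. Qed.

Lemma frobE k : frob k = step k (xseq frob k) (xseq (xseq frob) k).
Proof. by case: k => [|k] //=; rewrite /frob /= -frob_pair2. Qed.

Lemma frob_init k : D k = 0 -> frob k = be k.
Proof. by move=> Dk; rewrite frobE /step Dk eqxx. Qed.

Lemma frob_rec k : D k != 0 ->
  (D k)%:C%C * frob k + A * xseq frob k + B * xseq (xseq frob) k + d k = 0.
Proof.
move=> Dk; rewrite {1}frobE /step (negbTE Dk) mulrC divfK; first by rewrite -!addrA addNr.
by rewrite eq_complex /= eqxx andbT.
Qed.

(** Division by D k gains a factor 1/k, which beats any geometric growth: [bounded_recursion]
    applies to the sizes of the coefficients weighted by p^k, for every p. *)
Lemma ent_frob K : ent d -> (forall k, (K <= k)%N -> k%:R <= D k) -> ent frob.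
Proof.
move=> ed hD p p0; have [M hM] := ed p p0.
have M0 : 0 <= M by apply: le_trans (hM 0%N); rewrite expr0 mulr1 cn_ge0.
apply: (@bounded_recursion _ (cn A * p) (cn B * p ^+ 2) M K) => //.
- by rewrite mulr_ge0 ?cn_ge0 // ltW.
- by rewrite mulr_ge0 ?cn_ge0 ?exprn_ge0 // ltW.
- by move=> k; rewrite mulr_ge0 ?cn_ge0 ?exprn_ge0 // ltW.
move=> k Kk; have pk n : 0 <= p ^+ n by rewrite exprn_ge0 // ltW.
have Dk : k.+2%:R <= D k.+2 by apply: hD; apply: (leq_trans Kk); rewrite -addn2 leq_addr.
have D0 : D k.+2 != 0 by rewrite gt_eqF // (lt_le_trans _ Dk).
have := frob_rec D0; rewrite -!addrA => /eqP; rewrite addr_eq0 => /eqP e.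
apply: (@le_trans _ _ (D k.+2 * cn (frob k.+2) * p ^+ k.+2)).
  by rewrite mulrA ler_wpM2r // ler_wpM2r // cn_ge0.
have -> : D k.+2 * cn (frob k.+2) = cn (A * frob k.+1 + (B * frob k + d k.+2)).
  rewrite -[D k.+2]ger0_norm ?(le_trans _ Dk) // -cn_real e.
  by rewrite /cn !raddfN !normrN.
apply: (@le_trans _ _ ((cn A * cn (frob k.+1) + (cn B * cn (frob k) + cn (d k.+2))) * p ^+ k.+2)).
  rewrite ler_wpM2r //; apply: le_trans (cnD _ _) _; apply: lerD; first exact: cnM.
  by apply: le_trans (cnD _ _) _; apply: lerD => //; exact: cnM.
have fin (a b x y w P M' P1 P0 : R) : P = p * P1 -> P = p ^+ 2 * P0 -> w * P <= M' ->
    (a * x + (b * y + w)) * P <= a * p * (x * P1) + (b * p ^+ 2 * (y * P0) + M').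
  move=> e1 e0 wM; have -> : (a * x + (b * y + w)) * P = a * x * P + b * y * P + w * P by ring.
  rewrite {1}e1 {1}e0; have -> : a * x * (p * P1) = a * p * (x * P1) by ring.
  have -> : b * y * (p ^+ 2 * P0) = b * p ^+ 2 * (y * P0) by ring.
  by rewrite addrA lerD2l.
by apply: fin => //; rewrite ?exprS ?expr0 ?mulr1 ?mulrA.
Qed.

End Construction.
End Frobenius.

Section RegularSingular.
Variables (R : realType) (gamma : R).
Notation C := R[i].
Notation g := (gamma%:C%C : C).
Implicit Types (u v F G : R -> C) (l : nat) (z c : C) (r : R) (a b f : nat -> C).

Lemma xseq_iter n a : xseq (iter n (@xseq R) a) = iter n (@xseq R) (xseq a).
Proof. by rewrite -iterS iterSr. Qed.

(** Shifting by the gap 2l+1 between the exponents turns the indicial factor k(k - 2l - 1) into j(j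
    + 2l + 1), which vanishes only at j = 0. *)
Lemma rec_regular l z f j :
  formrec gamma l z (iter (l + l).+1 (@xseq R) f) 0 (fun=> 0) (j + (l + l).+1)%N =
  (j * (j + (l + l).+1))%:R * f j + 2 * g * xseq f j + z * xseq (xseq f) j.
Proof.
set N := (l + l).+1; rewrite /formrec mul0r addr0 /nseq iter_xseqD -/N.
rewrite (_ : xseq (iter N _ f) (j + N) = xseq f j); last first.
  by rewrite xseq_iter iter_xseqD.
rewrite (_ : xseq (xseq (iter N _ f)) (j + N) = xseq (xseq f) j); last first.
  by rewrite !xseq_iter iter_xseqD.
rewrite !addrA; congr (_ + _ + _).
have aux (K : comPzRingType) (n j' y : K) :
  (j' + n) * ((j' + n) * y) + - n * ((j' + n) * y) = j' * (j' + n) * y by ring.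
rewrite natrM natrD; exact: aux.
Qed.

Lemma rec_regular_low l z f k : (k < (l + l).+1)%N ->
  formrec gamma l z (iter (l + l).+1 (@xseq R) f) 0 (fun=> 0) k = 0.
Proof.
move=> kN; rewrite /formrec mul0r addr0 /nseq iter_xseq_low // !mulr0 !add0r.
have -> : xseq (iter (l + l).+1 (@xseq R) f) k = 0.
  by rewrite -[xseq _]/(iter (l + l).+2 (@xseq R) f) iter_xseq_low // ltnW.
have -> : xseq (xseq (iter (l + l).+1 (@xseq R) f)) k = 0.
  by rewrite -[xseq _]/(iter (l + l).+3 (@xseq R) f) iter_xseq_low // ltnW // ltnW.
by rewrite !mulr0 addr0.
Qed.

(** [regular_with] and [singular_with] expose the series hidden in [regular_radial] and
    [singular_radial]; in the regular case r^l is divided out, so that the normalized coefficient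
    has index 0. *)
Definition regular_with l z F f : Prop :=
  [/\ radial_solution gamma l z F, ent f, f 0%N = 1 &
      forall r, 0 < r -> F r = r%:C%C ^+ l * cps f r].

Definition singular_with l z G F f b c : Prop :=
  [/\ radial_solution gamma l z G, regular_with l z F f, ent b, b 0%N = 1 &
      forall r, 0 < r -> G r = formv l b c F r].

Lemma cps_low n a r : ent a -> (forall k, (k < n)%N -> a k = 0) ->
  cps a r = r%:C%C ^+ n * cps (fun k => a (k + n)%N) r.
Proof.
move=> ea a0; rewrite -cps_iter_xseq; last first.
  by elim: n {a0} => [|n IH]; [under eq_fun do rewrite addn0|under eq_fun do rewrite addnS -addSn; apply: (ent_tseq IH)].
congr (cps _ r); apply/funext => k; rewrite iter_xseqE; case: ltnP => [/a0//|nk].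
by rewrite subnK.
Qed.

Lemma ent_shift n a : ent a -> ent (fun k => a (k + n)%N).
Proof.
move=> ea; elim: n => [|n IH]; first by under eq_fun do rewrite addn0.
by under eq_fun do rewrite addnS -addSn; apply: (ent_tseq IH).
Qed.

Lemma regular_withP l z F : regular_radial gamma l z F <-> exists f, regular_with l z F f.
Proof.
split=> [[hF [a [/entire_ent ea a0 al aF]]]|[f [hF ef f0 fF]]].
  exists (fun k => a (k + l)%N); split=> //; first exact: ent_shift.
  by move=> r r0; rewrite -cps_low //; apply: power_sum_cps; apply: aF.
split=> //; exists (iter l (@xseq R) f); have ei := ent_iter_xseq l ef; split.
- exact: ent_entire.
- by move=> k kl; rewrite iter_xseq_low.
- by rewrite iter_xseq_at.
- by move=> r r0; rewrite fF // -cps_iter_xseq //; apply: cps_power_sum.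
Qed.

Lemma singular_withP l z G : singular_radial gamma l z G <->
  exists F f b c, singular_with l z G F f b c.
Proof.
split=> [[hG [F [H [c [b [/regular_withP[f hF] /entire_ent eb b0 bH GH]]]]]]|].
  exists F, f, b, c; split=> // r r0; rewrite GH //; congr (_ + _).
  rewrite -(power_sum_cps (bH r r0)) mulrA -exprMn rcV mulVf ?rc_neq0 //.
  by rewrite expr1n mul1r.
move=> [F [f [b [c [hG hF eb b0 Gf]]]]]; split=> //.
exists F, (fun r => (r^-1)%:C%C ^+ l.+1 * cps b r), c, b; split=> //.
- by apply/regular_withP; exists f.
- exact: ent_entire.
- move=> r r0; rewrite mulrA -exprMn rcV mulfV ?rc_neq0 // expr1n mul1r.
  exact: cps_power_sum.
Qed.

(** By [form_ode] the equation says that r^-(l+1) times a power series vanishes for r > 0, and such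
    a series has zero coefficients. *)
Lemma radial_form_rec l z v F f b c : radial_solution gamma l z F -> ent f ->
  (forall r, 0 < r -> F r = r%:C%C ^+ l * cps f r) -> ent b ->
  (forall r, 0 < r -> v r = formv l b c F r) ->
  radial_solution gamma l z v <-> forall k, formrec gamma l z b c f k = 0.
Proof.
move=> hF ef Ff eb vf; have er := ent_formrec gamma l z c eb ef.
split=> [hv|rec0].
  apply: (cps_eq0 er) => r r0; have hf := radial_near vf hv.
  have [_ _] := hf r r0.
  have d1 t : 0 < t -> cderiv (formv l b c F) t = form1 l b c F t.
    by move=> t0; have [_] := is_cd_derive (is_cd_form c eb hF t0).
  have d2 := is_cd_eqpos r0 (fun t t0 => esym (d1 t t0)) (is_cd_form1 c eb hF r0).
  have [_ e2] := is_cd_derive d2.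
  rewrite d1 // e2 (form_ode c eb ef hF Ff r0) => /eqP.
  by rewrite mulf_eq0 expf_eq0 rcV invr_eq0 (negbTE (rc_neq0 r0)) andbF => /eqP.
apply: (@radial_near _ _ _ _ (formv l b c F)) => [r r0|]; first by rewrite vf.
refine (@radial_intro _ _ _ _ _ (form1 l b c F) _ (fun t pos => is_cd_form c eb hF pos)
  (fun t pos => is_cd_form1 c eb hF pos) _) => r r0.
rewrite (form_ode c eb ef hF Ff r0).
have -> : formrec gamma l z b c f = fun=> 0 by apply/funext.
by rewrite cps0 mulr0.
Qed.

Lemma radial_pow_rec l z v f : ent f -> (forall r, 0 < r -> v r = r%:C%C ^+ l * cps f r) ->
  radial_solution gamma l z v <->
  forall k, (k * (k + (l + l).+1))%:R * f k + 2 * g * xseq f k + z * xseq (xseq f) k = 0.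
Proof.
move=> ef vf; have ei := ent_iter_xseq (l + l).+1 ef.
have vf' r : 0 < r -> v r = formv l (iter (l + l).+1 (@xseq R) f) 0 (fun=> 0) r.
  move=> r0; rewrite vf // /formv cps_iter_xseq // mulr0 addr0 -addSn exprD mulrA mulrA.
  by rewrite -exprMn rcV mulVf ?rc_neq0 // expr1n mul1r.
have z0 r : 0 < r -> (fun=> 0 : C) r = r%:C%C ^+ l * cps (fun=> 0) r.
  by rewrite cps0 mulr0.
split=> [/(radial_form_rec (radial0 _ l z) (@ent0 R) z0 ei vf') h k|h].
  by have := h (k + (l + l).+1)%N; rewrite rec_regular.
apply/(radial_form_rec (radial0 _ l z) (@ent0 R) z0 ei vf') => k.
case: (ltnP k (l + l).+1) => [|Nk]; first exact: rec_regular_low.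
by rewrite -(subnK Nk) rec_regular.
Qed.

End RegularSingular.

(** * Existence and uniqueness of regular and singular radial solutions *)

Section Ladder.
Variables (R : realType) (gamma : R).
Notation C := R[i].
Notation g := (gamma%:C%C : C).
Implicit Types (u v F G : R -> C) (l : nat) (z c : C) (r : R) (a b f : nat -> C).

Lemma natC_neq0 n : n.+1%:R != 0 :> C.
Proof. by rewrite pnatr_eq0. Qed.

Lemma natRC n : ((n%:R : R)%:C)%C = n%:R :> C.
Proof. by rewrite rmorph_nat. Qed.

Lemma regular_exists l z : exists F f, regular_with gamma l z F f.
Proof.
pose D (k : nat) : R := (k * (k + (l + l).+1))%:R.
pose f := frob D (fun=> 1) (fun=> 0) (2 * g) z.
have ef : ent f.
  apply: (@ent_frob _ _ _ _ _ _ 0); first exact: ent0.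
  by move=> k _; rewrite ler_nat leq_pmulr // addnS.
have ff k : (k * (k + (l + l).+1))%:R * f k + 2 * g * xseq f k + z * xseq (xseq f) k = 0.
  have [->|k0] := eqVneq k 0%N; first by rewrite !mulr0 mul0r !addr0.
  have Dk : D k != 0 by rewrite pnatr_eq0 muln_eq0 addnS (negbTE k0).
  by have := frob_rec (fun=> 1) (fun=> 0) (2 * g) z Dk; rewrite addr0 natRC.
exists (fun r => r%:C%C ^+ l * cps f r), f; split=> //.
  by apply/(@radial_pow_rec _ gamma l z _ f ef).
by apply: frob_init; rewrite /D mul0n.
Qed.

Lemma formrecE l z b c f k : formrec gamma l z b c f k =
  k%:R * (k%:R - (l + l).+1%:R) * b k + 2 * g * xseq b k + z * xseq (xseq b) k
  + c * iter (l + l).+1 (@xseq R) (logterm l f) k.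
Proof.
have aux (K : comPzRingType) (n k' y a1 a2 a3 : K) :
  k' * (k' * y) + (- n * (k' * y) + (a1 + (a2 + a3))) = k' * (k' - n) * y + a1 + a2 + a3 by ring.
exact: aux.
Qed.

(** A nonzero solution of the homogeneous recursion can start only at an index where D vanishes. *)
Lemma homogeneous_rec0 n (e D : nat -> C) (A B : C) :
  (forall k, (k < n)%N -> D k = 0 -> e k = 0) ->
  (forall k, (k < n)%N -> D k * e k + A * xseq e k + B * xseq (xseq e) k = 0) ->
  forall k, (k < n)%N -> e k = 0.
Proof.
move=> h0 h k; elim/ltn_ind: k => k IH kn; have [/h0->//|Dk] := eqVneq (D k) 0.
have e1 : xseq e k = 0.
  by case: k IH kn Dk => //= k IH kn _; apply: IH => //; apply: ltn_trans kn.
have e2 : xseq (xseq e) k = 0.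
  by case: k IH kn Dk {e1} => [|[|k]] //= IH kn _; apply: IH => //; apply: ltn_trans kn; apply: ltn_trans (ltnSn k.+1).
have := h k kn; rewrite e1 e2 !mulr0 !addr0 => /eqP.
by rewrite mulf_eq0 (negbTE Dk) => /eqP.
Qed.

Lemma natC_sub_eq0 k n : (k%:R * (k%:R - n%:R) == 0 :> C) = (k == 0%N) || (k == n).
Proof. by rewrite mulf_eq0 subr_eq0 eqr_nat pnatr_eq0. Qed.

Lemma xseq_lin a b (t : C) k : xseq (fun k => a k + t * b k) k = xseq a k + t * xseq b k.
Proof. by case: k => //=; rewrite mulr0 addr0. Qed.

Lemma xseq2_lin a b (t : C) k :
  xseq (xseq (fun k => a k + t * b k)) k = xseq (xseq a) k + t * xseq (xseq b) k.
Proof. by case: k => [|[|k]] //=; rewrite mulr0 addr0. Qed.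

(** The recursion is resonant at N = 2l+1, where the factor of b_N is zero. A series [b1] started at
    1 violates the equation only there; the series [b2] driven by the logarithm starts no earlier
    than N, and adding c times it together with the logarithmic term repairs that one equation. *)
Lemma singular_exists l z F f : regular_with gamma l z F f ->
  exists G b c, singular_with gamma l z G F f b c.
Proof.
move=> hF; have [rF ef f1 fF] := hF; set N := (l + l).+1.
pose D (k : nat) : R := k%:R * (k%:R - N%:R).
have Dnat k : (D k)%:C%C = k%:R * (k%:R - N%:R) :> C by rewrite /D rmorphM rmorphB /= !natRC.
have D0 k : (D k == 0) = (k == 0%N) || (k == N).
  by rewrite mulf_eq0 subr_eq0 eqr_nat pnatr_eq0.
have Dlarge k : (N.+1 <= k)%N -> k%:R <= D k.
  by move=> Nk; rewrite /D -natrB ?(ltnW Nk) // -natrM ler_nat leq_pmulr // subn_gt0.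
pose d := iter N (@xseq R) (logterm l f).
have ed : ent d by apply: ent_iter_xseq; apply: ent_logterm.
pose b1 := frob D (fun k => (k == 0%N)%:R) (fun=> 0) (2 * g) z.
pose b2 := frob D (fun=> 0) d (2 * g) z.
have eb1 : ent b1 by apply: (ent_frob _ _ _ (@ent0 R) Dlarge).
have eb2 : ent b2 by apply: (ent_frob _ _ _ ed Dlarge).
have b2low k : (k < N)%N -> b2 k = 0.
  move: k; apply: (@homogeneous_rec0 _ _ (fun k => (D k)%:C%C) (2 * g) z) => k kN.
    by move=> /eqP; rewrite eq_complex /= eqxx andbT => /eqP Dk; apply: (frob_init _ _ _ _ Dk).
  have [Dk|Dk] := eqVneq (D k) 0; last first.
    have dk : d k = 0 by rewrite /d iter_xseq_low.
    by have := frob_rec (fun=> 0) d (2 * g) z Dk; rewrite dk addr0.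
  have k0 : k = 0%N by move/eqP: Dk; rewrite D0 (ltn_eqF kN) orbF => /eqP.
  by rewrite k0 /D !mul0r /= !mulr0 !addr0.
(* Solves the equation at N: the factor of b_N is zero, [b2] does not contribute below N, and the
   logarithmic term has leading coefficient N because f 0 = 1. *)
pose c := - (2 * g * xseq b1 N + z * xseq (xseq b1) N) / N%:R.
pose b k := b1 k + c * b2 k.
have eb : ent b by apply: entD => //; apply: entZ.
have brec k : formrec gamma l z b c f k = 0.
  have aux (K : comPzRingType) (D' y1 y2 c' a1 a2 w1 w2 A B d' : K) :
    D' * y1 + A * a1 + B * w1 + 0 = 0 -> D' * y2 + A * a2 + B * w2 + d' = 0 ->
    D' * (y1 + c' * y2) + A * (a1 + c' * a2) + B * (w1 + c' * w2) + c' * d' = 0.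
    move=> e1 e2; rewrite -[RHS](addr0 0) -[X in _ = X + _]e1 -[X in _ = _ + X](mulr0 c') -[X in _ = _ + _ * X]e2.
    ring.
  rewrite formrecE /b xseq_lin xseq2_lin -/N -/d -Dnat.
  have [Dk|Dk] := eqVneq (D k) 0; last first.
    apply: aux; first exact: (frob_rec (fun k => (k == 0%N)%:R) (fun=> 0) (2 * g) z Dk).
    exact: (frob_rec (fun=> 0) d (2 * g) z Dk).
  rewrite Dk mul0r add0r; move/eqP: Dk; rewrite D0 => /orP[/eqP->|/eqP->].
    by rewrite /d /= !(mulr0, addr0).
  have -> : xseq b2 N = 0 by apply: b2low.
  have -> : xseq (xseq b2) N = 0 by rewrite /N /=; case E : (l + l)%N => //=; apply: b2low; rewrite /N E.
  have -> : d N = N%:R by rewrite /d iter_xseq_at /logterm f1 mulr1 /nseq mul0r mulr0 addr0.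
  by rewrite !mulr0 !addr0 /c divfK ?natC_neq0 // subrr.
exists (formv l b c F), b, c; split=> //.
  by apply/(@radial_form_rec _ gamma _ _ _ F f b c).
rewrite /b /b1 /b2 !frob_init ?mulr0 ?addr0 //; by apply/eqP; rewrite D0.
Qed.

(** Without its leading term the form loses its whole pole: the coefficients below the resonance N
    vanish, the equation at N then forces c = 0, and b minus b_N times the shifted series of F
    vanishes at both resonant indices, hence everywhere. *)
Lemma form_regular l z v F f b c : regular_with gamma l z F f ->
  radial_solution gamma l z v -> ent b -> b 0%N = 0 ->
  (forall r, 0 < r -> v r = formv l b c F r) ->
  forall r, 0 < r -> v r = b (l + l).+1 * F r.
Proof.
move=> [rF ef f1 fF] rv eb b0 vb; set N := (l + l).+1.
have brec := (radial_form_rec rF ef fF eb vb).1 rv.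
have N0 : N%:R != 0 :> C by apply: natC_neq0.
have blow k : (k < N)%N -> b k = 0.
  move: k; apply: (@homogeneous_rec0 _ _ (fun k => k%:R * (k%:R - N%:R)) (2 * g) z) => k kN.
    by move/eqP; rewrite natC_sub_eq0 (ltn_eqF kN) orbF => /eqP->.
  by have := brec k; rewrite formrecE iter_xseq_low // mulr0 addr0.
have c0 : c = 0.
  have := brec N; rewrite formrecE -/N subrr mulr0 mul0r add0r.
  have -> : xseq b N = 0 by apply: blow.
  have -> : xseq (xseq b) N = 0 by rewrite /N /=; case E : (l + l)%N => //=; apply: blow; rewrite /N E.
  have -> : iter N (@xseq R) (logterm l f) N = N%:R.
    by rewrite iter_xseq_at /logterm f1 mulr1 /nseq mul0r mulr0 addr0.
  by rewrite !mulr0 !add0r => /eqP; rewrite mulf_eq0 (negbTE N0) orbF => /eqP.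
have frec k : formrec gamma l z (iter N (@xseq R) f) 0 (fun=> 0) k = 0.
  case: (ltnP k N) => [|Nk]; first exact: rec_regular_low.
  by rewrite -(subnK Nk) rec_regular; apply: ((@radial_pow_rec _ gamma l z F f ef fF).1 rF).
pose t := - b N; pose e k := b k + t * iter N (@xseq R) f k.
have eN k : (k < N.+1)%N -> e k = 0.
  rewrite ltnS leq_eqVlt => /orP[/eqP->|kN]; last by rewrite /e blow // iter_xseq_low // mulr0 addr0.
  by rewrite /e iter_xseq_at f1 mulr1 subrr.
have e0 k : e k = 0.
  apply: (@homogeneous_rec0 k.+1 _ (fun k => k%:R * (k%:R - N%:R)) (2 * g) z) => // {}k _.
    by move/eqP; rewrite natC_sub_eq0 => kk; apply: eN; case/orP: kk => /eqP->.
  have aux (K : comPzRingType) (D' y1 y2 c' a1 a2 w1 w2 A B : K) :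
    D' * y1 + A * a1 + B * w1 = 0 -> D' * y2 + A * a2 + B * w2 = 0 ->
    D' * (y1 + c' * y2) + A * (a1 + c' * a2) + B * (w1 + c' * w2) = 0.
    move=> e1 e2; rewrite -[RHS](addr0 0) -[X in _ = X + _]e1 -[X in _ = _ + X](mulr0 c') -[X in _ = _ + _ * X]e2.
    ring.
  rewrite /e xseq_lin xseq2_lin; apply: aux.
    by have := brec k; rewrite formrecE c0 mul0r addr0.
  by have := frec k; rewrite formrecE mul0r addr0.
have bE : b = fun k => b N * iter N (@xseq R) f k.
  by apply/funext => k; have := e0 k; rewrite /e /t mulNr => /eqP; rewrite subr_eq0 => /eqP.
move=> r r0; rewrite vb // fF // /formv c0 !mul0r addr0 {1}bE cpsZ; last exact: ent_iter_xseq.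
rewrite cps_iter_xseq // mulrCA; congr (_ * _).
by rewrite /N -addSn exprD !mulrA -exprMn rcV mulVf ?rc_neq0 // expr1n mul1r.
Qed.

(** The regular ladder constants are read off with this: the factor is the leading coefficient of
    the series of v. *)
Lemma pow_regular l z v F f (h : nat -> C) : regular_with gamma l z F f ->
  radial_solution gamma l z v -> ent h -> (forall r, 0 < r -> v r = r%:C%C ^+ l * cps h r) ->
  forall r, 0 < r -> v r = h 0%N * F r.
Proof.
move=> hF rv eh vh r r0.
rewrite (@form_regular _ _ _ _ _ (iter (l + l).+1 (@xseq R) h) 0 hF rv) //.
- by rewrite iter_xseq_at.
- exact: ent_iter_xseq.
- move=> t t0; rewrite vh // /formv cps_iter_xseq // !mul0r addr0 -addSn exprD !mulrA.
  by rewrite -exprMn rcV mulVf ?rc_neq0 // expr1n mul1r.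
Qed.

Lemma regular_unique l z F F' : regular_radial gamma l z F -> regular_radial gamma l z F' ->
  forall r, 0 < r -> F r = F' r.
Proof.
move=> /regular_withP[f [rF ef f1 fF]] /regular_withP[f' hF'] r r0.
by rewrite (pow_regular hF' rF ef fF r0) f1 mul1r.
Qed.

(** Subtracting b_0 G kills the leading coefficient, so [form_regular] applies to the difference. *)
Lemma singular_form l z v G F f b c : singular_radial gamma l z G ->
  regular_with gamma l z F f -> radial_solution gamma l z v -> ent b ->
  (forall r, 0 < r -> v r = formv l b c F r) ->
  exists t : C, forall r, 0 < r -> v r = b 0%N * G r + t * F r.
Proof.
move=> /singular_withP[F' [f' [b' [c' [rG hF' eb' b'1 Gf]]]]] hF rv eb vf.
have FF' r : 0 < r -> F' r = F r.
  by apply: (@regular_unique l z); apply/regular_withP; [exists f'|exists f].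
pose w r := v r + (- b 0%N) * G r; have rw : radial_solution gamma l z w by exact: radial_lin.
pose bb k := b k + (- b 0%N) * b' k.
have ebb : ent bb by apply: entD => //; apply: entZ.
have wf r : 0 < r -> w r = formv l bb (c + (- b 0%N) * c') F r.
  move=> r0; rewrite /w vf // Gf // /formv FF' // cpsD ?cpsZ //; last exact: entZ.
  have aux (K : comPzRingType) (p x y t L c1 c2 F1 : K) :
    p * x + c1 * L * F1 + t * (p * y + c2 * L * F1) = p * (x + t * y) + (c1 + t * c2) * L * F1 by ring.
  exact: aux.
have bb0 : bb 0%N = 0 by rewrite /bb b'1 mulr1 subrr.
exists (bb (l + l).+1) => r r0; rewrite -(form_regular hF rw ebb bb0 wf r0) /w.
by rewrite mulNr addrC subrK.
Qed.

Lemma singular_unique l z G G' F : singular_radial gamma l z G -> singular_radial gamma l z G' ->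
  regular_radial gamma l z F ->
  exists t : C, forall r, 0 < r -> G' r = G r + t * F r.
Proof.
move=> sG /singular_withP[F' [f' [b' [c' [rG' hF' eb' b'1 G'f]]]]] hF.
have [t ht] := singular_form sG hF' rG' eb' G'f; exists t => r r0.
have hF2 : regular_radial gamma l z F' by apply/regular_withP; exists f'.
by rewrite ht // b'1 mul1r (regular_unique hF2 hF r0).
Qed.

End Ladder.

(** * The ladder constants *)

Section LadderAlgebra.
Variable K : fieldType.

(** The hypotheses are the recursion for the first two coefficients of F_l, with n = l. In [rup] F_l
    the coefficient of r^l cancels by [up_coef0]; the left side here is that of r^(l+1). *)
Lemma up_coef_eq (n g z f1 f2 : K) : n + 1 != 0 -> 2 * n + 3 != 0 -> 2 != 0 :> K ->
  (1 * (1 + (n + n + 1))) * f1 + 2 * g * 1 + z * 0 = 0 ->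
  (2 * (2 + (n + n + 1))) * f2 + 2 * g * f1 + z * 1 = 0 ->
  (n + 1) * (2 * f2) + g * f1 = - (g ^+ 2 + z * (n + 1) ^+ 2) / ((2 * n + 3) * (n + 1)).
Proof.
move=> n1 n3 n2 e1 e2.
have f1E : f1 = - g / (n + 1).
  apply: (mulfI (mulf_neq0 n2 n1)); apply/eqP; rewrite -subr_eq0 -[X in _ == X]e1.
  by apply/eqP; field; rewrite n1.
have f2E : f2 = - (2 * g * f1 + z) / (2 * (2 * n + 3)).
  apply: (mulfI (mulf_neq0 n2 n3)); apply/eqP; rewrite -subr_eq0 -[X in _ == X]e2.
  by apply/eqP; field; rewrite n2 n3.
by rewrite f2E f1E; field; rewrite n2 n3 n1.
Qed.

Lemma up_coef0 (n g z f1 : K) : 2 != 0 :> K ->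
  (1 * (1 + (n + n + 1))) * f1 + 2 * g * 1 + z * 0 = 0 -> (n + 1) * (1 * f1) + g * 1 = 0.
Proof. by move=> n2 e1; apply: (mulfI n2); rewrite mulr0 -[RHS]e1; ring. Qed.

Lemma down_coef0 (n g z b1 : K) : 2 != 0 :> K ->
  1 * (1 - (2 * n + 3)) * b1 + 2 * g * 1 + z * 0 = 0 -> (n + 1) * (1 * b1) - g * 1 = 0.
Proof. by move=> n2 e1; apply: (mulfI n2); rewrite mulr0 -[RHS]oppr0 -[in RHS]e1; ring. Qed.

(** The hypotheses are the recursion for the first coefficients of G_(l+1), with n = l, below the
    reach of the logarithm; the left side is the coefficient of r^-(l+1) in [rdown] G_(l+1). *)
Lemma down_coef_eq (n g z b1 b2 : K) : n + 1 != 0 -> 2 * n + 1 != 0 -> 2 != 0 :> K ->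
  1 * (1 - (2 * n + 3)) * b1 + 2 * g * 1 + z * 0 = 0 ->
  2 * (2 - (2 * n + 3)) * b2 + 2 * g * b1 + z * 1 = 0 ->
  (n + 1) * (2 * b2) - g * b1 = (g ^+ 2 + z * (n + 1) ^+ 2) / ((2 * n + 1) * (n + 1)).
Proof.
move=> n1 n3 n2 e1 e2.
have b1E : b1 = g / (n + 1).
  apply: (mulfI (mulf_neq0 n2 n1)); apply/eqP; rewrite eq_sym -subr_eq0 -[X in _ == X]e1.
  by apply/eqP; field; rewrite n1.
have b2E : b2 = (2 * g * b1 + z) / (2 * (2 * n + 1)).
  apply: (mulfI (mulf_neq0 n2 n3)); apply/eqP; rewrite eq_sym -subr_eq0 -[X in _ == X]e2.
  by apply/eqP; field; rewrite n2 n3.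
by rewrite b2E b1E; field; rewrite n2 n3 n1.
Qed.

Lemma rup_pow_eq n (r g rl f f1 : K) : r != 0 ->
  n.+1%:R * (n%:R * rl * r^-1 * f + rl * f1) - n%:R * n.+1%:R * r^-1 * (rl * f) + g * (rl * f) =
  rl * (n.+1%:R * f1 + g * f).
Proof. by move=> r1; rewrite -[n.+1]addn1 natrD; field. Qed.

Lemma rdown_pow_eq n (r g rl f f1 : K) : r != 0 ->
  n%:R * (n%:R * (r * rl) * r^-1 * f + r * rl * f1) + n%:R * n.+1%:R * r^-1 * (r * rl * f) - g * (r * rl * f) =
  rl * (n%:R * (n + n).+1%:R * f + (n%:R * (r * f1) - g * (r * f))).
Proof. by move=> r1; rewrite -[n.+1]addn1 -[(n + n).+1]addn1 !natrD; field. Qed.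

Lemma inv_pow_eq n (r f : K) : r != 0 ->
  r^-1 * (r ^+ n * f) = (r^-1 * (r^-1 * r^-1 ^+ n)) * (r * r ^+ n * r ^+ n) * f.
Proof.
move=> r1; have e : r^-1 ^+ n * r ^+ n = 1 by rewrite -exprMn mulVf // expr1n.
rewrite -[LHS]mul1r -[X in X * _ = _]e; field; exact: r1.
Qed.

Lemma inv_pow_eq2 n (r f : K) : r != 0 ->
  r^-1 * (r ^+ n * f) = (r^-1 * r^-1 ^+ n) * (r ^+ n * r ^+ n) * f.
Proof.
move=> r1; have e : r^-1 ^+ n * r ^+ n = 1 by rewrite -exprMn mulVf // expr1n.
rewrite -[LHS]mul1r -[X in X * _ = _]e; field; exact: r1.
Qed.

Lemma rup_form_eq n (r g p c L b b1 F F1 q f : K) : r != 0 -> r^-1 * F = (r^-1 * (r^-1 * p)) * q * f ->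
  n.+1%:R * (- n.+1%:R * (r^-1 * (r^-1 * p)) * b + r^-1 * p * b1 + c * (r^-1 * F + L * F1))
  - n%:R * n.+1%:R * r^-1 * (r^-1 * p * b + c * L * F) + g * (r^-1 * p * b + c * L * F) =
  r^-1 * (r^-1 * p) * (n.+1%:R * (r * b1) - n.+1%:R * (n + n).+1%:R * b + g * (r * b) + n.+1%:R * c * (q * f))
  + c * L * (n.+1%:R * F1 - n%:R * n.+1%:R * r^-1 * F + g * F).
Proof.
move=> r1 e; rewrite -[n.+1]addn1 -[(n + n).+1]addn1 !natrD.
apply/eqP; rewrite -subr_eq0; apply/eqP.
transitivity ((n%:R + 1) * c * (r^-1 * F - r^-1 * (r^-1 * p) * q * f)).
  by field.
by rewrite e subrr mulr0.
Qed.

Lemma rdown_form_eq n (r g p c L b b1 F F1 q f : K) : r != 0 -> r^-1 * F = (r^-1 * p) * q * f ->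
  n%:R * (- n.+1%:R * (r^-1 * (r^-1 * p)) * b + r^-1 * p * b1 + c * (r^-1 * F + L * F1))
  + n%:R * n.+1%:R * r^-1 * (r^-1 * p * b + c * L * F) - g * (r^-1 * p * b + c * L * F) =
  r^-1 * p * (n%:R * b1 - g * b + n%:R * c * (q * f))
  + c * L * (n%:R * F1 + n%:R * n.+1%:R * r^-1 * F - g * F).
Proof.
move=> r1 e; rewrite -[n.+1]addn1 !natrD.
apply/eqP; rewrite -subr_eq0; apply/eqP.
transitivity (n%:R * c * (r^-1 * F - r^-1 * p * q * f)).
  by field.
by rewrite e subrr mulr0.
Qed.

End LadderAlgebra.

Section Ladder2.
Variables (R : realType) (gamma : R).
Notation C := R[i].
Notation g := (gamma%:C%C : C).
Implicit Types (u v F G : R -> C) (l : nat) (z c : C) (r : R) (a b f : nat -> C).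

Definition acoef l z : C := g ^+ 2 + z * l.+1%:R ^+ 2.

Lemma natC_odd_neq0 n k : 2 * n%:R + k.+1%:R != 0 :> C.
Proof. by rewrite -natrM -natrD addnS natC_neq0. Qed.

Lemma rup_pow l F f r : ent f -> (forall r, 0 < r -> F r = r%:C%C ^+ l * cps f r) ->
  is_cd F r 1 (cderiv F r) -> 0 < r ->
  rup gamma l F r = r%:C%C ^+ l * cps (fun k => l.+1%:R * dseq f k + g * f k) r.
Proof.
move=> ef fF dF r0; have r1 := rc_neq0 r0.
have h : is_cd F r 1 (r%:C%C ^+ l * cps (dseq f) r + l%:R * r%:C%C ^+ l * (r^-1)%:C%C * cps f r).
  by apply: (is_cd_eqpos r0 _ (is_cdM (is_cd_powr l r0) (is_cd_cps r ef))) => t t0; rewrite fF.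
have ed := ent_dseq ef.
rewrite /rup (is_cd_inj dF h) fF // cpsD ?cpsZ //; try exact: entZ.
by rewrite addrC addrC [X in _ * X]addrC rcV; apply: rup_pow_eq.
Qed.

Lemma natCS n : n.+1%:R = n%:R + 1 :> C. Proof. by rewrite -addn1 natrD. Qed.

Lemma rup_regular l z F F' : regular_radial gamma l z F -> regular_radial gamma l.+1 z F' ->
  forall r, 0 < r -> rup gamma l F r = - acoef l z / ((2 * l%:R + 3) * l.+1%:R) * F' r.
Proof.
move=> /regular_withP[f [rF ef f1 fF]] /regular_withP[f' hF'] r r0.
have frec := (@radial_pow_rec _ gamma l z F f ef fF).1 rF.
pose h k := l.+1%:R * dseq f k + g * f k.
have eh : ent h by apply: entD; apply: entZ => //; apply: ent_dseq.
have rec1 : (1 * (1 + (l%:R + l%:R + 1))) * f 1%N + 2 * g * 1 + z * 0 = 0.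
  by have := frec 1%N; rewrite natrM natrD (natCS (l + l)) (natrD _ l) /= f1.
have rec2 : (2 * (2 + (l%:R + l%:R + 1))) * f 2%N + 2 * g * f 1%N + z * 1 = 0.
  by have := frec 2%N; rewrite natrM natrD (natCS (l + l)) (natrD _ l) /= f1.
have h0 : h 0%N = 0 by rewrite /h (natCS l) /dseq f1; apply: up_coef0 rec1; apply: natC_neq0.
have hr t : 0 < t -> rup gamma l F t = t%:C%C ^+ l.+1 * cps (tseq h) t.
  move=> t0; rewrite (rup_pow ef fF (radial_cd1 rF t0) t0) (cps_split t eh) h0 add0r exprSr.
  by rewrite mulrA.
rewrite (pow_regular hF' (rup_radial rF) (ent_tseq eh) hr r0) /tseq /h /dseq /acoef (natCS l).
congr (_ * _); apply: up_coef_eq rec1 rec2; rewrite ?natC_odd_neq0 -?natCS ?natC_neq0 //.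
Qed.

Lemma rdown_regular l z F F' : regular_radial gamma l.+1 z F -> regular_radial gamma l z F' ->
  forall r, 0 < r -> rdown gamma l.+1 F r = l.+1%:R * (2 * l%:R + 3) * F' r.
Proof.
move=> /regular_withP[f [rF ef f1 fF]] /regular_withP[f' hF'] r r0.
pose h k := l.+1%:R * (l.+1 + l.+1).+1%:R * f k + (l.+1%:R * xseq (dseq f) k + (- g) * xseq f k).
have ed := ent_dseq ef; have exd := ent_xseq ed; have ex := ent_xseq ef.
have eh : ent h by apply: entD; [apply: entZ|apply: entD; apply: entZ].
have hr t : 0 < t -> rdown gamma l.+1 F t = t%:C%C ^+ l * cps h t.
  move=> t0.
  have hd : is_cd F t 1 (t%:C%C ^+ l.+1 * cps (dseq f) t + l.+1%:R * t%:C%C ^+ l.+1 * (t^-1)%:C%C * cps f t).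
    by apply: (is_cd_eqpos t0 _ (is_cdM (is_cd_powr l.+1 t0) (is_cd_cps t ef))) => w w0; rewrite fF.
  rewrite /rdown (is_cd_inj (radial_cd1 rF t0) hd) fF // /h cpsD; last 2 first.
  - exact: entZ.
  - by apply: entD; apply: entZ.
  rewrite cpsD ?cpsZ ?cps_xseq //; try exact: entZ.
  rewrite [X in _ * X + _]addrC rcV mulNr exprS; exact: rdown_pow_eq (rc_neq0 t0).
rewrite (pow_regular hF' (rdown_radial rF) eh hr r0) /h /= !mulr0 !addr0 f1 mulr1.
by congr (_ * _ * _); rewrite -natrM -natrD; congr (_%:R); lia.
Qed.

(** The pole grows by one order, with leading coefficient -(l+1)(2l+1), and the logarithm now
    multiplies [rup] F_l, a multiple of F_(l+1) by [rup_regular]. The result is again a Frobenius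
    form, identified by [singular_form]. *)
Lemma rup_singular l z G G' F' : singular_radial gamma l z G -> singular_radial gamma l.+1 z G' ->
  regular_radial gamma l.+1 z F' ->
  exists t : C, forall r, 0 < r ->
    rup gamma l G r = - (l.+1%:R * (2 * l%:R + 1)) * G' r + t * F' r.
Proof.
move=> /singular_withP[F [f [b [c [rG hF eb b1 Gf]]]]] sG' hF0.
have [f' hF'] := (regular_withP gamma l.+1 z F').1 hF0.
have [rF ef f1 fF] := hF.
have hFr : regular_radial gamma l z F by apply/regular_withP; exists f.
pose k := - acoef l z / ((2 * l%:R + 3) * l.+1%:R).
have ed := ent_dseq eb; have exd := ent_xseq ed; have ex := ent_xseq eb.
have ei := ent_iter_xseq (l + l).+1 ef.
(* The coefficients of r^(l+2) times the part of [rup] G free of logarithms. The last term, from the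
   derivative of log r, enters only at index 2l+1. *)
pose h j := l.+1%:R * xseq (dseq b) j + (- (l.+1%:R * (l + l).+1%:R) * b j + (g * xseq b j +
  l.+1%:R * c * iter (l + l).+1 (@xseq R) f j)).
have e1 : ent (fun j => l.+1%:R * c * iter (l + l).+1 (@xseq R) f j) by exact: entZ.
have e2 : ent (fun j => g * xseq b j + l.+1%:R * c * iter (l + l).+1 (@xseq R) f j).
  by apply: entD => //; apply: entZ.
have e3 : ent (fun j => - (l.+1%:R * (l + l).+1%:R) * b j + (g * xseq b j +
  l.+1%:R * c * iter (l + l).+1 (@xseq R) f j)) by apply: entD => //; apply: entZ.
have e4 : ent (fun j => l.+1%:R * xseq (dseq b) j) by apply: entZ.
have eh : ent h by apply: entD.
have hv r : 0 < r -> rup gamma l G r = formv l.+1 h (c * k) F' r.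
  move=> r0; have r1 := rc_neq0 r0.
  have dG : cderiv G r = form1 l b c F r.
    apply: (is_cd_inj (radial_cd1 rG r0)).
    by apply: (is_cd_eqpos r0 _ (is_cd_form c eb rF r0)) => t t0; rewrite Gf.
  rewrite /rup dG Gf // /form1 /formv /h (cpsD _ e4 e3) cpsD // ?cpsD ?cpsZ //; try exact: entZ.
  rewrite cps_iter_xseq // !cps_xseq // !rcV !(exprS _ l.+1) !(exprS _ l).
  have kF := rup_regular hFr hF0 r0; rewrite -/k /rup rcV in kF.
  apply: (etrans (@rup_form_eq _ l r%:C%C g (r%:C%C^-1 ^+ l) c (ln r)%:C%C (cps b r)
    (cps (dseq b) r) (F r) (cderiv F r) (r%:C%C ^+ (l + l).+1) (cps f r) r1 _)).
    by rewrite fF // (exprS _ (l + l)) exprD (mulrA r%:C%C); apply: inv_pow_eq.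
  rewrite kF; congr (_ + _); last by rewrite mulrA [c * _ * k]mulrAC.
  have aux (K : comPzRingType) (n1 N x1 x2 x3 x4 : K) :
    n1 * x1 - n1 * N * x2 + x3 + x4 = n1 * x1 + (- (n1 * N) * x2 + (x3 + x4)) by ring.
  by congr (_ * _); apply: aux.
have [t ht] := singular_form sG' hF' (rup_radial rG) eh hv.
exists t => r r0; rewrite ht //; congr (_ * _ + _).
rewrite /h b1 /= !mulr0 !addr0 add0r mulr1 (natCS (l + l)) (natrD _ l).
have aux (K : comPzRingType) (n1 n : K) : - (n1 * (n + n + 1)) = - (n1 * (2 * n + 1)) by ring.
exact: aux.
Qed.

(** Here G has a pole of order l+2. In [rdown] G the term of order l+3 cancels between the
    derivative and the centrifugal term, that of order l+2 by [down_coef0], so the series is shifted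
    once by [tseq] and order l+1 remains. *)
Lemma rdown_singular l z G G' F' : singular_radial gamma l.+1 z G -> singular_radial gamma l z G' ->
  regular_radial gamma l z F' ->
  exists t : C, forall r, 0 < r ->
    rdown gamma l.+1 G r = acoef l z / ((2 * l%:R + 1) * l.+1%:R) * G' r + t * F' r.
Proof.
move=> /singular_withP[F [f [b [c [rG hF eb b1 Gf]]]]] sG' hF0.
have [f' hF'] := (regular_withP gamma l z F').1 hF0.
have [rF ef f1 fF] := hF; set n := l.+1.
have hFr : regular_radial gamma n z F by apply/regular_withP; exists f.
pose k := n%:R * (2 * l%:R + 3) : C.
have brec := (radial_form_rec rF ef fF eb Gf).1 rG.
have N3 : (n + n).+1%:R = 2 * l%:R + 3 :> C by rewrite -natrM -natrD; congr (_%:R); rewrite /n; lia.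
have rec1 : 1 * (1 - (2 * l%:R + 3)) * b 1%N + 2 * g * 1 + z * 0 = 0.
  by have e := brec 1%N; rewrite formrecE iter_xseq_low // (mulr0 c) addr0 /= b1 N3 in e.
have rec2 : 2 * (2 - (2 * l%:R + 3)) * b 2%N + 2 * g * b 1%N + z * 1 = 0.
  have l2 : (2 < (n + n).+1)%N by rewrite addnS.
  by have e := brec 2%N; rewrite formrecE (iter_xseq_low _ l2) (mulr0 c) addr0 /= b1 N3 in e.
have ed := ent_dseq eb; have ei := ent_iter_xseq (n + n) ef.
pose h j := n%:R * dseq b j + ((- g) * b j + n%:R * c * iter (n + n) (@xseq R) f j).
have e1 : ent (fun j => n%:R * c * iter (n + n) (@xseq R) f j) by exact: entZ.
have e2 : ent (fun j => (- g) * b j + n%:R * c * iter (n + n) (@xseq R) f j).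
  by apply: entD => //; apply: entZ.
have e4 : ent (fun j => n%:R * dseq b j) by apply: entZ.
have eh : ent h by apply: entD.
have h0 : h 0%N = 0.
  rewrite /h /= mulr0 addr0 b1 /dseq mulNr /n natCS; apply: down_coef0 rec1; exact: natC_neq0.
have hv r : 0 < r -> rdown gamma n G r = formv l (tseq h) (c * k) F' r.
  move=> r0; have r1 := rc_neq0 r0.
  have dG : cderiv G r = form1 n b c F r.
    apply: (is_cd_inj (radial_cd1 rG r0)).
    by apply: (is_cd_eqpos r0 _ (is_cd_form c eb rF r0)) => t t0; rewrite Gf.
  have kF := rdown_regular hFr hF0 r0; rewrite -/k /rdown rcV in kF.
  have ch : cps (tseq h) r = r%:C%C^-1 * cps h r.
    by rewrite (cps_split r eh) h0 add0r mulKf.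
  rewrite /formv ch -rcV (mulrA ((r^-1)%:C%C ^+ l.+1)) -exprSr -/n.
  rewrite /rdown dG Gf // /form1 /formv /h (cpsD _ e4 e2) cpsD // ?cpsZ //; try exact: entZ.
  rewrite cps_iter_xseq // !rcV !(exprS _ n.+1) !(exprS _ n).
  apply: (etrans (@rdown_form_eq _ n r%:C%C g (r%:C%C^-1 ^+ n) c (ln r)%:C%C (cps b r)
    (cps (dseq b) r) (F r) (cderiv F r) (r%:C%C ^+ (n + n)) (cps f r) r1 _)).
    by rewrite fF // exprD; apply: inv_pow_eq2.
  rewrite kF; congr (_ + _); last by rewrite mulrA [c * _ * k]mulrAC.
  by congr (_ * _); rewrite mulNr addrA.
have [t ht] := singular_form sG' hF' (rdown_radial rG) (ent_tseq eh) hv.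
exists t => r r0; rewrite ht //; congr (_ * _ + _).
rewrite /tseq /h iter_xseq_low ?addnS // mulr0 addr0 mulNr /dseq /acoef /n natCS.
by apply: down_coef_eq rec1 rec2; rewrite ?natC_odd_neq0 -?natCS ?natC_neq0.
Qed.

End Ladder2.

(** * Solid harmonics *)

Section Ordinal3.

Lemma ord3_cyc (i : 'I_3) :
  [/\ i + 1 + 1 = i + 2, i + 1 + 2 = i, i + 2 + 1 = i & i + 2 + 2 = i + 1] /\
  [/\ (i == i + 1) = false, (i == i + 2) = false & (i + 1 == i + 2) = false].
Proof.
case: i => [[|[|[|//]]] hi]; do !split; do ?[by apply: val_inj]; exact: erefl.
Qed.

Lemma sum3 (V : nmodType) (F : 'I_3 -> V) (i : 'I_3) :
  \sum_j F j = F i + F (i + 1) + F (i + 2).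
Proof.
have [_ [h1 h2 h3]] := ord3_cyc i.
rewrite (bigD1 i) //= (bigD1 (i + 1)) 1?eq_sym ?h1 //= (bigD1 (i + 2)) /=; last first.
  by rewrite eq_sym h2 eq_sym h3.
rewrite big1 ?addr0 ?addrA // => j.
by case: i {h1 h2 h3} => [[|[|[|//]]] hi]; case: j => [[|[|[|//]]] hj].
Qed.

End Ordinal3.

Lemma mpoly_ring_ind n (K : comNzRingType) (T : mpoly.mpoly n K -> Prop) :
  (forall c, T (mpoly.mpolyC n c)) -> (forall i, T (mpoly.mpolyX K (mpoly.mnm1 i))) ->
  (forall P Q, T P -> T Q -> T (P + Q)) -> (forall P Q, T P -> T Q -> T (P * Q)) ->
  forall P, T P.
Proof.
move=> hC hX hD hM P; have h1 : T 1 by rewrite -[1]/(mpoly.mpolyC n 1).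
elim/mpoly.mpolyind: P => [|c m P _ _ IH]; first by rewrite -mpoly.mpolyC0.
apply: (hD _ _ _ IH); rewrite -mpoly.mul_mpolyC; apply: (hM) => //.
rewrite mpoly.mpolyXE_id; apply: (big_ind T) => [//|P0 Q0|i _]; first exact: hM.
elim: (m i) => [|k IHk]; first by rewrite expr0.
by rewrite exprS; apply: (hM) => //; apply: hX.
Qed.

Section MultivariateDerivations.
Variable K : numFieldType.
Notation MP := (mpoly.mpoly 3 K).
Implicit Types (P Q : MP) (i j : 'I_3) (l : nat).

Definition vX i : MP := mpoly.mpolyX K (mpoly.mnm1 i).
Notation D := (@mpoly.mderiv 3 K).
Notation homog l P := (P \is mpoly.ishomog1 l (@mpoly.mdeg 3)).

Lemma mpoly_alg_ind (T : MP -> Prop) :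
  (forall c, T (mpoly.mpolyC 3 c)) -> (forall i, T (vX i)) ->
  (forall P Q, T P -> T Q -> T (P + Q)) -> (forall P Q, T P -> T Q -> T (P * Q)) ->
  forall P, T P.
Proof. exact: mpoly_ring_ind. Qed.

Lemma derivX i j : D i (vX j) = (i == j)%:R.
Proof.
rewrite /vX mpoly.mderivX mpoly.mnm1E eq_sym; case: eqP => [->|_]; last by rewrite scale0r.
rewrite scale1r (_ : mpoly.mnm_sub _ _ = mpoly.mnm0); first exact: mpoly.mpolyX0.
by apply/mpoly.mnmP => k; rewrite mpoly.mnmBE subnn mpoly.mnm0E.
Qed.

Lemma derivMX i j Q : D i (vX j * Q) = (i == j)%:R * Q + vX j * D i Q.
Proof. by rewrite mpoly.mderivM derivX. Qed.

Lemma derivC i j Q : D i (D j Q) = D j (D i Q). Proof. exact: mpoly.mderiv_comm. Qed.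

Definition rot i Q : MP := vX (i + 1) * D (i + 2) Q - vX (i + 2) * D (i + 1) Q.
Definition euler Q : MP := \sum_j vX j * D j Q.
Definition lapl Q : MP := \sum_j D j (D j Q).
Definition rad2 : MP := \sum_j vX j * vX j.

Lemma homog_X i : homog 1 (vX i).
Proof. by rewrite mpoly.dhomogX /= mpoly.mdeg1. Qed.

Lemma homog_M l l' P Q : homog l P -> homog l' Q -> homog (l + l') (P * Q).
Proof. exact: mpoly.dhomogM. Qed.

Lemma homog_sub l P Q : homog l P -> homog l Q -> homog l (P - Q).
Proof. by move=> hP hQ; apply: rpredB. Qed.

Lemma homog_D l i P : homog l P -> homog l.-1 (D i P).
Proof.
move=> /mpoly.dhomogP hP; apply/mpoly.dhomogP => m; rewrite mpoly.mcoeff_msupp.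
rewrite mpoly.mcoeff_deriv => h; have : mpoly.mnm_add m (mpoly.mnm1 i) \in mpoly.msupp P.
  by rewrite mpoly.mcoeff_msupp; apply/eqP => e; move: h; rewrite e mul0rn eqxx.
by move=> /hP <-; rewrite /= mpoly.mdegD mpoly.mdeg1 addn1.
Qed.

Lemma homog0_D i P : homog 0 P -> D i P = 0.
Proof.
move=> /mpoly.dhomogP hP; apply/mpoly.mpolyP => m; rewrite mpoly.mcoeff0 mpoly.mcoeff_deriv.
have [->|h] := eqVneq (mpoly.mcoeff (mpoly.mnm_add m (mpoly.mnm1 i)) P) 0; first by rewrite mul0rn.
rewrite -mpoly.mcoeff_msupp in h.
by have := hP _ h; rewrite /= mpoly.mdegD mpoly.mdeg1 addn1.
Qed.

Lemma euler_homog l P : homog l P -> euler P = l%:R * P.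
Proof.
move=> /mpoly.dhomogP hP; rewrite /euler {2}[P]mpoly.mpolyE mulr_sumr.
under eq_bigr => j _ do rewrite {1}[P]mpoly.mpolyE raddf_sum mulr_sumr.
rewrite exchange_big big_seq [RHS]big_seq; apply: eq_bigr => m mP.
have := hP m mP; rewrite /= mpoly.mdegE => <-; rewrite natr_sum mulr_suml.
apply: eq_bigr => j _ /=; rewrite linearZ /= mpoly.mderivX.
rewrite -!scalerAr; have [->|mj] := eqVneq (m j) 0%N.
  by rewrite scale0r mul0r.
rewrite /vX -mpoly.mpolyXD mpoly.addmC mpoly.submK; last first.
  by apply/mpoly.mnm_lepP => k; rewrite mpoly.mnm1E; case: eqP => // <-; rewrite lt0n.
by rewrite mulr_natl scaler_nat.
Qed.

Lemma laplD P Q : lapl (P + Q) = lapl P + lapl Q.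
Proof. by rewrite /lapl -big_split; apply: eq_bigr => j _; rewrite !raddfD. Qed.
Lemma lapl0 : lapl 0 = 0.
Proof. by rewrite /lapl big1 // => j _; rewrite !raddf0. Qed.
Lemma laplN P : lapl (- P) = - lapl P.
Proof. by rewrite /lapl -sumrN; apply: eq_bigr => j _; rewrite !raddfN. Qed.
Lemma laplZ c P : lapl (c *: P) = c *: lapl P.
Proof. by rewrite /lapl scaler_sumr; apply: eq_bigr => j _; rewrite !linearZ. Qed.
Lemma lapl_D i P : lapl (D i P) = D i (lapl P).
Proof. by rewrite /lapl raddf_sum; apply: eq_bigr => j _; rewrite !(derivC j i). Qed.

Lemma lapl_MX j Q : lapl (vX j * Q) = 2 * D j Q + vX j * lapl Q.
Proof.
have [_ [h1 h2 _]] := ord3_cyc j; rewrite /lapl !(sum3 _ j) !derivMX.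
rewrite eqxx [j + 1 == j]eq_sym h1 [j + 2 == j]eq_sym h2 !raddfD /= !mul0r !mul1r !derivMX.
rewrite eqxx [j + 1 == j]eq_sym h1 [j + 2 == j]eq_sym h2 !mul0r !mul1r !raddf0.
move: (D j Q) (D j (D j Q)) (D (j + 1) (D (j + 1) Q)) (D (j + 2) (D (j + 2) Q)) => a0 b0 c0 d0.
have aux (A : comPzRingType) (x a b c d : A) :
   a + (a + x * b) + (0 + (0 + x * c)) + (0 + (0 + x * d)) = 2 * a + x * (b + c + d) by ring.
exact: aux.
Qed.

Definition harm l P : Prop := homog l P /\ lapl P = 0.

Lemma harm0 l : harm l 0.
Proof. by split; [exact: rpred0|rewrite /lapl big1 // => j _; rewrite !raddf0]. Qed.

Lemma harm_lin l c P Q : harm l P -> harm l Q -> harm l (c *: P + Q).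
Proof.
move=> [h1 e1] [h2 e2]; split; first by apply: rpredD => //; apply: rpredZ.
by rewrite laplD laplZ e1 e2 scaler0 addr0.
Qed.

Lemma harm_D l i P : harm l P -> harm l.-1 (D i P).
Proof. by move=> [h e]; split; [exact: homog_D|rewrite lapl_D e raddf0]. Qed.

Lemma harm_rot l i P : harm l P -> harm l (rot i P).
Proof.
move=> [h e]; split.
  have hh a b : homog l (vX a * D b P).
    case: l h => [|l] h; first by rewrite homog0_D // mulr0; exact: rpred0.
    by apply: (homog_M (l := 1)); [exact: homog_X|exact: (homog_D (l := l.+1))].
  exact: homog_sub.
rewrite laplD laplN !lapl_MX !lapl_D e !raddf0 !mulr0 !addr0.
by rewrite derivC subrr.
Qed.

(** The harmonic part of x_i P. The correction is fixed by the Laplacian of r^2 Q being (6 + 4 deg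
    Q) Q for harmonic Q, used with Q = d_i P of degree l - 1, where the factor is 2(2l+1). *)
Definition raise l i P : MP := vX i * P - (2 * l%:R + 1)^-1 *: (rad2 * D i P).

Lemma lapl_rad2 l P : harm l P -> lapl (rad2 * P) = (6 + 4 * l%:R) * P.
Proof.
move=> [h e]; rewrite /rad2 mulr_suml.
have -> : lapl (\sum_j vX j * vX j * P) = \sum_j lapl (vX j * (vX j * P)).
  by rewrite (big_morph lapl laplD lapl0); apply: eq_bigr => j _; rewrite mulrA.
transitivity (\sum_j (2 * P + 4 * (vX j * D j P))).
  apply: eq_bigr => j _; rewrite !lapl_MX e derivMX eqxx mulr0 addr0.
  have aux (A : comPzRingType) (x a p : A) : 2 * (1 * p + x * a) + x * (2 * a) = 2 * p + 4 * (x * a) by ring.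
  exact: aux.
have -> : \sum_j (2 * P + 4 * (vX j * D j P)) = \sum_(j < 3) (2 * P) + 4 * euler P.
  by rewrite big_split /= /euler mulr_sumr.
rewrite (euler_homog h) sumr_const card_ord.
have aux (A : comPzRingType) (p n : A) : (2 * p) *+ 3 + 4 * (n * p) = (6 + 4 * n) * p by ring.
exact: aux.
Qed.

Lemma homog_rad2 : homog 2 rad2.
Proof. by apply: rpred_sum => j _; apply: (homog_M (l := 1)); apply: homog_X. Qed.

Lemma harm_raise l i P : harm l P -> harm l.+1 (raise l i P).
Proof.
move=> hP; have [h e] := hP; rewrite /raise; case: l h e hP => [|l] h e hP.
  rewrite homog0_D // (mulr0 rad2) scaler0 subr0; split.
    by apply: (homog_M (l := 1) (l' := 0)) => //; exact: homog_X.
  by rewrite lapl_MX e mulr0 addr0 homog0_D // mulr0.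
have hD := harm_D i hP; split.
  apply: homog_sub; first by apply: (homog_M (l := 1)) => //; exact: homog_X.
  by apply: rpredZ; apply: (homog_M (l := 2)); [exact: homog_rad2|exact: hD.1].
rewrite laplD laplN laplZ lapl_MX e mulr0 addr0 (lapl_rad2 hD) /=.
have n0 : (2 * l.+1%:R + 1 : K) != 0 by rewrite -natrM natr1 pnatr_eq0.
have -> : (6 + 4 * l%:R) * D i P = (2 * l.+1%:R + 1) *: (2 * D i P).
  have -> : (2 * l.+1%:R + 1 : K) = (2 * l.+1 + 1)%:R by rewrite natrD natrM.
  rewrite scaler_nat -[RHS]mulr_natl natrD natrM -[l.+1]addn1 natrD.
  have aux (A : comNzRingType) (n x : A) : (6 + 4 * n) * x = (2 * (n + 1) + 1) * (2 * x) by ring.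
  exact: aux.
by rewrite scalerA mulVf // scale1r subrr.
Qed.

(** Harmonicity kills the correction terms and Euler's identity evaluates the rest. So every
    harmonic polynomial of positive degree is obtained by raising its own gradient. *)
Lemma sum_raise_deriv l P : harm l.+1 P -> \sum_i raise l i (D i P) = l.+1%:R *: P.
Proof.
move=> [h e]; rewrite /raise sumrB -scaler_sumr -mulr_sumr -/(lapl P) e mulr0 scaler0 subr0.
by rewrite -/(euler P) (euler_homog h) scaler_nat mulr_natl.
Qed.

(** The sum of the squares of the L_i is r^2 times the Laplacian minus E(E+1), with E the Euler
    operator. The hypotheses are harmonicity and Euler's identity for P and for its first
    derivatives. *)
Lemma casimir_eq (A : comNzRingType) (x y z p px py pz pxx pyy pzz pxy pxz pyz n : A) :
  pxx + pyy + pzz = 0 ->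
  x * pxz + y * pyz + z * pzz = n * pz - pz ->
  x * pxy + y * pyy + z * pyz = n * py - py ->
  x * pxx + y * pxy + z * pxz = n * px - px ->
  x * px + y * py + z * pz = n * p ->
  y * (y * pzz - py - z * pyz) - z * (pz + y * pyz - z * pyy) +
  (z * (z * pxx - pz - x * pxz) - x * (px + z * pxz - x * pzz)) +
  (x * (x * pyy - px - y * pxy) - y * (py + x * pxy - y * pxx)) = - (n * (n + 1) * p).
Proof.
move=> e0 e3 e2 e1 e4.
transitivity ((x * x + y * y + z * z) * (pxx + pyy + pzz)
  - x * ((x * pxx + y * pxy + z * pxz) - (n * px - px))
  - y * ((x * pxy + y * pyy + z * pyz) - (n * py - py))
  - z * ((x * pxz + y * pyz + z * pzz) - (n * pz - pz))
  - (n + 1) * ((x * px + y * py + z * pz) - n * p) - (n * (n + 1) * p)); first by ring.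
by rewrite e0 e1 e2 e3 e4 !subrr !mulr0 !subr0 sub0r.
Qed.

Lemma casimir l P : harm l P -> \sum_i rot i (rot i P) = - ((l * l.+1)%:R * P).
Proof.
move=> [h e].
have hE i : euler (D i P) = l%:R * D i P - D i P.
  case: l h => [|l] h; first by rewrite homog0_D // mulr0 subr0 /euler big1 // => j _; rewrite raddf0 mulr0.
  by rewrite (euler_homog (homog_D i h)) -[l.+1 in RHS]addn1 natrD mulrDl mul1r addrK.
have := euler_homog h; have := hE 0; have := hE 1; have := hE 2; move: e.
rewrite /lapl /euler !(sum3 _ 0).
have rE i : rot i (rot i P) = vX (i + 1) * (vX (i + 1) * D (i + 2) (D (i + 2) P)
     - D (i + 1) P - vX (i + 2) * D (i + 2) (D (i + 1) P))
   - vX (i + 2) * (D (i + 2) P + vX (i + 1) * D (i + 1) (D (i + 2) P)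
     - vX (i + 2) * D (i + 1) (D (i + 1) P)).
  have [_ [_ _ h3]] := ord3_cyc i.
  rewrite /rot !raddfB /= !derivMX !eqxx [i + 2 == _]eq_sym h3 !mul0r !mul1r !add0r.
  by congr (_ * _ - _ * _); rewrite ?opprD !addrA // addrAC.
have [[h11 h12 h21 h22] _] := ord3_cyc 0; rewrite !add0r in h11 h12 h21 h22.
rewrite !rE !add0r h11 h12 h21 h22.
rewrite (derivC 1 0) (derivC 2 0) (derivC 2 1) natrM -[l.+1]addn1 natrD; exact: casimir_eq.
Qed.

(** On the unit sphere this is the gradient minus its radial component: r d_i acting on the function
    x |-> Q(x/r), see [is_cd_sph]. *)
Definition tang i Q : MP := D i Q - vX i * euler Q.

Notation ev := (@mpoly.meval 3 K).

Lemma ev_vX (w : 'I_3 -> K) i : ev w (vX i) = w i. Proof. exact: mpoly.mevalXU. Qed.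

Lemma tangC i c : tang i (mpoly.mpolyC 3 c) = 0.
Proof.
rewrite /tang /euler mpoly.mderivC big1 ?mulr0 ?subr0 // => j _.
by rewrite mpoly.mderivC mulr0.
Qed.

Lemma euler_vX j : euler (vX j) = vX j.
Proof.
have [_ [h1 h2 _]] := ord3_cyc j.
rewrite /euler (sum3 _ j) !derivX eqxx [j + 1 == j]eq_sym h1 [j + 2 == j]eq_sym h2.
by rewrite !mulr0 !addr0 mulr1.
Qed.

Lemma eulerD P Q : euler (P + Q) = euler P + euler Q.
Proof. by rewrite /euler -big_split; apply: eq_bigr => j _; rewrite raddfD mulrDr. Qed.

Lemma eulerM P Q : euler (P * Q) = euler P * Q + P * euler Q.
Proof.
rewrite /euler mulr_suml mulr_sumr -big_split; apply: eq_bigr => j _ /=.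
by rewrite mpoly.mderivM mulrDr; congr (_ + _); [rewrite mulrA|rewrite mulrCA].
Qed.

Lemma tangD i P Q : tang i (P + Q) = tang i P + tang i Q.
Proof. by rewrite /tang eulerD raddfD /= mulrDr opprD addrACA. Qed.

Lemma tangM i P Q : tang i (P * Q) = tang i P * Q + P * tang i Q.
Proof.
rewrite /tang eulerM mpoly.mderivM.
have aux (A : comPzRingType) (p q dp dq x ep eq : A) :
  dp * q + p * dq - x * (ep * q + p * eq) = (dp - x * ep) * q + p * (dq - x * eq) by ring.
exact: aux.
Qed.

Lemma ev_tang_vX (w : 'I_3 -> K) i j : ev w (tang i (vX j)) = (i == j)%:R - w i * w j.
Proof. by rewrite /tang euler_vX derivX mpoly.mevalB mpoly.mevalM !ev_vX; case: eqP; rewrite ?mpoly.meval1 ?mpoly.meval0. Qed.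

Lemma ev_XM (w : 'I_3 -> K) i Q : ev w (vX i * Q) = w i * ev w Q.
Proof. by rewrite mpoly.mevalM ev_vX. Qed.

Lemma ev_tang (w : 'I_3 -> K) i Q : ev w (tang i Q) = ev w (D i Q) - w i * ev w (euler Q).
Proof. by rewrite /tang mpoly.mevalB ev_XM. Qed.

Lemma ev_rot (w : 'I_3 -> K) i Q :
  ev w (rot i Q) = w (i + 1) * ev w (D (i + 2) Q) - w (i + 2) * ev w (D (i + 1) Q).
Proof. by rewrite /rot mpoly.mevalB !ev_XM. Qed.

Lemma ev_tangM (w : 'I_3 -> K) i P Q :
  ev w (tang i (P * Q)) = ev w (tang i P) * ev w Q + ev w P * ev w (tang i Q).
Proof. by rewrite tangM mpoly.mevalD !mpoly.mevalM. Qed.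

Lemma ev_tangD (w : 'I_3 -> K) i P Q :
  ev w (tang i (P + Q)) = ev w (tang i P) + ev w (tang i Q).
Proof. by rewrite tangD mpoly.mevalD. Qed.

Lemma ev_tangC (w : 'I_3 -> K) i c : ev w (tang i (mpoly.mpolyC 3 c)) = 0.
Proof. by rewrite tangC mpoly.meval0. Qed.

End MultivariateDerivations.

(** * Functions u(r) P(x/r) on the punctured space *)

Section SeparatedAlgebra.
Variable K : fieldType.

Lemma is_sph_coord_eq (w wj r d : K) : r != 0 ->
  w * (- r ^- 2 * (wj / r)) + d * r^-1 = r^-1 * (d - wj / r * (w / r)).
Proof. by move=> r1; field. Qed.

Lemma sph_leibniz_eq (s p q dp dq : K) : p * (s * dq) + s * dp * q = s * (dp * q + p * dq).
Proof. by ring. Qed.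

Lemma sep_deriv_eq (w r u u1 q t : K) : r != 0 ->
  u * (r^-1 * t) + w * u1 * q = u1 * (w * q) + r^-1 * u * t.
Proof. by move=> r1; ring. Qed.

Lemma addr_mix_eq (a b x y x' y' : K) :
  a * (x + x') - b * (y + y') = a * x - b * y + (a * x' - b * y').
Proof. by ring. Qed.

Lemma angmom_eq (r u u1 wa wb q da db e : K) : r != 0 ->
  r * wa * (u1 * (wb * q) + r^-1 * u * (db - wb * e)) -
  r * wb * (u1 * (wa * q) + r^-1 * u * (da - wa * e)) = u * (wa * db - wb * da).
Proof. by move=> r1; field. Qed.

End SeparatedAlgebra.

Section PuncturedCalculus.
Variable R : realType.
Notation C := R[i].
Notation V := 'cV[R]_3.
Notation Fun := (punctured R -> C).
Notation MP := (mpoly.mpoly 3 C).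
Notation D := (@mpoly.mderiv 3 C).
Notation ev := (@mpoly.meval 3 C).
Implicit Types (i j : 'I_3) (x y : V) (u v : R -> C) (Q : MP) (f h : Fun).

Lemma enorm_gt0 x : x != 0 -> 0 < enorm x.
Proof.
move=> x0; rewrite sqrtr_gt0 lt_neqAle sumr_ge0 ?andbT; last by move=> j _; rewrite sqr_ge0.
apply: contra x0; rewrite eq_sym psumr_eq0; last by move=> j _; rewrite sqr_ge0.
move=> /allP h; apply/eqP/matrixP => j k; rewrite (ord1 k) mxE.
by have := h j (mem_index_enum _); rewrite /= sqrf_eq0 => /eqP.
Qed.

Lemma enorm_sqr x : enorm x ^+ 2 = \sum_j x j 0 ^+ 2.
Proof. by rewrite sqr_sqrtr // sumr_ge0 // => j _; rewrite sqr_ge0. Qed.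

Lemma is_derive_coord i j x : is_derive x (delta_mx i 0) (fun y : V => y j 0) (j == i)%:R.
Proof.
apply: DeriveDef; first exact/diff_derivable/differentiable_coord.
have := derive_id x (delta_mx i 0 : V); rewrite derive_mx; last exact: derivable_id.
by move/matrixP/(_ j 0); rewrite !mxE andbT => <-.
Qed.

Definition sumsq (y : V) : R := \sum_j y j 0 * y j 0.

Lemma enormE : @enorm R = Num.sqrt \o sumsq :> (V -> R).
Proof. by apply/funext => y /=; congr Num.sqrt; apply: eq_bigr => j _; rewrite expr2. Qed.

Lemma sumsqE : sumsq = \sum_j ((fun y : V => y j 0) * (fun y : V => y j 0)).
Proof. by apply/funext => y; rewrite fct_sumE. Qed.

Lemma differentiable_sumsq x : differentiable sumsq x.
Proof.
rewrite sumsqE; apply: differentiable_sum => j.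
by apply: differentiableM; apply: differentiable_coord.
Qed.

Lemma is_derive_sumsq i x : is_derive x (delta_mx i 0) sumsq (2 * x i 0).
Proof.
rewrite sumsqE; apply: is_derive_eq.
  by apply: is_derive_sum => j; apply: is_deriveM; apply: is_derive_coord.
rewrite (bigD1 i) //= big1 ?addr0 => [|j ji].
  by rewrite eqxx /GRing.scale /= mulr1 -mulr2n mulr_natl.
by rewrite (negbTE ji) /GRing.scale /= mulr0 addr0.
Qed.

Lemma sumsq_gt0 x : x != 0 -> 0 < sumsq x.
Proof. by move=> /enorm_gt0; rewrite enormE /= sqrtr_gt0. Qed.

Lemma differentiable_enorm x : x != 0 -> differentiable (@enorm R) x.
Proof.
move=> /sumsq_gt0 x0; rewrite enormE.
apply: (@differentiable_comp _ _ _ _ sumsq Num.sqrt x (differentiable_sumsq x)).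
by apply/derivable1_diffP; have [] := is_derive1_sqrt x0.
Qed.

Lemma is_derive_enorm i x : x != 0 -> is_derive x (delta_mx i 0) (@enorm R) (x i 0 / enorm x).
Proof.
move=> x0; have s0 := sumsq_gt0 x0; rewrite [X in is_derive _ _ X]enormE.
apply: is_derive_eq (is_derive_comp1 (is_derive1_sqrt s0) (is_derive_sumsq i x) (differentiable_sumsq x)) _.
have e1 : Num.sqrt (sumsq x) = enorm x by rewrite enormE.
by rewrite e1 invfM mulrACA mulVf ?mul1r ?pnatr_eq0 // mulrC.
Qed.

Definition unitv (y : V) i : C := (y i 0 / enorm y)%:C%C.
Definition sepT u Q (y : V) : C := u (enorm y) * ev (unitv y) Q.
Lemma unitv_norm x : x != 0 -> \sum_j unitv x j * unitv x j = 1.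
Proof.
move=> x0; have r0 := enorm_gt0 x0.
transitivity ((\sum_j (x j 0 ^+ 2 / enorm x ^+ 2))%:C%C : C).
  rewrite raddf_sum; apply: eq_bigr => j _; rewrite /unitv -rmorphM /=; congr (_%:C)%C.
  by rewrite -expr2 expr_div_n.
by rewrite -mulr_suml -enorm_sqr divff // expf_neq0 // gt_eqF.
Qed.

Lemma is_cd_unitv i j x : x != 0 -> 
  is_cd (fun y => unitv y j) x (delta_mx i 0)
    ((enorm x)^-1%:C%C * ((i == j)%:R - unitv x i * unitv x j)).
Proof.
move=> x0; have r0 := enorm_gt0 x0; have r1 : enorm x != 0 by rewrite gt_eqF.
have dV : is_derive (enorm x) 1 (fun t : R => t^-1) (- enorm x ^- 2).
  by have := @is_deriveV _ id _ _ _ r1 (is_derive_id (enorm x) 1); rewrite /GRing.scale /= mulr1.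
have h := is_derive_comp1 dV (is_derive_enorm i x0) (differentiable_enorm x0).
have := is_cd_real (is_deriveM (is_derive_coord i j x) h).
move/is_cd_eq; apply; rewrite /unitv /GRing.scale /=.
rewrite -rmorphM -[(i == j)%:R](rmorph_nat (real_complex R)) -rmorphB -rmorphM /=; congr (_%:C)%C.
by rewrite eq_sym [X in _ + X]mulrC; apply: is_sph_coord_eq.
Qed.

Lemma cdiff_unitv j x : x != 0 -> cdiff (fun y => unitv y j) x.
Proof.
move=> x0; have r0 := enorm_gt0 x0; have r1 : enorm x != 0 by rewrite gt_eqF.
apply: cdiff_real; apply: (@differentiableM _ _ (fun y : V => y j 0) (fun y => (enorm y)^-1)).
  exact: differentiable_coord.
by apply: differentiableV => //; apply: differentiable_enorm.
Qed.

Lemma is_cd_sph i Q x : x != 0 ->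
  is_cd (fun y => ev (unitv y) Q) x (delta_mx i 0) ((enorm x)^-1%:C%C * ev (unitv x) (tang i Q)).
Proof.
move=> x0; elim/mpoly_alg_ind: Q => [c|j|P Q hP hQ|P Q hP hQ].
- rewrite ev_tangC mulr0; under eq_fun do rewrite mpoly.mevalC; exact: is_cd_cst.
- under eq_fun do rewrite ev_vX; rewrite ev_tang_vX; exact: is_cd_unitv.
- under eq_fun do rewrite mpoly.mevalD.
  by rewrite ev_tangD; apply: is_cd_eq (is_cdD hP hQ) _; rewrite -mulrDr.
- under eq_fun do rewrite mpoly.mevalM.
  rewrite ev_tangM; apply: is_cd_eq (is_cdM hP hQ) _; exact: sph_leibniz_eq.
Qed.

Lemma cdiff_sph Q x : x != 0 -> cdiff (fun y => ev (unitv y) Q) x.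
Proof.
move=> x0; elim/mpoly_alg_ind: Q => [c|j|P Q hP hQ|P Q hP hQ].
- under eq_fun do rewrite mpoly.mevalC; exact: cdiff_cst.
- by under eq_fun do rewrite ev_vX; exact: cdiff_unitv.
- by under eq_fun do rewrite mpoly.mevalD; exact: (cdiffD hP hQ).
- by under eq_fun do rewrite mpoly.mevalM; exact: (cdiffM hP hQ).
Qed.

Lemma near_neq0 x : x != 0 -> \near x, x != 0.
Proof. by move=> x0; apply: (@cvgr_neq0 _ _ _ (nbhs x) _ id x) => //; exact: cvg_id. Qed.

Lemma extend0E f x (x0 : x != 0) : extend0 f x = f (exist _ x x0).
Proof. by rewrite /extend0 insubT. Qed.

(** [pderiv] is a total function; [is_pd] also records that the derivatives exist, which rules for
    sums need. *)
Definition is_pd i f h : Prop :=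
  forall x : punctured R, is_cd (extend0 f) (val x) (delta_mx i 0) (h x).
Definition fdiff f : Prop := forall x : punctured R, cdiff (extend0 f) (val x).

Lemma is_pd_pderiv i f h : is_pd i f h -> pderiv i f = h.
Proof.
move=> hf; apply/funext => x; have [[_ h1] [_ h2]] := hf x.
by rewrite /pderiv h1 h2; case: (h x).
Qed.

Lemma is_pd_ext i f h (F : V -> C) :
  (forall y, y != 0 -> extend0 f y = F y) ->
  (forall x : punctured R, is_cd F (val x) (delta_mx i 0) (h x)) -> is_pd i f h.
Proof.
move=> fF hF x; apply: is_cd_near (hF x); have := near_neq0 (valP x).
by apply: filterS => y /fF.
Qed.

Lemma fdiff_ext f (F : V -> C) :
  (forall y, y != 0 -> extend0 f y = F y) -> (forall x, x != 0 -> cdiff F x) -> fdiff f.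
Proof.
move=> fF hF x; apply: cdiff_near (hF _ (valP x)); have := near_neq0 (valP x).
by apply: filterS => y /fF.
Qed.

Lemma is_pdD i f1 f2 h1 h2 : is_pd i f1 h1 -> is_pd i f2 h2 -> is_pd i (f1 + f2) (h1 + h2).
Proof.
move=> a b x; have := is_cdD (a x) (b x); congr (is_cd _ _ _ _).
by apply/funext => y; rewrite extend0D.
Qed.

Lemma is_pd0 i : is_pd i 0 0.
Proof. by move=> x; rewrite extend0_0; exact: is_cd_cst. Qed.

Lemma fdiffD f1 f2 : fdiff f1 -> fdiff f2 -> fdiff (f1 + f2).
Proof.
move=> a b x; have := cdiffD (a x) (b x); congr (cdiff _ _).
by apply/funext => y; rewrite extend0D.
Qed.

Lemma fdiff0 : fdiff 0.
Proof. by move=> x; rewrite extend0_0; exact: cdiff_cst. Qed.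

Notation sep := (@separated_fun R).

Lemma sepE u Q (x : punctured R) : sep u Q x = u (enorm (val x)) * ev (unitv (val x)) Q.
Proof. by []. Qed.

Lemma extend0_sep u Q y : y != 0 -> extend0 (sep u Q) y = sepT u Q y.
Proof. by move=> y0; rewrite (extend0E _ y0). Qed.

(** The gradient splits into a radial part, which differentiates u, and a tangential part, which
    differentiates the angular factor. *)
Lemma is_pd_sep i u u1 Q : (forall r, 0 < r -> is_cd u r 1 (u1 r)) ->
  is_pd i (sep u Q) (sep u1 (vX _ i * Q) + sep (fun r => (r^-1)%:C%C * u r) (tang i Q)).
Proof.
move=> du; apply: (is_pd_ext (F := sepT u Q)) => [y y0|x]; first exact: extend0_sep.
have x0 := valP x; have r0 := enorm_gt0 x0.
apply: is_cd_eq (is_cdM (is_cd_comp (du _ r0) (is_derive_enorm i x0) (differentiable_enorm x0)) (is_cd_sph i Q x0)) _.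
rewrite fctE !sepE ev_XM rcV -[(_ / _)%:C%C]/(unitv (val x) i).
exact: sep_deriv_eq (rc_neq0 r0).
Qed.

Lemma fdiff_sep u u1 Q : (forall r, 0 < r -> is_cd u r 1 (u1 r)) -> fdiff (sep u Q).
Proof.
move=> du; apply: (fdiff_ext (F := sepT u Q)) => [y y0|x x0]; first exact: extend0_sep.
apply: cdiffM (cdiff_sph Q x0).
exact: cdiff_comp (du _ (enorm_gt0 x0)) (differentiable_enorm x0).
Qed.

Lemma coord_unitv (x : punctured R) i :
  (val x i 0)%:C%C = (enorm (val x))%:C%C * unitv (val x) i :> C.
Proof.
have r0 := enorm_gt0 (valP x); rewrite /unitv -rmorphM /= mulrC divfK // gt_eqF //.
Qed.

Lemma pderiv_sep i u u1 Q (x : punctured R) : (forall r, 0 < r -> is_cd u r 1 (u1 r)) ->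
  pderiv i (sep u Q) x =
  u1 (enorm (val x)) * (unitv (val x) i * ev (unitv (val x)) Q) +
  (enorm (val x))%:C%C^-1 * u (enorm (val x)) *
    (ev (unitv (val x)) (D i Q) - unitv (val x) i * ev (unitv (val x)) (euler Q)).
Proof. by move=> du; rewrite (is_pd_pderiv (is_pd_sep i Q du)) fctE !sepE ev_XM ev_tang rcV. Qed.

Lemma angmomE i f (x : punctured R) : angmom i f x =
  (enorm (val x))%:C%C * unitv (val x) (i + 1) * pderiv (i + 2) f x -
  (enorm (val x))%:C%C * unitv (val x) (i + 2) * pderiv (i + 1) f x.
Proof. by rewrite -!coord_unitv. Qed.

(** L_i is tangent to the spheres, so the terms in u' cancel, and so do the radial corrections in
    [tang]. *)
Lemma angmom_sep i u u1 Q : (forall r, 0 < r -> is_cd u r 1 (u1 r)) ->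
  angmom i (sep u Q) = sep u (rot i Q).
Proof.
move=> du; apply/funext => x; rewrite angmomE !(pderiv_sep _ _ _ du) sepE ev_rot.
exact: angmom_eq (rc_neq0 (enorm_gt0 (valP x))).
Qed.

Lemma angmomD i f1 f2 h1 h2 h3 h4 :
  is_pd (i + 1) f1 h1 -> is_pd (i + 2) f1 h2 -> is_pd (i + 1) f2 h3 -> is_pd (i + 2) f2 h4 ->
  angmom i (f1 + f2) = angmom i f1 + angmom i f2.
Proof.
move=> a b c d; apply/funext => x; rewrite -[RHS]/(angmom i f1 x + angmom i f2 x) !angmomE.
rewrite (is_pd_pderiv (is_pdD a c)) (is_pd_pderiv (is_pdD b d)).
rewrite (is_pd_pderiv a) (is_pd_pderiv b) (is_pd_pderiv c) (is_pd_pderiv d) !fctE.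
exact: addr_mix_eq.
Qed.

End PuncturedCalculus.

(** * Orthogonal substitutions in harmonic polynomials *)

Section MatrixAction.
Variable K : numFieldType.
Notation MP := (mpoly.mpoly 3 K).
Notation D := (@mpoly.mderiv 3 K).
Notation ev := (@mpoly.meval 3 K).
Implicit Types (P Q : MP) (i j : 'I_3) (l : nat) (B : 'M[K]_3).

Definition linform B i : MP := \sum_j B i j *: vX K j.
Definition compM B Q : MP := mpoly.comp_mpoly [tuple linform B i | i < 3] Q.

Lemma compMC B c : compM B (mpoly.mpolyC 3 c) = mpoly.mpolyC 3 c.
Proof. exact: mpoly.comp_mpolyC. Qed.
Lemma compMX B i : compM B (vX K i) = linform B i.
Proof. by rewrite /compM /vX mpoly.comp_mpolyXU -tnth_nth tnth_mktuple. Qed.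
Lemma compMD B P Q : compM B (P + Q) = compM B P + compM B Q.
Proof. exact: mpoly.comp_mpolyD. Qed.
Lemma compMM B P Q : compM B (P * Q) = compM B P * compM B Q.
Proof. exact: rmorphM. Qed.
Lemma compM0 B : compM B 0 = 0.
Proof. exact: mpoly.comp_mpoly0. Qed.

Lemma ev_compM B (w : 'I_3 -> K) Q : ev w (compM B Q) = ev (fun i => \sum_j B i j * w j) Q.
Proof.
rewrite /compM mpoly.comp_mpoly_meval; apply: mpoly.meval_eq => i.
rewrite tnth_mktuple raddf_sum; apply: eq_bigr => j _.
by rewrite /= mpoly.mevalZ ev_vX.
Qed.

Lemma deriv_compM B i Q : D i (compM B Q) = \sum_j B j i *: compM B (D j Q).
Proof.
elim/mpoly_alg_ind: Q => [c|k|P Q hP hQ|P Q hP hQ].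
- rewrite compMC mpoly.mderivC big1 // => j _.
  by rewrite mpoly.mderivC compM0 scaler0.
- rewrite compMX raddf_sum; transitivity (B k i *: 1 : MP).
    rewrite (bigD1 i) //= linearZ /= derivX eqxx big1 ?addr0 // => j ji.
    by rewrite linearZ /= derivX eq_sym (negbTE ji) scaler0.
  rewrite (bigD1 k) //= derivX eqxx -[1 in RHS]/(mpoly.mpolyC 3 1) compMC big1 ?addr0 // => j jk.
  by rewrite derivX (negbTE jk) compM0 scaler0.
- by rewrite compMD raddfD /= hP hQ -big_split; apply: eq_bigr => j _; rewrite raddfD /= compMD scalerDr.
- rewrite compMM mpoly.mderivM hP hQ mulr_suml mulr_sumr -big_split; apply: eq_bigr => j _ /=.
  by rewrite mpoly.mderivM compMD !compMM scalerDr scalerAl scalerAr.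
Qed.

Lemma compM_sum B (I : Type) (r : seq I) (F : I -> MP) :
  compM B (\sum_(k <- r) F k) = \sum_(k <- r) compM B (F k).
Proof. by rewrite (big_morph (compM B) (compMD B) (compM0 B)). Qed.

Lemma lapl_compM B Q : B *m B^T = 1%:M -> lapl (compM B Q) = compM B (lapl Q).
Proof.
move=> oB; rewrite /lapl compM_sum.
transitivity (\sum_j \sum_k \sum_i (B j i * B k i) *: compM B (D k (D j Q))).
  transitivity (\sum_i \sum_j \sum_k (B j i * B k i) *: compM B (D k (D j Q))).
    apply: eq_bigr => i _; rewrite deriv_compM raddf_sum; apply: eq_bigr => j _.
    rewrite /= linearZ /= deriv_compM scaler_sumr; apply: eq_bigr => k _.
    by rewrite scalerA.
  rewrite exchange_big; apply: eq_bigr => j _; rewrite exchange_big.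
  exact: eq_bigr.
have key j k (P : MP) : \sum_i (B j i * B k i) *: P = (j == k)%:R *: P.
  have /matrixP/(_ j k) := oB; rewrite !mxE => <-; rewrite scaler_suml.
  by apply: eq_bigr => i _; rewrite mxE.
apply: eq_bigr => j _; rewrite (bigD1 j) //= key eqxx scale1r big1 ?addr0 // => k kj.
by rewrite key eq_sym (negbTE kj) scale0r.
Qed.

Notation homog l P := (P \is mpoly.ishomog1 l (@mpoly.mdeg 3)).

Lemma homog_linform B i : homog 1 (linform B i).
Proof. by apply: rpred_sum => j _; apply: rpredZ; apply: homog_X. Qed.

Lemma homog_compM l B Q : homog l Q -> homog l (compM B Q).
Proof.
move=> /mpoly.dhomogP hQ; rewrite /compM mpoly.comp_mpolyE big_seq; apply: rpred_sum => m mQ.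
apply: rpredZ; rewrite -(hQ m mQ) /= mpoly.mdegE.
elim/big_rec2: _ => [|i d P _ hP]; first exact: mpoly.dhomog1.
rewrite tnth_mktuple; apply: homog_M => //.
by have := mpoly.dhomogMn (m i) (homog_linform B i); rewrite mul1n.
Qed.

Lemma harm_compM l B Q : B *m B^T = 1%:M -> harm l Q -> harm l (compM B Q).
Proof. by move=> oB [h e]; split; [exact: homog_compM|rewrite lapl_compM // e compM0]. Qed.

Lemma homog_monomials l Q : homog l Q ->
  Q = \sum_(m : mpoly.bmultinom 3 l.+1) mpoly.mcoeff m Q *: mpoly.mpolyX K m.
Proof.
move=> /mpoly.dhomogP hQ; apply: mpoly.mpolywE; rewrite mpoly.msizeE.
by apply/bigmax_leqP_seq => m mQ _; rewrite ltnS; have := hQ m mQ => /= ->.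
Qed.

End MatrixAction.

(** * Angular parts of the Runge-Lenz operators and of the Laplacian *)

Section SphereIdentities.
Variable K : numFieldType.
Notation MP := (mpoly.mpoly 3 K).
Notation D := (@mpoly.mderiv 3 K).
Notation ev := (@mpoly.meval 3 K).
Implicit Types (P Q : MP) (i j : 'I_3) (l : nat) (w : 'I_3 -> K).

Lemma rl1_eq (x y z q dx dy dz n : K) : x * x + y * y + z * z = 1 ->
  x * dx + y * dy + z * dz = n * q ->
  x * (q + y * dy) - y * (y * dx) - (z * (z * dx) - x * (q + z * dz)) - x * q =
  (n + 1) * (x * q) - dx.
Proof.
move=> e1 e2.
transitivity (x * q + x * (x * dx + y * dy + z * dz) - (x * x + y * y + z * z) * dx); first by ring.
by rewrite e1 e2; ring.
Qed.

Lemma euler_D l i Q : Q \is mpoly.ishomog1 l (@mpoly.mdeg 3) ->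
  euler (D i Q) = l%:R * D i Q - D i Q.
Proof.
case: l => [|l] h; first by rewrite homog0_D // mulr0 subr0 /euler big1 // => j _; rewrite raddf0 mulr0.
by rewrite (euler_homog (homog_D i h)) -[l.+1 in RHS]addn1 natrD mulrDl mul1r addrK.
Qed.

Lemma ev_nat w n Q : ev w (n%:R * Q) = n%:R * ev w Q.
Proof. by rewrite mpoly.mevalM rmorph_nat. Qed.

Lemma ev_DXM w i j Q : ev w (D i (vX K j * Q)) = (i == j)%:R * ev w Q + w j * ev w (D i Q).
Proof. by rewrite derivMX mpoly.mevalD ev_XM mpoly.mevalM rmorph_nat. Qed.

Lemma ev_euler w Q : ev w (euler Q) = \sum_j w j * ev w (D j Q).
Proof. by rewrite /euler raddf_sum; apply: eq_bigr => j _; rewrite /= ev_XM. Qed.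

Lemma ev_lapl w Q : ev w (lapl Q) = \sum_j ev w (D j (D j Q)).
Proof. by rewrite /lapl raddf_sum. Qed.

(** The coefficient of u' when R_i, without the factor sqrt(-1) and the Coulomb term, acts on u(r)
    Q(x/r). *)
Lemma sphere_rl1 w l i Q : \sum_j w j * w j = 1 -> harm l Q ->
  ev w (rot (i + 2) (vX K (i + 1) * Q)) - ev w (rot (i + 1) (vX K (i + 2) * Q)) - w i * ev w Q =
  (l%:R + 1) * (w i * ev w Q) - ev w (D i Q).
Proof.
move=> w1 [h _]; have [[c1 c2 c3 c4] [n1 n2 n3]] := ord3_cyc i.
have e := congr1 (ev w) (euler_homog h); rewrite ev_nat ev_euler (sum3 _ i) in e.
rewrite (sum3 _ i) in w1.
rewrite !ev_rot !ev_DXM c1 c2 c3 c4 !eqxx n1 n2 !mul1r !mul0r !add0r.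
exact: (rl1_eq w1 e).
Qed.

Lemma rl2_eq (x y z q dx dy dz hxx hyy hzz hxy hxz n : K) : x * x + y * y + z * z = 1 ->
  x * dx + y * dy + z * dz = n * q ->
  hxx + hyy + hzz = 0 -> x * hxx + y * hxy + z * hxz = n * dx - dx ->
  (x * hyy - y * hxy) - n * (x * (q + y * dy) - y * (y * dx)) -
  ((z * hxz - x * hzz) - n * (z * (z * dx) - x * (q + z * dz))) - (dx - x * (n * q)) =
  - (n * (n + 1) * (x * q)).
Proof.
move=> e1 e2 e3 e4.
transitivity (x * (hxx + hyy + hzz) - (x * hxx + y * hxy + z * hxz)
   - n * ((x * (q + y * dy) - y * (y * dx) - (z * (z * dx) - x * (q + z * dz)) - x * q)
      + x * q) - dx + n * (x * q)); first by ring.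
by rewrite (rl1_eq e1 e2) e3 e4; ring.
Qed.

Lemma tang_homog l i Q : Q \is mpoly.ishomog1 l (@mpoly.mdeg 3) ->
  tang i Q = D i Q - l%:R *: (vX K i * Q).
Proof.
by move=> h; rewrite /tang (euler_homog h) scaler_nat mulr_natl mulrnAr.
Qed.

Lemma ev_rot_tang w l i j Q : Q \is mpoly.ishomog1 l (@mpoly.mdeg 3) ->
  ev w (rot i (tang j Q)) = ev w (rot i (D j Q)) - l%:R * ev w (rot i (vX K j * Q)).
Proof.
move=> h; rewrite (tang_homog j h) !ev_rot !mpoly.mderivB !mpoly.mderivZ !mpoly.mevalB !mpoly.mevalZ.
have aux (a b x y x' y' n : K) : a * (x - n * x') - b * (y - n * y') = a * x - b * y - n * (a * x' - b * y').
  by ring.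
exact: aux.
Qed.

(** The companion of [sphere_rl1]: the coefficient of u/r. *)
Lemma sphere_rl2 w l i Q : \sum_j w j * w j = 1 -> harm l Q ->
  ev w (rot (i + 2) (tang (i + 1) Q)) - ev w (rot (i + 1) (tang (i + 2) Q)) - ev w (tang i Q) =
  - (l%:R * (l%:R + 1) * (w i * ev w Q)).
Proof.
move=> w1 [h e0]; have [[c1 c2 c3 c4] [n1 n2 n3]] := ord3_cyc i.
have e := congr1 (ev w) (euler_homog h); rewrite ev_nat ev_euler (sum3 _ i) in e.
have e2 := congr1 (ev w) (euler_D i h); rewrite ev_euler mpoly.mevalB ev_nat (sum3 _ i) in e2.
have e3 := congr1 (ev w) e0; rewrite ev_lapl mpoly.meval0 (sum3 _ i) in e3.
rewrite (sum3 _ i) in w1.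
rewrite !(ev_rot_tang _ _ _ h) ev_tang (euler_homog h) ev_nat.
rewrite !ev_rot !ev_DXM c1 c2 c3 c4 !eqxx n1 n2 !mul1r !mul0r !add0r.
rewrite (derivC (i + 1) i) (derivC (i + 2) i) in e2 *.
exact: (rl2_eq w1 e e3 e2).
Qed.

(** Where r = 1, the correction in [raise] becomes a harmonic polynomial of degree l - 1: this
    splits x_i Q into its two spherical degrees. *)
Lemma ev_raise w l i Q : \sum_j w j * w j = 1 ->
  w i * ev w Q = ev w (raise l i Q) + (2 * l%:R + 1)^-1 * ev w (D i Q).
Proof.
move=> w1; rewrite /raise mpoly.mevalB mpoly.mevalZ ev_XM mpoly.mevalM.
have -> : ev w (rad2 K) = 1.
  by rewrite /rad2 raddf_sum -[RHS]w1; apply: eq_bigr => j _; rewrite /= ev_XM ev_vX.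
by rewrite mul1r subrK.
Qed.

End SphereIdentities.

Section SphereLaplacian.
Variable K : numFieldType.
Notation MP := (mpoly.mpoly 3 K).
Notation D := (@mpoly.mderiv 3 K).
Notation ev := (@mpoly.meval 3 K).
Implicit Types (P Q : MP) (i j : 'I_3) (l : nat) (w : 'I_3 -> K).

Lemma sphere_sumX w Q : \sum_j w j * w j = 1 -> \sum_i w i * ev w (vX K i * Q) = ev w Q.
Proof.
move=> w1; rewrite -[RHS]mul1r -w1 mulr_suml; apply: eq_bigr => i _.
by rewrite ev_XM mulrA.
Qed.

Lemma tangX_eq (x y z q dx dy dz n : K) : x * x + y * y + z * z = 1 ->
  x * dx + y * dy + z * dz = n * q ->
  (1 - x * x) * q + x * (dx - x * (n * q)) + ((1 - y * y) * q + y * (dy - y * (n * q)))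
   + ((1 - z * z) * q + z * (dz - z * (n * q))) = 2 * q.
Proof.
move=> e1 e2; transitivity (3 * q - (x * x + y * y + z * z) * q + (x * dx + y * dy + z * dz)
   - (x * x + y * y + z * z) * (n * q)); first by ring.
by rewrite e1 e2; ring.
Qed.

Lemma sphere_sum_tangX w l Q : \sum_j w j * w j = 1 -> harm l Q ->
  \sum_i ev w (tang i (vX K i * Q)) = 2 * ev w Q.
Proof.
move=> w1 [h _]; have e := congr1 (ev w) (euler_homog h); rewrite ev_nat ev_euler (sum3 _ 0) in e.
rewrite (sum3 _ 0) in w1.
rewrite (sum3 _ 0) !ev_tangM !ev_tang_vX !ev_vX !ev_tang (euler_homog h) !ev_nat !eqxx.
exact: (tangX_eq w1 e).
Qed.

Lemma Xtang_eq (x y z q dx dy dz n : K) : x * x + y * y + z * z = 1 ->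
  x * dx + y * dy + z * dz = n * q ->
  x * (dx - x * (n * q)) + y * (dy - y * (n * q)) + z * (dz - z * (n * q)) = 0.
Proof.
move=> e1 e2; transitivity ((x * dx + y * dy + z * dz) - (x * x + y * y + z * z) * (n * q)); first by ring.
by rewrite e1 e2; ring.
Qed.

Lemma sphere_sum_Xtang w l Q : \sum_j w j * w j = 1 -> harm l Q ->
  \sum_i w i * ev w (tang i Q) = 0.
Proof.
move=> w1 [h _]; have e := congr1 (ev w) (euler_homog h); rewrite ev_nat ev_euler (sum3 _ 0) in e.
rewrite (sum3 _ 0) in w1.
rewrite (sum3 _ 0) !ev_tang (euler_homog h) !ev_nat.
exact: (Xtang_eq w1 e).
Qed.

Lemma tang2_eq (x y z q dx dy dz hxx hyy hzz n tx ty tz : K) : x * x + y * y + z * z = 1 ->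
  x * dx + y * dy + z * dz = n * q -> hxx + hyy + hzz = 0 -> tx + ty + tz = 2 * q ->
  (hxx - x * (n * dx - dx)) - n * tx + ((hyy - y * (n * dy - dy)) - n * ty)
  + ((hzz - z * (n * dz - dz)) - n * tz) = - (n * (n + 1) * q).
Proof.
move=> e1 e2 e3 e4.
transitivity ((hxx + hyy + hzz) - (n - 1) * (x * dx + y * dy + z * dz) - n * (tx + ty + tz)); first by ring.
by rewrite e2 e3 e4; ring.
Qed.

Lemma ev_tang_tang w l i Q : Q \is mpoly.ishomog1 l (@mpoly.mdeg 3) ->
  ev w (tang i (tang i Q)) = (ev w (D i (D i Q)) - w i * (l%:R * ev w (D i Q) - ev w (D i Q)))
    - l%:R * ev w (tang i (vX K i * Q)).
Proof.
move=> h; rewrite (tang_homog i h) -scaleNr ev_tangD.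
have -> : ev w (tang i (- l%:R *: (vX K i * Q))) = - l%:R * ev w (tang i (vX K i * Q)).
  by rewrite -mpoly.mul_mpolyC ev_tangM ev_tangC mul0r add0r mpoly.mevalC.
by rewrite ev_tang (euler_D i h) mpoly.mevalB ev_nat mulNr.
Qed.

(** The sum of the squared tangential derivatives is the Laplacian of the sphere, with its usual
    eigenvalue. *)
Lemma sphere_sum_tang2 w l Q : \sum_j w j * w j = 1 -> harm l Q ->
  \sum_i ev w (tang i (tang i Q)) = - (l%:R * (l%:R + 1) * ev w Q).
Proof.
move=> w1 hQ; have e4 := sphere_sum_tangX w1 hQ; have [h e0] := hQ.
have e := congr1 (ev w) (euler_homog h); rewrite ev_nat ev_euler (sum3 _ 0) in e.
have e3 := congr1 (ev w) e0; rewrite ev_lapl mpoly.meval0 (sum3 _ 0) in e3.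
rewrite (sum3 _ 0) in w1; rewrite (sum3 _ 0) in e4.
rewrite (sum3 _ 0) !(ev_tang_tang _ _ h).
exact: (tang2_eq w1 e e3 e4).
Qed.

Lemma sum_lin4 (I : finType) (a b c d : K) (A B E F : I -> K) :
  \sum_i (a * A i + b * B i + (c * E i + d * F i)) =
  a * (\sum_i A i) + b * (\sum_i B i) + (c * (\sum_i E i) + d * (\sum_i F i)).
Proof. by rewrite !big_split /= !mulr_sumr. Qed.

Lemma laplacian_sum w l Q (a b c d : K) : \sum_j w j * w j = 1 -> harm l Q ->
  \sum_i (a * (w i * ev w (vX K i * Q)) + b * ev w (tang i (vX K i * Q))
    + (c * (w i * ev w (tang i Q)) + d * ev w (tang i (tang i Q)))) =
  a * ev w Q + b * (2 * ev w Q) + (c * 0 + d * (- (l%:R * (l%:R + 1) * ev w Q))).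
Proof.
move=> w1 hQ; rewrite sum_lin4 (sphere_sumX Q w1) (sphere_sum_tangX w1 hQ).
by rewrite (sphere_sum_Xtang w1 hQ) (sphere_sum_tang2 w1 hQ).
Qed.

Lemma schrodinger_eq (n r g u u1 u2 q z a : K) : r != 0 ->
  u2 = (n * (n + 1) * r^-1 ^+ 2 - 2 * g * r^-1 - z) * u - 2 * r^-1 * u1 ->
  - (u2 * q + r^-1 * u1 * (2 * q) + (a * 0 + r^-1 * (r^-1 * u) * (- (n * (n + 1) * q))))
   - 2 * g * r^-1 * (u * q) = z * (u * q).
Proof. by move=> r1 ->; field. Qed.

Lemma rungelenz_eq (n r u u1 g s1 s2 s3 t1 t2 t3 wi q d p : K) : r != 0 -> 2 * n + 1 != 0 ->
  s1 - s2 - s3 = (n + 1) * (wi * q) - d ->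
  t1 - t2 - t3 = - (n * (n + 1) * (wi * q)) ->
  wi * q = p + (2 * n + 1)^-1 * d ->
  (u1 * s1 + r^-1 * u * t1) - (u1 * s2 + r^-1 * u * t2) - (u1 * s3 + r^-1 * u * t3) + g * wi * (u * q)
  = ((n + 1) * u1 - n * (n + 1) * r^-1 * u + g * u) * p
    - (2 * n + 1)^-1 * ((n * u1 + n * (n + 1) * r^-1 * u - g * u) * d).
Proof.
move=> r1 n1 e1 e2 e3.
transitivity (u1 * (s1 - s2 - s3) + r^-1 * u * (t1 - t2 - t3) + g * u * (wi * q)); first by ring.
by rewrite e1 e2 e3; field; rewrite r1 n1.
Qed.

End SphereLaplacian.

(** * Separated solutions of the Schroedinger equation and the operators acting on them *)

Section SeparatedSolutions.
Variables (R : realType) (gamma : R).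
Notation C := R[i].
Notation g := (gamma%:C%C : C).
Notation Fun := (punctured R -> C).
Notation MP := (mpoly.mpoly 3 C).
Notation ev := (@mpoly.meval 3 C).
Notation sep := (@separated_fun R).
Implicit Types (i j : 'I_3) (x : punctured R) (u : R -> C) (Q : MP) (f h : Fun) (l : nat) (z : C).

Lemma sep_eq u v Q : (forall r, 0 < r -> u r = v r) -> sep u Q = sep v Q.
Proof. by move=> uv; apply/funext => x; rewrite !sepE uv // enorm_gt0 // (valP x). Qed.

Lemma sepD u Q Q' : sep u (Q + Q') = sep u Q + sep u Q'.
Proof. by apply/funext => x; rewrite fctE !sepE mpoly.mevalD mulrDr. Qed.

Lemma sepZ u (c : C) Q : sep u (c *: Q) = c *: sep u Q.
Proof. by apply/funext => x; rewrite -[RHS]/(c * sep u Q x) !sepE mpoly.mevalZ mulrCA. Qed.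

Lemma sep0 u : sep u 0 = 0.
Proof. by apply/funext => x; rewrite sepE mpoly.meval0 mulr0. Qed.

Lemma sep_lin (c c' : C) u v Q : sep (fun r => c * u r + c' * v r) Q = c *: sep u Q + c' *: sep v Q.
Proof.
apply/funext => x; rewrite -[RHS]/(c * sep u Q x + c' * sep v Q x) !sepE.
by rewrite mulrDl !mulrA.
Qed.

Section OneSolution.
Variables (l : nat) (z : C) (u : R -> C).
Hypothesis hu : radial_solution gamma l z u.

(** A class containing u(r) Q(x/r) and closed under partial derivatives, because u'' can be
    expressed by u and u' with coefficients polynomial in 1/r. One differentiability statement for
    the class therefore gives smoothness of all orders. *)
Inductive sep_sum : Fun -> Prop :=
| sep_sum0 : sep_sum 0
| sep_sumS p q Q f : sep_sum f -> sep_sum (sep (lau p q u) Q + f).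

Lemma sep_sum_fdiff f : sep_sum f -> fdiff f.
Proof.
elim=> [|p q Q {}f _ IH]; first exact: fdiff0.
apply: fdiffD IH; apply: fdiff_sep => t t0; exact: is_cd_lau hu t0.
Qed.

Lemma lau_mulX p q : (fun r : R => (r^-1)%:C%C * lau p q u r) = lau ('X * p) ('X * q) u.
Proof. by apply/funext => r; rewrite /lau /lauv !hornerM !hornerX mulrDr !mulrA. Qed.

Lemma is_pd_sep_lau i p q Q : is_pd i (sep (lau p q u) Q)
  (sep (lau (laup g l z p q) (lauq p q) u) (vX _ i * Q) + sep (lau ('X * p) ('X * q) u) (tang i Q)).
Proof. by rewrite -lau_mulX; apply: is_pd_sep => t t0; exact: is_cd_lau hu t0. Qed.

Lemma sep_sum_pderiv i f : sep_sum f -> sep_sum (pderiv i f).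
Proof.
move=> sf; suff [h [hf sh]] : exists h, is_pd i f h /\ sep_sum h by rewrite (is_pd_pderiv hf).
elim: sf => [|p q Q {}f _ [h [hf sh]]]; first by exists 0; split; [exact: is_pd0|exact: sep_sum0].
eexists; split; first exact: (is_pdD (is_pd_sep_lau i p q Q) hf).
by rewrite -addrA; do 2 apply: sep_sumS.
Qed.

Lemma sep_sum_smooth f : sep_sum f -> smooth f.
Proof.
move=> sf s x; have sfs : sep_sum (foldr (@pderiv R) f s).
  by elim: s => //= i s IH; exact: sep_sum_pderiv.
exact: sep_sum_fdiff sfs x.
Qed.

Lemma u_lau : u = lau 1 0 u.
Proof. by apply/funext => r; rewrite /lau /lauv horner0 hornerC mul1r mul0r addr0. Qed.

Lemma lau_X : (fun r : R => (r^-1)%:C%C * u r) = lau 'X 0 u.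
Proof. by apply/funext => r; rewrite /lau /lauv horner0 hornerX mul0r addr0. Qed.

Lemma smooth_sep Q : smooth (sep u Q).
Proof.
by rewrite u_lau -[sep _ _]addr0; apply: sep_sum_smooth; apply: sep_sumS; apply: sep_sum0.
Qed.

Let du : forall r, 0 < r -> is_cd u r 1 (cderiv u r) := fun t pos => radial_cd1 hu pos.
Let du1 : forall r, 0 < r -> is_cd (cderiv u) r 1 (cderiv (cderiv u) r).
Proof. by move=> r r0; have [_ /derive_is_cd] := hu r0. Qed.
Let dsu : forall r, 0 < r -> is_cd (fun r : R => (r^-1)%:C%C * u r) r 1 (lau (laup g l z 'X 0) (lauq 'X 0) u r).
Proof. by move=> r r0; rewrite lau_X; apply: is_cd_lau. Qed.

Lemma pderiv_u i Q : pderiv i (sep u Q) =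
  sep (cderiv u) (vX _ i * Q) + sep (fun r => (r^-1)%:C%C * u r) (tang i Q).
Proof. exact: is_pd_pderiv (is_pd_sep i Q du). Qed.

Lemma pderiv2_u i Q x : pderiv i (pderiv i (sep u Q)) x =
  cderiv (cderiv u) (enorm (val x)) * (unitv (val x) i * ev (unitv (val x)) (vX _ i * Q))
  + (enorm (val x))%:C%C^-1 * cderiv u (enorm (val x)) * ev (unitv (val x)) (tang i (vX _ i * Q))
  + (lau (laup g l z 'X 0) (lauq 'X 0) u (enorm (val x)) * (unitv (val x) i * ev (unitv (val x)) (tang i Q))
  + (enorm (val x))%:C%C^-1 * ((enorm (val x))%:C%C^-1 * u (enorm (val x))) * ev (unitv (val x)) (tang i (tang i Q))).
Proof.
rewrite pderiv_u (is_pd_pderiv (is_pdD (is_pd_sep i _ du1) (is_pd_sep i _ dsu))).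
by rewrite !fctE !sepE !(ev_XM _ i (vX _ i * Q)) !(ev_XM _ i (tang i Q)) rcV.
Qed.

Lemma laplacian_sep Q x : harm l Q -> laplacian (sep u Q) x =
  cderiv (cderiv u) (enorm (val x)) * ev (unitv (val x)) Q
  + (enorm (val x))%:C%C^-1 * cderiv u (enorm (val x)) * (2 * ev (unitv (val x)) Q)
  + (lau (laup g l z 'X 0) (lauq 'X 0) u (enorm (val x)) * 0
  + (enorm (val x))%:C%C^-1 * ((enorm (val x))%:C%C^-1 * u (enorm (val x))) *
    (- (l%:R * (l%:R + 1) * ev (unitv (val x)) Q))).
Proof.
move=> hQ; have w1 := unitv_norm (valP x).
rewrite /laplacian fct_sumE.
under eq_bigr => i _ do rewrite pderiv2_u.
exact: (laplacian_sum _ _ _ _ w1 hQ).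
Qed.

Lemma schrodinger_sep Q : harm l Q -> schrodinger gamma (sep u Q) = z *: sep u Q.
Proof.
move=> hQ; apply/funext => x; rewrite -[RHS]/(z * sep u Q x) /schrodinger laplacian_sep // sepE.
have r0 := enorm_gt0 (valP x); have r1 := rc_neq0 r0.
have e : (2 * gamma / enorm (val x))%:C%C = 2 * g * (enorm (val x))%:C%C^-1.
  by rewrite !rmorphM fmorphV rmorph_nat.
rewrite e; apply: schrodinger_eq r1 _.
have := is_cd_inj (du1 r0) (radial_cd2 hu r0); rewrite rcV => ->.
by rewrite -natCS.
Qed.

End OneSolution.
End SeparatedSolutions.

Section SeparatedActions.
Variables (R : realType) (gamma : R).
Notation C := R[i].
Notation g := (gamma%:C%C : C).
Notation V := 'cV[R]_3.
Notation Fun := (punctured R -> C).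
Notation MP := (mpoly.mpoly 3 C).
Notation D := (@mpoly.mderiv 3 C).
Notation ev := (@mpoly.meval 3 C).
Notation sep := (@separated_fun R).
Implicit Types (i j : 'I_3) (x : punctured R) (u : R -> C) (Q : MP) (f h : Fun) (l : nat) (z : C).

Lemma angmom_pderiv l z u i j Q x : radial_solution gamma l z u ->
  angmom i (pderiv j (sep u Q)) x =
  cderiv u (enorm (val x)) * ev (unitv (val x)) (rot i (vX _ j * Q))
  + (enorm (val x))%:C%C^-1 * u (enorm (val x)) * ev (unitv (val x)) (rot i (tang j Q)).
Proof.
move=> hu.
have du1 : forall r, 0 < r -> is_cd (cderiv u) r 1 (cderiv (cderiv u) r).
  by move=> r r0; have [_ /derive_is_cd] := hu r r0.
have dsu : forall r, 0 < r -> is_cd (fun r : R => (r^-1)%:C%C * u r) r 1 (lau (laup g l z 'X 0) (lauq 'X 0) u r).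
  by move=> r r0; rewrite lau_X; apply: is_cd_lau.
rewrite (pderiv_u hu) (angmomD (is_pd_sep _ _ du1) (is_pd_sep _ _ du1) (is_pd_sep _ _ dsu) (is_pd_sep _ _ dsu)).
by rewrite (angmom_sep _ _ du1) (angmom_sep _ _ dsu) fctE !sepE rcV.
Qed.

Lemma pderiv_at l z u i Q x : radial_solution gamma l z u ->
  pderiv i (sep u Q) x = cderiv u (enorm (val x)) * (unitv (val x) i * ev (unitv (val x)) Q)
  + (enorm (val x))%:C%C^-1 * u (enorm (val x)) * ev (unitv (val x)) (tang i Q).
Proof. by move=> hu; rewrite (pderiv_u hu) fctE !sepE ev_XM rcV. Qed.

Lemma angmom_sol l z u i Q : radial_solution gamma l z u -> angmom i (sep u Q) = sep u (rot i Q).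
Proof. by move=> hu; apply: (@angmom_sep _ _ _ (cderiv u)) => t t0; exact: radial_cd1 hu t0. Qed.

Lemma rungelenz_sep l z u i Q : radial_solution gamma l z u -> harm l Q ->
  rungelenz gamma i (sep u Q) = 'i%C *: (sep (rup gamma l u) (raise l i Q)
    - (2 * l%:R + 1)^-1 *: sep (rdown gamma l u) (D i Q)).
Proof.
move=> hu hQ; rewrite /rungelenz; congr (_ *: _); apply/funext => x.
have r1 := rc_neq0 (enorm_gt0 (valP x)); have w1 := unitv_norm (valP x).
transitivity (angmom (i + 2) (pderiv (i + 1) (sep u Q)) x - angmom (i + 1) (pderiv (i + 2) (sep u Q)) x
  - pderiv i (sep u Q) x + (gamma * val x i 0 / enorm (val x))%:C%C * sep u Q x); first by [].
transitivity (sep (rup gamma l u) (raise l i Q) x - (2 * l%:R + 1)^-1 * sep (rdown gamma l u) (D i Q) x); last by [].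
rewrite !(angmom_pderiv _ _ _ _ hu) (pderiv_at _ _ _ hu) !sepE.
have -> : (gamma * val x i 0 / enorm (val x))%:C%C = g * unitv (val x) i.
  by rewrite /unitv -rmorphM mulrA.
rewrite /rup /rdown !(natCS _ l) !rcV.
exact: (rungelenz_eq _ _ _ r1 (natC_odd_neq0 R l 0) (sphere_rl1 i w1 hQ) (sphere_rl2 i w1 hQ) (ev_raise l i Q w1)).
Qed.

Definition mxC (B : 'M[R]_3) : 'M[C]_3 := map_mx (real_complex R) B.

Lemma mxC_orth (B : 'M[R]_3) : B *m B^T = 1%:M -> mxC B *m (mxC B)^T = 1%:M.
Proof. move=> oB; have -> : (mxC B)^T = mxC B^T by apply/matrixP => i j; rewrite !mxE.
by rewrite /mxC -map_mxM oB map_mx1. Qed.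

Lemma enorm_orth (B : 'M[R]_3) (y : V) : B^T *m B = 1%:M -> enorm (B *m y) = enorm y.
Proof.
move=> oB; have e (v : V) : \sum_i v i 0 ^+ 2 = (v^T *m v) 0 0.
  by rewrite mxE; apply: eq_bigr => i _; rewrite mxE expr2.
by rewrite /enorm !e trmx_mul mulmxA -[X in X *m _]mulmxA oB mulmx1.
Qed.

Lemma unitv_orth (B : 'M[R]_3) (y : V) i : B^T *m B = 1%:M ->
  unitv (B *m y) i = \sum_j mxC B i j * unitv y j.
Proof.
move=> oB; rewrite /unitv enorm_orth // mxE mulr_suml raddf_sum; apply: eq_bigr => j _ /=.
by rewrite mxE -rmorphM mulrA.
Qed.

Definition real_act (A : 'M[R]_3) : 'M[R]_3 := (\det (invmx A))^-1 *: invmx A.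

Lemma real_act_orth (A : 'M[R]_3) : orthogonal_mx A ->
  (real_act A)^T *m real_act A = 1%:M /\ real_act A *m (real_act A)^T = 1%:M.
Proof.
move=> /eqP oA; have Au : A \in unitmx.
  by have /mulmx1_unit[] := oA.
have iA : invmx A = A^T by rewrite -[RHS]mulmx1 -(mulmxV Au) mulmxA oA mul1mx.
have oA' : A *m A^T = 1%:M by rewrite -iA mulmxV.
have d2 : (\det (A^T))^-1 * (\det (A^T))^-1 = 1.
  have : \det A * \det A = 1 by rewrite -{1}[\det A]det_tr -det_mulmx oA det1.
  by rewrite det_tr -invfM => ->; rewrite invr1.
have tZ (c : R) (M : 'M[R]_3) : (c *: M)^T = c *: M^T by apply/matrixP => i j; rewrite !mxE.
by rewrite /real_act iA; split; rewrite tZ trmxK -scalemxAl -scalemxAr scalerA d2 scale1r.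
Qed.

Lemma fun_act_sep (A : 'M[R]_3) u Q : orthogonal_mx A ->
  fun_act A (sep u Q) = sep u (compM (mxC (real_act A)) Q).
Proof.
move=> /real_act_orth[oB _]; apply/funext => x; rewrite /fun_act.
have -> : point_act (invmx A) (val x) = real_act A *m val x.
  by rewrite /point_act /real_act -scalemxAl.
have y0 : real_act A *m val x != 0.
  apply: contraNneq (valP x) => e; rewrite -[val x]mul1mx -oB -mulmxA e mulmx0 eqxx //.
rewrite (extend0_sep _ _ y0) /sepT (enorm_orth _ oB) sepE ev_compM; congr (_ * _).
by apply: mpoly.meval_eq => i; rewrite unitv_orth.
Qed.

Lemma sep_linear_comb u (I : finType) (c : I -> C) (P : I -> MP) :
  sep u (\sum_k c k *: P k) = \sum_k c k *: sep u (P k).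
Proof.
rewrite (big_morph (sep u) (sepD u) (sep0 u)).
by apply: eq_bigr => k _; rewrite sepZ.
Qed.

(** The substitutions preserve the degree, so the orbit stays in the span of u(r) times the finitely
    many monomials of degree at most l in x/r. *)
Lemma Kfinite_sep u l Q : harm l Q -> Kfinite (sep u Q).
Proof.
move=> [h _]; exists #|{: mpoly.bmultinom 3 l.+1}|.
exists (fun k => sep u (mpoly.mpolyX C (mpoly.bmnm (enum_val k)))) => A oA.
rewrite fun_act_sep //; set P := compM _ _.
have hP : P \is mpoly.ishomog1 l (@mpoly.mdeg 3) by apply: homog_compM.
exists (fun k => mpoly.mcoeff (mpoly.bmnm (enum_val k)) P).
rewrite {1}(homog_monomials hP) sep_linear_comb.
by rewrite (reindex_onto enum_val enum_rank) /=; [apply: eq_bigl => k; rewrite enum_valK eqxx|move=> k _; rewrite enum_rankK].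
Qed.

Lemma is_solution_sep l z u Q : radial_solution gamma l z u -> harm l Q ->
  sep u Q \in is_solution gamma z.
Proof.
move=> hu hQ; apply/asboolP; split.
- exact: smooth_sep hu Q.
- exact: Kfinite_sep hQ.
- exact: (schrodinger_sep hu hQ).
Qed.

End SeparatedActions.

(** * Separation of degrees *)

Section CasimirSeparation.
Variable K : numFieldType.
Notation MP := (mpoly.mpoly 3 K).
Implicit Types (P : MP) (l : nat).

Lemma rotD i P P' : rot i (P + P') = rot i P + rot i P'.
Proof.
rewrite /rot !mpoly.mderivD.
have aux (A : comPzRingType) (x y a b c d : A) : x * (a + b) - y * (c + d) = x * a - y * c + (x * b - y * d) by ring.
exact: aux.
Qed.

Lemma rot0 i : rot i 0 = 0 :> MP.
Proof. by rewrite /rot !mpoly.mderiv0 !mulr0 subr0. Qed.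

Lemma ev_sum (w : 'I_3 -> K) (I : finType) (F : I -> MP) :
  mpoly.meval w (\sum_k F k) = \sum_k mpoly.meval w (F k).
Proof. exact: raddf_sum. Qed.

Definition casi P : MP := \sum_i rot i (rot i P).

Lemma casiD P P' : casi (P + P') = casi P + casi P'.
Proof. by rewrite /casi -big_split; apply: eq_bigr => i _; rewrite !rotD. Qed.

Lemma casi0 : casi 0 = 0.
Proof. by rewrite /casi big1 // => i _; rewrite !rot0. Qed.

Lemma casi_harm l P : harm l P -> casi P = - ((l * l.+1)%:R *: P).
Proof. by move=> /casimir e; rewrite /casi e scaler_nat mulr_natl. Qed.

(** The Casimir operator has eigenvalue -l(l+1) in degree l, and these are distinct. Adding N(N+1)
    to it kills the top component and multiplies the lower ones by nonzero numbers, which gives an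
    induction on the number of components. *)
Lemma casimir_separation (U : MP -> Prop) : U 0 ->
  (forall P P', U P -> U P' -> U (P + P')) -> (forall c P, U P -> U (c *: P)) ->
  (forall i P, U P -> U (rot i P)) ->
  forall N (Q : nat -> MP), (forall l, (l < N)%N -> harm l (Q l)) ->
  U (\sum_(l < N) Q l) -> forall l, (l < N)%N -> U (Q l).
Proof.
move=> U0 UD UZ Ur; have Uc P : U P -> U (casi P).
  by move=> UP; apply: (big_ind U) => [//|P1 P2|i _]; [exact: UD|apply: (Ur); apply: Ur].
elim=> // N IH Q hQ UQ.
have low l : (l < N)%N -> U (Q l).
  move=> lN; pose c k : K := (N * N.+1)%:R - (k * k.+1)%:R.
  have c0 : c l != 0.
    by rewrite subr_eq0 eqr_nat gtn_eqF //; apply: ltn_mul.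
  suff Uq : U (c l *: Q l) by have := UZ (c l)^-1 _ Uq; rewrite scalerA mulVf // scale1r.
  apply: (IH (fun k => c k *: Q k)) => // [k kN|].
    by have := harm_lin (c k) (hQ k (ltnW kN)) (harm0 _ k); rewrite addr0.
  have := UD _ _ (Uc _ UQ) (UZ (N * N.+1)%:R _ UQ).
  rewrite (big_morph casi casiD casi0) scaler_sumr -big_split big_ord_recr /=.
  rewrite (casi_harm (hQ N (ltnSn N))) addNr addr0; congr U; apply: eq_bigr => k _.
  by rewrite (casi_harm (hQ k (ltnW (ltn_ord k)))) /c scalerBl addrC.
move=> l; rewrite ltnS leq_eqVlt => /orP[/eqP->|/low//].
have := UQ; rewrite big_ord_recr /=; set S := \sum_(i < N) _ => UQS.
have US : U S by apply: (big_ind U) => [//|P1 P2|i _]; [exact: UD|apply: low].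
by have := UD _ _ UQS (UZ (-1) _ US); rewrite scaleN1r addrAC subrr add0r.
Qed.

End CasimirSeparation.

Section DegreeSeparation.
Variable R : realType.
Notation C := R[i].
Notation MP := (mpoly.mpoly 3 C).
Notation ev := (@mpoly.meval 3 C).
Notation sep := (@separated_fun R).
Notation Fun := (punctured R -> C).

(** Vanishing on the unit sphere, which is all that functions of x/r can detect. Writing it with the
    constant radial factor 1 makes stability under [rot] a case of [angmom_sep]. *)
Definition sph0 (P : MP) : Prop := sep (fun=> 1) P = 0.

Lemma sph0P P : sph0 P <-> forall x : punctured R, ev (unitv (val x)) P = 0.
Proof.
split=> [h x|h]; last by apply/funext => x; rewrite sepE mul1r h.
by have := congr1 (fun f : Fun => f x) h; rewrite /= sepE mul1r.
Qed.

Lemma angmom0 i : angmom i (0 : Fun) = 0.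
Proof.
apply/funext => x; rewrite angmomE !(is_pd_pderiv (@is_pd0 _ _)).
by rewrite !mulr0 subr0.
Qed.

Lemma sph0_rot i P : sph0 P -> sph0 (rot i P).
Proof.
rewrite /sph0 => h; have du (r : R) : 0 < r -> is_cd (fun=> 1 : C) r 1 0 by move=> _; exact: is_cd_cst.
by rewrite -(angmom_sep i P du) h angmom0.
Qed.

Lemma sph0_separation N (Q : nat -> MP) : (forall l, (l < N)%N -> harm l (Q l)) ->
  sph0 (\sum_(l < N) Q l) -> forall l, (l < N)%N -> sph0 (Q l).
Proof.
apply: casimir_separation => [|P P' h h'|c P h|i P].
- exact: sep0.
- by rewrite /sph0 sepD h h' addr0.
- by rewrite /sph0 sepZ h scaler0.
- exact: sph0_rot.
Qed.

Lemma point_of_norm (r : R) (x : punctured R) : 0 < r ->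
  exists y : punctured R, enorm (val y) = r /\ unitv (val y) = unitv (val x).
Proof.
move=> r0; have n0 := enorm_gt0 (valP x); pose t := r / enorm (val x).
have t0 : 0 < t by rewrite divr_gt0.
have y0 : t *: val x != 0 by rewrite scaler_eq0 negb_or gt_eqF //= (valP x).
have ty : enorm (t *: val x) = r.
  have -> : enorm (t *: val x) = t * enorm (val x).
    rewrite /enorm -[t in RHS]ger0_norm ?(ltW t0) // -sqrtr_sqr -sqrtrM ?sqr_ge0 //.
    by rewrite mulr_sumr; congr Num.sqrt; apply: eq_bigr => j _; rewrite mxE exprMn.
  by rewrite /t divfK // gt_eqF.
exists (exist (fun v : 'cV[R]_3 => v != 0) (t *: val x) y0); split=> //=; apply/funext => i; rewrite /unitv ty mxE /t.
by congr (_%:C)%C; rewrite mulrAC [r / _]mulrC mulfK ?gt_eqF // mulrC.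
Qed.

(** At fixed norm r the sum is the restriction to the sphere of a polynomial with components u_l(r)
    Q_l, to which [sph0_separation] applies. *)
Lemma separation N (u : nat -> R -> C) (Q : nat -> MP) :
  (forall l, (l < N)%N -> harm l (Q l)) -> \sum_(l < N) sep (u l) (Q l) = 0 ->
  forall l r (x : punctured R), (l < N)%N -> 0 < r -> u l r * ev (unitv (val x)) (Q l) = 0.
Proof.
move=> hQ hs l r x lN r0.
have hq k : (k < N)%N -> harm k (u k r *: Q k).
  by move=> kN; have := harm_lin (u k r) (hQ k kN) (harm0 _ k); rewrite addr0.
have h : sph0 (u l r *: Q l).
  apply: (sph0_separation (Q := fun k => u k r *: Q k) hq _ lN).
  apply/sph0P => y; have [y' [e1 e2]] := point_of_norm y r0.
  have e : \sum_(k < N) sep (u k) (Q k) y' = 0.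
    by have := congr1 (fun f : Fun => f y') hs; rewrite /= fct_sumE.
  rewrite ev_sum -[RHS]e; apply: eq_bigr => k _.
  by rewrite sepE e1 e2 mpoly.mevalZ.
by have := (sph0P _).1 h x; rewrite mpoly.mevalZ.
Qed.

End DegreeSeparation.

(** * The two families *)

Section Families.
Variables (R : realType) (gamma : R).
Notation C := R[i].
Notation MP := (mpoly.mpoly 3 C).
Notation sep := (@separated_fun R).
Notation Fun := (punctured R -> C).
Notation Rfam := (regular_family gamma).
Notation Sfam := (singular_family gamma).

Record solid := Solid { sdeg : nat; spol : MP; sharm : harm sdeg spol }.
Implicit Types (h : solid) (z : C).

Lemma solid_harmonic h : harmonic_poly (sdeg h) (spol h).
Proof. exact: sharm h. Qed.

Lemma harmonic_harm l (P : MP) : harmonic_poly l P -> harm l P.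
Proof. by []. Qed.

Definition Freg l z : R -> C := projT1 (cid (regular_exists gamma l z)).

Lemma Freg_with l z : exists f, regular_with gamma l z (Freg l z) f.
Proof. exact: projT2 (cid (regular_exists gamma l z)). Qed.

Lemma Freg_regular l z : regular_radial gamma l z (Freg l z).
Proof. by apply/regular_withP; exact: Freg_with. Qed.

Lemma Gsing_exists l z : exists G, singular_radial gamma l z G.
Proof.
have [f hf] := Freg_with l z; have [G [b [c hG]]] := singular_exists hf.
by exists G; apply/singular_withP; exists (Freg l z), f, b, c.
Qed.

Definition Gsing l z : R -> C := projT1 (cid (Gsing_exists l z)).

Lemma Gsing_singular l z : singular_radial gamma l z (Gsing l z).
Proof. exact: projT2 (cid (Gsing_exists l z)). Qed.

Lemma Freg_sol l z : radial_solution gamma l z (Freg l z).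
Proof. by have [] := Freg_regular l z. Qed.

Lemma Gsing_sol l z : radial_solution gamma l z (Gsing l z).
Proof. by have [] := Gsing_singular l z. Qed.

Definition rsol h z : Sol gamma z := MkSol (is_solution_sep (Freg_sol (sdeg h) z) (sharm h)).
Definition ssol h z : Sol gamma z := MkSol (is_solution_sep (Gsing_sol (sdeg h) z) (sharm h)).

Lemma rsol_gen h z : reg_gen (rsol h z).
Proof.
by exists (sdeg h), (Freg (sdeg h) z), (spol h); split; [exact: Freg_regular|exact: solid_harmonic|].
Qed.

Definition rsec h : sections (RegSol gamma) := fun z => Submod (linspan_gen (rsol_gen h z)).
Definition ssec h : sections (SingSol gamma) := fun z => qproj _ (ssol h z).

Definition Rgens : set (sections (RegSol gamma)) :=
  [set s : sections (RegSol gamma) | exists (p : {poly C}) l P, harmonic_poly l P /\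
    forall z, exists2 F, regular_radial gamma l z F &
      Sol_fun (subval (s z)) = p.[z] *: separated_fun F P].
Definition Sgens : set (sections (SingSol gamma)) :=
  [set s : sections (SingSol gamma) | exists (p : {poly C}) l P, harmonic_poly l P /\
    forall z, exists G (psi : Sol gamma z), [/\ singular_radial gamma l z G,
      Sol_fun psi = separated_fun G P & s z = p.[z] *: qproj _ psi]].

Lemma rsec_gen h : Rgens (rsec h).
Proof.
exists 1, (sdeg h), (spol h); split=> [|z]; first exact: solid_harmonic.
by exists (Freg (sdeg h) z); [exact: Freg_regular|rewrite hornerC scale1r].
Qed.

Lemma ssec_gen h : Sgens (ssec h).
Proof.
exists 1, (sdeg h), (spol h); split=> [|z]; first exact: solid_harmonic.
exists (Gsing (sdeg h) z), (ssol h z); split=> //; first exact: Gsing_singular.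
by rewrite hornerC scale1r.
Qed.

Definition gr h : Rfam := Submod (linspan_gen (rsec_gen h)).
Definition gs h : Sfam := Submod (linspan_gen (ssec_gen h)).

Definition rfun (t : Rfam) z : Fun := Sol_fun (subval (subval t z)).

Lemma rfun_gr h z : rfun (gr h) z = sep (Freg (sdeg h) z) (spol h).
Proof. by []. Qed.

Lemma rfunD t t' z : rfun (t + t') z = rfun t z + rfun t' z.
Proof. by []. Qed.

Lemma rfunZ (p : {poly C}) t z : rfun (p *: t) z = p.[z] *: rfun t z.
Proof. by []. Qed.

Lemma rfun_inj t t' : (forall z, rfun t z = rfun t' z) -> t = t'.
Proof.
move=> e; apply: val_inj; apply: functional_extensionality_dep => z.
apply: val_inj; apply: val_inj; exact: e.
Qed.

Definition sval_at (s : Sfam) z : SingSol gamma z := subval s z.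

Lemma svalD s s' z : sval_at (s + s') z = sval_at s z + sval_at s' z.
Proof. by []. Qed.

Lemma svalZ (p : {poly C}) s z : sval_at (p *: s) z = p.[z] *: sval_at s z.
Proof. by []. Qed.

Lemma sval_inj s s' : (forall z, sval_at s z = sval_at s' z) -> s = s'.
Proof. by move=> e; apply: val_inj; apply: functional_extensionality_dep => z; exact: e. Qed.

Lemma gr_of (a : Rfam) (p : {poly C}) l (P : MP) (hP : harm l P) :
  (forall z, exists2 F, regular_radial gamma l z F & rfun a z = p.[z] *: sep F P) ->
  a = p *: gr (Solid hP).
Proof.
move=> ha; apply: rfun_inj => z; have [F hF ->] := ha z; rewrite rfunZ rfun_gr /=.
by congr (_ *: _); apply: sep_eq => r r0; apply: regular_unique hF (Freg_regular l z) r r0.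
Qed.

(** Two choices of the singular solution differ by a multiple of F_l, which is invisible modulo
    regular solutions. Hence the sections built from [Gsing] generate the whole family. *)
Lemma qproj_sing_eq z l (P : MP) G G' (psi psi' : Sol gamma z) : harm l P ->
  singular_radial gamma l z G -> singular_radial gamma l z G' ->
  Sol_fun psi = sep G P -> Sol_fun psi' = sep G' P ->
  qproj (@reg_gen R gamma z) psi = qproj (@reg_gen R gamma z) psi'.
Proof.
move=> hP hG hG' e e'; apply/eqP; rewrite qproj_eq; have hF := Freg_regular l z.
have [t ht] := singular_unique hG' hG hF.
have -> : psi - psi' = t *: rsol (Solid hP) z.
  apply: val_inj; rewrite -[LHS]/(Sol_fun psi - Sol_fun psi') e e'.
  rewrite -[RHS]/(t *: sep (Freg l z) P); apply/funext => x.
  rewrite -[LHS]/(sep G P x - sep G' P x) -[RHS]/(t * sep (Freg l z) P x) !sepE ht ?(enorm_gt0 (valP x)) //.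
  by rewrite mulrDl addrAC subrr add0r mulrA.
by apply: rpredZ; apply: linspan_gen; exact: rsol_gen.
Qed.

Lemma gs_of (a : Sfam) (p : {poly C}) l (P : MP) (hP : harm l P) :
  (forall z, exists G (psi : Sol gamma z), [/\ singular_radial gamma l z G,
      Sol_fun psi = sep G P & sval_at a z = p.[z] *: qproj _ psi]) ->
  a = p *: gs (Solid hP).
Proof.
move=> ha; apply: sval_inj => z; have [G [psi [hG e ->]]] := ha z; rewrite svalZ.
congr (_ *: _); apply: (qproj_sing_eq hP hG (Gsing_singular l z) e).
by [].
Qed.

(** Formal combinations of generators with coefficients in C[T], common to both families. Membership
    in a span only provides some presentation, so maps are defined on symbols and then shown to
    respect relations. *)
Definition symbol : Type := seq ({poly C} * solid).
Definition evR (sg : symbol) : Rfam := \sum_(t <- sg) t.1 *: gr t.2.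
Definition evS (sg : symbol) : Sfam := \sum_(t <- sg) t.1 *: gs t.2.

Lemma evR_cat sg sg' : evR (sg ++ sg') = evR sg + evR sg'. Proof. exact: big_cat. Qed.
Lemma evS_cat sg sg' : evS (sg ++ sg') = evS sg + evS sg'. Proof. exact: big_cat. Qed.

Lemma subval_sum (K : pzRingType) (V : lmodType K) (U : set V) I (r : seq I) (F : I -> submod U) :
  subval (\sum_(i <- r) F i) = \sum_(i <- r) subval (F i).
Proof. exact: (big_morph (fun t : submod U => subval t) (fun _ _ => erefl) erefl). Qed.

Lemma evR_surj (t : Rfam) : exists sg, t = evR sg.
Proof.
have /asboolP[n [a [c [ha e]]]] := subvalP t.
have hA i : exists qh : {poly C} * solid, a i = subval (qh.1 *: gr qh.2).
  have [p [l [P [hP hz]]]] := ha i; exists (p, Solid hP).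
  by rewrite -(@gr_of (Submod (linspan_gen (ha i))) p l P).
have [q hq] := boolp.choice hA.
exists [seq (c i * (q i).1, (q i).2) | i <- enum 'I_n].
apply: val_inj; rewrite /= e /evR big_map big_enum subval_sum.
by apply: eq_bigr => i _; rewrite hq -scalerA.
Qed.

Lemma evS_surj (s : Sfam) : exists sg, s = evS sg.
Proof.
have /asboolP[n [a [c [ha e]]]] := subvalP s.
have hA i : exists qh : {poly C} * solid, a i = subval (qh.1 *: gs qh.2).
  have [p [l [P [hP hz]]]] := ha i; exists (p, Solid hP).
  by rewrite -(@gs_of (Submod (linspan_gen (ha i))) p l P).
have [q hq] := boolp.choice hA.
exists [seq (c i * (q i).1, (q i).2) | i <- enum 'I_n].
apply: val_inj; rewrite /= e /evS big_map big_enum subval_sum.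
by apply: eq_bigr => i _; rewrite hq -scalerA.
Qed.

End Families.

(** * Independence of regular and singular solutions *)

Section Independence.
Variables (R : realType) (gamma : R).
Notation C := R[i].

(** With s the square root of r, ln(1/s) < 1/s gives s |ln s| < 1, and r ln r = 2 s^2 ln s. *)
Lemma norm_ln_mul_le (r : R) : 0 < r -> r < 1 -> `|r * ln r| <= 2 * Num.sqrt r.
Proof.
move=> r0 r1; have s0 : 0 < Num.sqrt r by rewrite sqrtr_gt0.
have e : r = Num.sqrt r ^+ 2 by rewrite sqr_sqrtr ?ltW.
have h : ln (Num.sqrt r)^-1 < (Num.sqrt r)^-1 by apply: ln_sublinear; rewrite invr_gt0.
have l1 : ln r <= 0 by apply: ln_le0; exact: ltW.
rewrite lnV ?posrE // in h.
have h2 : Num.sqrt r * - ln (Num.sqrt r) < 1 by rewrite -(mulfV (lt0r_neq0 s0)) ltr_pM2l.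
rewrite normrM (ger0_norm (ltW r0)) (ler0_norm l1) e lnXn // -e.
rewrite {1}e; move: s0 h2; move: (Num.sqrt r) (ln _) => s L s0 h2; nra.
Qed.

Lemma ln_mul_cvg0 : (r * ln r : R) @[r --> 0^'+] --> (0 : R).
Proof.
apply/cvgr0Pnorm_lt => e e0; near=> r.
have r0 : 0 < r by near: r; exact: nbhs_right_gt.
apply: le_lt_trans (norm_ln_mul_le r0 _) _; first by near: r; exact: nbhs_right_lt.
have : r < (e / 2) ^+ 2 by near: r; apply: nbhs_right_lt; rewrite exprn_gt0 ?divr_gt0.
rewrite -(ltr_sqrt) ?exprn_gt0 ?divr_gt0 // sqrtr_sqr gtr0_norm ?divr_gt0 //.
by rewrite ltr_pdivlMr // mulrC.
Unshelve. all: by end_near. Qed.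

Lemma log_limit_eq0 (h u v : R -> R) : {for 0, continuous h} -> {for 0, continuous u} ->
  {for 0, continuous v} -> (forall r, 0 < r -> h r = r * u r + r * ln r * v r) -> h 0 = 0.
Proof.
move=> hc uc vc e.
have /cvg_at_right_filter ch : h r @[r --> 0] --> h 0 by [].
have /cvg_at_right_filter cu : u r @[r --> 0] --> u 0 by [].
have /cvg_at_right_filter cv : v r @[r --> 0] --> v 0 by [].
have ci : r @[r --> (0 : R)^'+] --> (0 : R) by apply: cvg_at_right_filter; exact: cvg_id.
have : h r @[r --> 0^'+] --> (0 * u 0 + 0 * v 0).
  apply: (@cvg_trans _ ((r * u r + r * ln r * v r) @[r --> 0^'+])).
    by apply: near_eq_cvg; near=> r; rewrite e //; near: r; exact: nbhs_right_gt.
  exact: (cvgD (cvgM ci cu) (cvgM ln_mul_cvg0 cv)).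
rewrite !mul0r addr0 => /(cvg_unique _ ch) -> //; exact: norm_hausdorff.
Unshelve. all: by end_near. Qed.

Lemma Re_real_mul (r : R) (c : C) : complex.Re (r%:C%C * c) = r * complex.Re c.
Proof. by case: c => a b /=; rewrite mul0r subr0. Qed.
Lemma Re_add (c d : C) : complex.Re (c + d) = complex.Re c + complex.Re d.
Proof. by case: c d => a b []. Qed.

(** After multiplication by r^(l+1) proportionality would express the series b as r times a power
    series plus r ln r times another. Both tend to 0 at the origin, whereas b(0) = 1. *)
Lemma singular_not_regular l z G F t : singular_radial gamma l z G ->
  regular_radial gamma l z F -> ~ (forall r, 0 < r -> G r = t * F r).
Proof.
move=> /singular_withP[F1 [f [b [c [_ hF1 eb b1 hG]]]]] hF hGF.
have [_ ef f1 hF1f] := hF1.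
have FF1 r : 0 < r -> F r = F1 r by apply: (@regular_unique _ gamma l z) => //; apply/regular_withP; exists f.
pose q := iter (l + l) (@xseq R) f; have eq_ : ent q by exact: ent_iter_xseq.
have key r : 0 < r -> cps b r = r%:C%C * cps (fun k => t * q k) r
    + (r * ln r)%:C%C * cps (fun k => - c * q k) r.
  move=> r0; have := hG r r0; rewrite hGF // FF1 // hF1f // /formv hF1f //.
  rewrite !cpsZ // /q cps_iter_xseq // rmorphM /= => e.
  have rr : r%:C%C * (r^-1)%:C%C = 1 :> C by rewrite -rmorphM /= mulfV ?gt_eqF.
  have aux (K : comPzRingType) (x y L B g T D : K) : x * y = 1 ->
      T * (x ^+ l * g) = y ^+ l.+1 * B + D * L * (x ^+ l * g) ->
      B = x * (T * (x ^+ (l + l) * g)) + x * L * (- D * (x ^+ (l + l) * g)).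
    move=> xy /eqP; rewrite -subr_eq => /eqP h.
    have e1 : x ^+ l.+1 * y ^+ l.+1 = 1 by rewrite -exprMn xy expr1n.
    by rewrite -[B]mul1r -e1 -mulrA -h exprS exprD; ring.
  exact: (aux _ _ _ (ln r)%:C%C _ _ _ _ rr e).
have eT : ent (fun k => t * q k) by apply: entZ.
have eC : ent (fun k => - c * q k) by apply: entZ.
have h1 : complex.Re (cps b 0) = 0.
  apply: (log_limit_eq0 (cps_continuous_Re eb (x := 0)) (cps_continuous_Re eT (x := 0)) (cps_continuous_Re eC (x := 0))).
  by move=> r r0; rewrite key // Re_add !Re_real_mul.
by move: h1; rewrite cps_at0 b1 /= => /eqP; rewrite oner_eq0.
Qed.

Lemma regular_not0 l z F : regular_radial gamma l z F -> ~ (forall r, 0 < r -> F r = 0).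
Proof.
move=> /regular_withP[f [_ ef f1 hF]] F0; have : f 0%N = 0.
  apply: cps_eq0_head ef _ => r r0; have := hF r r0; rewrite F0 // => /esym/eqP.
  by rewrite mulf_eq0 expf_eq0 (negbTE (rc_neq0 r0)) andbF => /eqP.
by rewrite f1 => /eqP; rewrite oner_eq0.
Qed.

End Independence.

Section Components.
Variables (R : realType) (gamma : R).
Notation C := R[i].
Notation MP := (mpoly.mpoly 3 C).
Notation ev := (@mpoly.meval 3 C).
Notation sep := (@separated_fun R).
Notation Fun := (punctured R -> C).
Notation symbol := (symbol R).
Notation evR := (@evR R gamma).
Notation evS := (@evS R gamma).
Implicit Types (sg : symbol) (z : C).

Lemma separation2 N (u v : nat -> R -> C) (P Q : nat -> MP) :
  (forall l, harm l (P l)) -> (forall l, harm l (Q l)) ->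
  \sum_(l < N) sep (u l) (P l) = \sum_(l < N) sep (v l) (Q l) ->
  forall l (r : R) (x : punctured R), (l < N)%N -> 0 < r ->
  u l r * ev (unitv (val x)) (P l) = v l r * ev (unitv (val x)) (Q l).
Proof.
move=> hP hQ hs l r x lN r0; pose W k := u k r *: P k + (- v k r) *: Q k.
have hW k : (k < N)%N -> harm k (W k).
  move=> _; apply: harm_lin => //; have := harm_lin (- v k r) (hQ k) (harm0 _ k).
  by rewrite addr0.
have evW k (y : punctured R) : ev (unitv (val y)) (W k) =
    u k r * ev (unitv (val y)) (P k) - v k r * ev (unitv (val y)) (Q k).
  by rewrite mpoly.mevalD !mpoly.mevalZ mulNr.
have h : sph0 (W l).
  apply: (sph0_separation hW _ lN); apply/sph0P => y.
  have [y' [e1 e2]] := point_of_norm y r0.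
  have := congr1 (fun f : Fun => f y') hs; rewrite /= !fct_sumE => e.
  rewrite ev_sum; transitivity (\sum_(k < N) (u k r * ev (unitv (val y)) (P k) - v k r * ev (unitv (val y)) (Q k))); first by apply: eq_bigr => k _; exact: evW.
  apply/eqP; rewrite sumrB subr_eq0; apply/eqP.
  have aux w (T : nat -> MP) : \sum_(k < N) w k r * ev (unitv (val y)) (T k) = \sum_(k < N) sep (w k) (T k) y'.
    by apply: eq_bigr => k _; rewrite sepE e1 e2.
  by rewrite (aux u P) (aux v Q).
by have /sph0P/(_ x)/eqP := h; rewrite evW subr_eq0 => /eqP.
Qed.

(** The harmonic polynomial that multiplies F_l, or G_l, in the value at z. It does not depend on
    which family the symbol is evaluated in, which is why relations can be compared. *)
Definition scomp sg z (l : nat) : MP := \sum_(t <- sg | sdeg t.2 == l) t.1.[z] *: spol t.2.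

Lemma harm_scomp sg z l : harm l (scomp sg z l).
Proof.
apply: (big_ind (harm l)) => [|P Q hP hQ|t /eqP tl]; first exact: harm0.
  by have := harm_lin 1 hP hQ; rewrite scale1r.
by have := harm_lin t.1.[z] (sharm t.2) (harm0 _ _); rewrite addr0 tl.
Qed.

Definition sbound sg : nat := \max_(t <- sg) (sdeg t.2).+1.

Lemma sum_by_degree sg N (V : nmodType) (f : {poly C} * solid R -> V) : (sbound sg <= N)%N ->
  \sum_(t <- sg) f t = \sum_(l < N) \sum_(t <- sg | sdeg t.2 == l) f t.
Proof.
rewrite /sbound; elim: sg => [|t sg IH] hN; first by rewrite big_nil big1 // => l _; rewrite big_nil.
move: hN; rewrite !big_cons geq_max => /andP[tN sN]; rewrite IH //.
rewrite [RHS](eq_bigr (fun l : 'I_N => (if (sdeg t.2) == l then f t else 0) + \sum_(s <- sg | sdeg s.2 == l) f s)).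
  rewrite big_split /= -big_mkcond /=; congr (_ + _).
  by rewrite (@big_pred1 _ _ _ _ (Ordinal tN)) // => k; rewrite -val_eqE eq_sym.
by move=> l _; rewrite big_cons; case: ifP => // _; rewrite add0r.
Qed.

Lemma sep_scomp u sg z l :
  sep u (scomp sg z l) = \sum_(t <- sg | sdeg t.2 == l) t.1.[z] *: sep u (spol t.2).
Proof.
rewrite (big_morph (sep u) (@sepD R u) (sep0 u)).
by apply: eq_bigr => t _; rewrite sepZ.
Qed.

Lemma rfun_sum sg z : rfun (evR sg) z = \sum_(t <- sg) t.1.[z] *: sep (Freg gamma (sdeg t.2) z) (spol t.2).
Proof. by rewrite /evR (big_morph (fun t => rfun t z) (fun _ _ => erefl) erefl). Qed.

Lemma rfun_evR sg z N : (sbound sg <= N)%N ->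
  rfun (evR sg) z = \sum_(l < N) sep (Freg gamma l z) (scomp sg z l).
Proof.
move=> hN; rewrite rfun_sum (sum_by_degree _ hN).
by apply: eq_bigr => l _; rewrite sep_scomp; apply: eq_bigr => t /eqP->.
Qed.

Definition spsi sg z : Sol gamma z := \sum_(t <- sg) t.1.[z] *: ssol gamma t.2 z.

Lemma sval_evS sg z : sval_at (evS sg) z = qproj _ (spsi sg z).
Proof.
rewrite /evS (big_morph (fun t => sval_at t z) (fun _ _ => erefl) erefl) /spsi linear_sum.
by apply: eq_bigr => t _; rewrite linearZ.
Qed.

Lemma spsi_fun sg z N : (sbound sg <= N)%N ->
  Sol_fun (spsi sg z) = \sum_(l < N) sep (Gsing gamma l z) (scomp sg z l).
Proof.
move=> hN; rewrite /spsi (big_morph (fun t : Sol gamma z => Sol_fun t) (fun _ _ => erefl) erefl).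
rewrite (sum_by_degree _ hN).
by apply: eq_bigr => l _; rewrite sep_scomp; apply: eq_bigr => t /eqP<-.
Qed.

Lemma sep_sph0 u (P : MP) : sph0 P -> sep u P = 0.
Proof. by move=> /sph0P h; apply/funext => x; rewrite sepE h (mulr0 (u _)). Qed.

Lemma scomp_out sg z l : (sbound sg <= l)%N -> scomp sg z l = 0.
Proof.
rewrite /sbound /scomp; elim: sg => [|t sg IH]; first by rewrite !big_nil.
rewrite !big_cons geq_max => /andP[tN /IH->]; case: eqP => // e.
by rewrite e ltnn in tN.
Qed.

Lemma sph0_0 : sph0 (0 : MP). Proof. exact: sep0. Qed.

Lemma rfun_eq0P sg z : rfun (evR sg) z = 0 <-> forall l, sph0 (scomp sg z l).
Proof.
rewrite (rfun_evR z (leqnn _)); split=> [e l|h]; last first.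
  by rewrite big1 // => l _; apply: sep_sph0.
case: (leqP (sbound sg) l) => [lN|lN]; first by rewrite scomp_out //; exact: sph0_0.
apply/sph0P => x; apply: contrapT => /eqP n0.
apply: (regular_not0 (Freg_regular gamma l z)) => r r0.
have := @separation _ (sbound sg) (fun l => Freg gamma l z) _ (fun l _ => harm_scomp sg z l) e l r x lN r0.
by move/eqP; rewrite mulf_eq0 (negbTE n0) orbF => /eqP.
Qed.

(** A combination of the G_l that is zero in the quotient equals a combination of the F_l. Comparing
    degree by degree, a component of the former that is nonzero at some point of the sphere would
    make G_l a multiple of F_l. *)
Lemma sval_eq0P sg z : sval_at (evS sg) z = 0 <-> forall l, sph0 (scomp sg z l).
Proof.
rewrite sval_evS; split=> [e l|h]; last first.
  have -> : spsi sg z = 0.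
    apply: val_inj; rewrite /= (spsi_fun z (leqnn _)) big1 // => l _; exact: sep_sph0.
  exact: linear0.
have : spsi sg z - 0 \in linspan (@reg_gen R gamma z) by rewrite -qproj_eq e linear0.
rewrite subr0 => /asboolP[n [a [c [ha ea]]]].
have hA i : exists h : solid R, Sol_fun (a i) = sep (Freg gamma (sdeg h) z) (spol h).
  have [k [F [P [hF hP ->]]]] := ha i; exists (Solid (harmonic_harm hP)).
  by apply: sep_eq => r r0; apply: (regular_unique hF (Freg_regular gamma k z) r0).
have [h hh] := boolp.choice hA.
pose sg' : symbol := [seq ((c i)%:P, h i) | i <- enum 'I_n].
pose N := maxn (sbound sg) (sbound sg').
have e1 : Sol_fun (spsi sg z) = rfun (evR sg') z.
  rewrite ea rfun_sum big_map big_enum.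
  rewrite (big_morph (fun t : Sol gamma z => Sol_fun t) (fun _ _ => erefl) erefl).
  by apply: eq_bigr => i _; rewrite /= hornerC -hh.
rewrite (@spsi_fun _ _ N) ?leq_maxl // (@rfun_evR _ _ N) ?leq_maxr // in e1.
case: (leqP N l) => [lN|lN].
  by rewrite scomp_out; [exact: sph0_0|exact: leq_trans (leq_maxl _ _) lN].
apply/sph0P => x; apply: contrapT => /eqP n0.
pose t := ev (unitv (val x)) (scomp sg' z l) / ev (unitv (val x)) (scomp sg z l).
apply: (@singular_not_regular _ _ _ _ _ _ t (Gsing_singular gamma l z) (Freg_regular gamma l z)) => r r0.
have e2 := separation2 (u := fun l => Gsing gamma l z) (v := fun l => Freg gamma l z) (harm_scomp sg z) (harm_scomp sg' z) e1 x lN r0.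
by rewrite /t mulrAC [_ * Freg _ _ _ _]mulrC -e2 mulfK.
Qed.

Lemma evR_eq0P sg : evR sg = 0 <-> forall z l, sph0 (scomp sg z l).
Proof.
split=> [e z|h]; first by apply/rfun_eq0P; rewrite e.
by apply: rfun_inj => z; rewrite ((rfun_eq0P sg z).2 (h z)).
Qed.

Lemma evS_eq0P sg : evS sg = 0 <-> forall z l, sph0 (scomp sg z l).
Proof.
split=> [e z|h]; first by apply/sval_eq0P; rewrite e.
by apply: sval_inj => z; rewrite ((sval_eq0P sg z).2 (h z)).
Qed.

End Components.

(** * The intertwining operator *)

Lemma poly_nat_eq0 (K : numFieldType) (p : {poly K}) : (forall n : nat, p.[n%:R] = 0) -> p = 0.
Proof.
move=> h; apply/eqP; apply/negP => /negP p0.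
have : (size [seq (n%:R : K) | n <- iota 0 (size p)] < size p)%N.
  apply: max_poly_roots => //; first by apply/allP => _ /mapP[n _ ->]; apply/eqP; exact: h.
  by rewrite map_inj_uniq ?iota_uniq // => m n /eqP; rewrite eqr_nat => /eqP.
by rewrite size_map size_iota ltnn.
Qed.

Section Operator.
Variables (R : realType) (gamma : R).
Notation C := R[i].
Notation symbol := (symbol R).
Notation evR := (@evR R gamma).
Notation evS := (@evS R gamma).
Notation Rfam := (regular_family gamma).
Notation Sfam := (singular_family gamma).
Implicit Types (sg : symbol) (z : C).

Definition mulsym (f : nat -> {poly C}) sg : symbol := [seq (f (sdeg t.2) * t.1, t.2) | t <- sg].

Lemma scomp_mulsym f sg z l : scomp (mulsym f sg) z l = (f l).[z] *: scomp sg z l.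
Proof.
rewrite /scomp big_map /= scaler_sumr; apply: eq_bigr => t /eqP->.
by rewrite hornerM scalerA.
Qed.

Lemma scomp_cat sg sg' z l : scomp (sg ++ sg') z l = scomp sg z l + scomp sg' z l.
Proof. exact: big_cat. Qed.

Lemma evR_mulsym (p : {poly C}) sg : evR (mulsym (fun=> p) sg) = p *: evR sg.
Proof. by rewrite /evR big_map scaler_sumr; apply: eq_bigr => t _; rewrite scalerA. Qed.

Lemma evS_mulsym (p : {poly C}) sg : evS (mulsym (fun=> p) sg) = p *: evS sg.
Proof. by rewrite /evS big_map scaler_sumr; apply: eq_bigr => t _; rewrite scalerA. Qed.

Lemma evS0_mulsym f sg : evS sg = 0 -> evR (mulsym f sg) = 0.
Proof.
move/evS_eq0P => h; apply/evR_eq0P => z l; rewrite scomp_mulsym.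
by rewrite /sph0 sepZ h scaler0.
Qed.

(** Well-definedness of the operator: both families have the relations given by vanishing
    components, and multiplying the component of degree l by a polynomial depending on l preserves
    these. *)
Lemma evS_eq_mulsym f sg sg' : evS sg = evS sg' -> evR (mulsym f sg) = evR (mulsym f sg').
Proof.
move=> e; have : evS (sg ++ mulsym (fun=> -1) sg') = 0.
  by rewrite evS_cat evS_mulsym e scaleN1r subrr.
move/(evS0_mulsym f); rewrite /mulsym map_cat evR_cat -/(mulsym f sg) => h.
apply/eqP; rewrite -subr_eq0 -h; apply/eqP; congr (_ + _).
rewrite -scaleN1r -evR_mulsym /mulsym -!map_comp; congr evR; apply: eq_map => t /=.
by rewrite mulrCA.
Qed.

Definition apol (l : nat) : {poly C} := ((gamma%:C ^+ 2)%:P + (l.+1%:R ^+ 2) *: 'X)%C.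
Definition kcoef (l : nat) : C := ((2 * l%:R + 1) * (2 * l%:R + 3) * l.+1%:R ^+ 2)^-1.
(* The quotient cpol l.+1 / cpol l is forced: it is the quotient of the constants
   in rup_regular and rup_singular. *)
Fixpoint cpol (l : nat) : {poly C} :=
  if l is m.+1 then cpol m * (kcoef m *: apol m) else 1.

Lemma horner_apol l z : (apol l).[z] = acoef gamma l z.
Proof. by rewrite /apol hornerD hornerC hornerZ hornerX mulrC. Qed.

Lemma cpol_neq0 l : cpol l != 0.
Proof.
elim: l => [|l IH]; first exact: oner_neq0.
rewrite /= mulf_neq0 // scaler_eq0 negb_or; apply/andP; split.
  have h3 : 2 * l%:R + 3 != 0 :> C by exact: (natC_odd_neq0 R l 2).
  have h1 : 2 * l%:R + 1 != 0 :> C by exact: (natC_odd_neq0 R l 0).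
  by rewrite invr_neq0 // !mulf_neq0 ?expf_neq0 ?natC_neq0.
apply/eqP => /(congr1 (fun p : {poly C} => p`_1)).
rewrite coefD coefC coefZ coefX add0r mulr1 coef0 => /eqP.
by rewrite expf_eq0 (negbTE (natC_neq0 _ l)).
Qed.

Definition symS (s : Sfam) : symbol := projT1 (cid (evS_surj s)).
Lemma symSE s : evS (symS s) = s. Proof. by rewrite /symS; case: cid. Qed.

Definition Aop (s : Sfam) : Rfam := evR (mulsym cpol (symS s)).

Lemma Aop_evS sg : Aop (evS sg) = evR (mulsym cpol sg).
Proof. by apply: evS_eq_mulsym; rewrite symSE. Qed.

Fact Aop_linear : linear Aop.
Proof.
move=> p s s'; rewrite -[s]symSE -[s']symSE -evS_mulsym -evS_cat !Aop_evS.
rewrite /mulsym map_cat evR_cat -evR_mulsym; congr (_ + _).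
by rewrite /mulsym -!map_comp; congr evR; apply: eq_map => t /=; rewrite mulrCA.
Qed.
HB.instance Definition _ := GRing.isLinear.Build {poly C} Sfam Rfam _ Aop Aop_linear.

Lemma Aop_gs h : Aop (gs gamma h) = cpol (sdeg h) *: gr gamma h.
Proof.
have e : gs gamma h = evS [:: (1, h)] by rewrite /evS big_seq1 scale1r.
by rewrite e Aop_evS /evR /= big_seq1 /= mulr1.
Qed.

Definition sev sg (l : nat) (w : 'I_3 -> C) : {poly C} :=
  \sum_(t <- sg | sdeg t.2 == l) (mpoly.meval w (spol t.2))%:P * t.1.

Lemma horner_sev sg l w z : (sev sg l w).[z] = mpoly.meval w (scomp sg z l).
Proof.
rewrite /sev horner_sum /scomp (big_morph (mpoly.meval w) (mpoly.mevalD w) (mpoly.meval0 w)).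
by apply: eq_bigr => t _; rewrite hornerM hornerC mpoly.mevalZ mulrC.
Qed.

Lemma Aop_inj : injective Aop.
Proof.
move=> s s' e; apply/eqP; rewrite -subr_eq0; apply/eqP.
have : Aop (s - s') = 0 by rewrite linearB /= e subrr.
rewrite -[s - s']symSE Aop_evS => /evR_eq0P h; apply/evS_eq0P => z l.
(* At a point of the sphere the component is a polynomial q in z. The factor [cpol] l may vanish at
   the given z, so it is cancelled in C[T] rather than at that value. *)
apply/sph0P => x; apply/eqP; rewrite -horner_sev; set q := sev _ _ _.
suff -> : q = 0 by rewrite horner0.
have : cpol l * q = 0.
  apply: poly_nat_eq0 => n; rewrite hornerM horner_sev.
  by have /sph0P/(_ x) := h n%:R l; rewrite scomp_mulsym mpoly.mevalZ.
by move/eqP; rewrite mulf_eq0 (negbTE (cpol_neq0 l)) => /eqP.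
Qed.

Lemma Alin_exists : exists f : {linear Sfam -> Rfam}, forall s, f s = Aop s.
Proof. by exists Aop. Qed.

Definition Alin : {linear Sfam -> Rfam} := projT1 (cid Alin_exists).

Lemma AlinE s : Alin s = Aop s.
Proof. exact: projT2 (cid Alin_exists) s. Qed.

End Operator.

Lemma linear_packed (K : pzRingType) (V W : lmodType K) (f : V -> W) : linear f ->
  exists g : {linear V -> W}, forall v, g v = f v.
Proof.
by move=> hf; exists (HB.pack_for {linear V -> W} f (GRing.isLinear.Build K V W _ f hf)).
Qed.

Lemma linear_comb3 (K : pzRingType) (V W : lmodType K) (f : {linear V -> W}) (a b c : K) (u v w : V) :
  f (a *: u + b *: (c *: (v - w))) = a *: f u + b *: (c *: (f v - f w)).
Proof. by rewrite linearD !linearZ linearB. Qed.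

Lemma linear_comb4 (K : comPzRingType) (V W : lmodType K) (f : {linear V -> W}) (a b c d e : K) (u v w : V) :
  f (a *: u + b *: (c *: (d *: v - e *: w))) = a *: f u + b *: (c *: (d *: f v - e *: f w)).
Proof. by rewrite linear_comb3 !linearZ. Qed.

Lemma comb4_scale (K : comPzRingType) (W : lmodType K) (a b c d e p q r d' e' : K) (u v w : W) :
  d * q = p * d' -> e *: (r *: w) = (p * e') *: w ->
  a *: (p *: u) + b *: (c *: (d *: (q *: v) - e *: (r *: w))) =
  p *: (a *: u + b *: (c *: (d' *: v - e' *: w))).
Proof.
have sC x y (s : W) : x *: (y *: s) = y *: (x *: s) by rewrite !scalerA mulrC.
move=> dq ->; rewrite [d *: _]scalerA dq -!(scalerA p) -scalerBr.
by rewrite (sC a p) (sC c p) (sC b p) -scalerDr.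
Qed.

(** * The action of the Lie algebra on generators *)

Section LieAction.
Variables (R : realType) (gamma : R).
Notation C := R[i].
Notation D := (@mpoly.mderiv 3 C).
Notation sep := (@separated_fun R).
Notation solid := (solid R).
Notation Rfam := (regular_family gamma).
Notation Sfam := (singular_family gamma).
Notation gr := (@gr R gamma).
Notation gs := (@gs R gamma).
Implicit Types (h : solid) (z : C) (i : 'I_3).

Definition hrot i h := Solid (harm_rot i (sharm h)).
Definition hraise i h := Solid (harm_raise i (sharm h)).
Definition hder i h := Solid (harm_D i (sharm h)).

Lemma rfunB (t t' : Rfam) z : rfun (t - t') z = rfun t z - rfun t' z.
Proof. by []. Qed.
Lemma svalB (s s' : Sfam) z : sval_at (s - s') z = sval_at s z - sval_at s' z.
Proof. by []. Qed.

Lemma Sol_funD z (u v : Sol gamma z) : Sol_fun (u + v) = Sol_fun u + Sol_fun v.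
Proof. by []. Qed.
Lemma Sol_funB z (u v : Sol gamma z) : Sol_fun (u - v) = Sol_fun u - Sol_fun v.
Proof. by []. Qed.
Lemma Sol_funZ z c (u : Sol gamma z) : Sol_fun (c *: u) = c *: Sol_fun u.
Proof. by []. Qed.

(** The coefficients of the raising and lowering parts of R_i on generators, up to the factor
    sqrt(-1) and the minus sign of the lowering part. The lowering ones absorb the factor (2l+1)^-1
    of [rungelenz_sep]; in degree 0 their value is irrelevant to the sum, as d_i P is then zero. *)
Definition cuR (l : nat) : {poly C} := (- ((2 * l%:R + 3) * l.+1%:R))^-1 *: apol gamma l.
Definition cdR (l : nat) : {poly C} := (l%:R)%:P.
Definition cuS (l : nat) : {poly C} := (- (l.+1%:R * (2 * l%:R + 1)))%:P.
Definition cdS (l : nat) : {poly C} :=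
  if l is m.+1 then ((2 * l%:R + 1) * ((2 * m%:R + 1) * m.+1%:R))^-1 *: apol gamma m else 0.

Lemma up_reg i h z : sep (rup gamma (sdeg h) (Freg gamma (sdeg h) z)) (raise (sdeg h) i (spol h)) =
  (cuR (sdeg h)).[z] *: rfun (gr (hraise i h)) z.
Proof.
rewrite rfun_gr /=; set l := sdeg h; set Q := raise _ _ _.
transitivity (sep (fun r => (cuR l).[z] * Freg gamma l.+1 z r + 0 * Freg gamma l.+1 z r) Q).
  apply: sep_eq => r r0.
  rewrite (rup_regular (Freg_regular gamma l z) (Freg_regular gamma l.+1 z) r0).
  rewrite mul0r addr0 /cuR hornerZ horner_apol; congr (_ * _).
  by rewrite invrN !mulNr mulrC.
by rewrite sep_lin scale0r addr0.
Qed.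

Lemma down_reg i h z : (2 * (sdeg h)%:R + 1)^-1 *: sep (rdown gamma (sdeg h) (Freg gamma (sdeg h) z)) (D i (spol h)) =
  (cdR (sdeg h)).[z] *: rfun (gr (hder i h)) z.
Proof.
rewrite rfun_gr /= hornerC; have := sharm h; move: (sdeg h) (spol h) => [|l] P hP.
  by rewrite homog0_D ?sep0 ?scaler0 //; case: hP.
transitivity ((2 * l.+1%:R + 1)^-1 *: sep (fun r => (l.+1%:R * (2 * l%:R + 3)) * Freg gamma l z r + 0 * Freg gamma l z r) (D i P)).
  congr (_ *: _); apply: sep_eq => r r0.
  by rewrite (rdown_regular (Freg_regular gamma l.+1 z) (Freg_regular gamma l z) r0) mul0r addr0.
rewrite sep_lin scale0r addr0 scalerA; congr (_ *: _).
have aux (K : fieldType) (x : K) : 2 * (x + 1) + 1 != 0 -> (2 * (x + 1) + 1)^-1 * ((x + 1) * (2 * x + 3)) = x + 1.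
  by move=> x0; field.
by rewrite (natCS _ l); apply: aux; rewrite -(natCS _ l) (natC_odd_neq0 R l.+1 0).
Qed.

Lemma up_sing i h z : exists t : C,
  sep (rup gamma (sdeg h) (Gsing gamma (sdeg h) z)) (raise (sdeg h) i (spol h)) =
  Sol_fun ((cuS (sdeg h)).[z] *: ssol gamma (hraise i h) z + t *: rsol gamma (hraise i h) z).
Proof.
set l := sdeg h; set Q := raise _ _ _.
have [t ht] := rup_singular (Gsing_singular gamma l z) (Gsing_singular gamma l.+1 z) (Freg_regular gamma l.+1 z).
exists t; rewrite hornerC.
transitivity (sep (fun r => - (l.+1%:R * (2 * l%:R + 1)) * Gsing gamma l.+1 z r + t * Freg gamma l.+1 z r) Q).
  by apply: sep_eq => r r0; rewrite ht.
by rewrite sep_lin.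
Qed.

Lemma down_sing i h z : exists t : C,
  (2 * (sdeg h)%:R + 1)^-1 *: sep (rdown gamma (sdeg h) (Gsing gamma (sdeg h) z)) (D i (spol h)) =
  Sol_fun ((cdS (sdeg h)).[z] *: ssol gamma (hder i h) z + t *: rsol gamma (hder i h) z).
Proof.
suff [t ht] : exists t : C,
  (2 * (sdeg h)%:R + 1)^-1 *: sep (rdown gamma (sdeg h) (Gsing gamma (sdeg h) z)) (D i (spol h)) =
  (cdS (sdeg h)).[z] *: sep (Gsing gamma (sdeg h).-1 z) (D i (spol h))
   + t *: sep (Freg gamma (sdeg h).-1 z) (D i (spol h)) by exists t; rewrite ht.
have := sharm h; move: (sdeg h) (spol h) => [|l] P hP.
  by exists 0; rewrite homog0_D ?sep0 ?scaler0 ?addr0 //; case: hP.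
have [t ht] := rdown_singular (Gsing_singular gamma l.+1 z) (Gsing_singular gamma l z) (Freg_regular gamma l z).
exists ((2 * l.+1%:R + 1)^-1 * t); rewrite hornerZ horner_apol -scalerA.
transitivity ((2 * l.+1%:R + 1)^-1 *: sep (fun r => acoef gamma l z / ((2 * l%:R + 1) * l.+1%:R) * Gsing gamma l z r + t * Freg gamma l z r) (D i P)).
  by congr (_ *: _); apply: sep_eq => r r0; rewrite ht.
rewrite sep_lin scalerDr !scalerA; congr (_ *: _ + _).
have aux (K : fieldType) (x a y : K) : x^-1 * (a / y) = (x * y)^-1 * a.
  by rewrite invfM -mulrA [y^-1 * a]mulrC.
exact: aux.
Qed.

Definition gsum (M : lmodType {poly C}) (cu cd : nat -> {poly C}) (v : solid -> M) (X : lie_g C) h : M :=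
  \sum_i (X.1 i 0 *: v (hrot i h) + X.2 i 0 *: ('i%C%:P *: (cu (sdeg h) *: v (hraise i h) - cd (sdeg h) *: v (hder i h)))).

Lemma gop_sep (X : lie_g C) z u h : radial_solution gamma (sdeg h) z u ->
  gop gamma X z (sep u (spol h)) =
  \sum_i ((X.1 i 0).[z] *: sep u (rot i (spol h)) + (X.2 i 0).[z] *: ('i%C *:
    (sep (rup gamma (sdeg h) u) (raise (sdeg h) i (spol h))
     - (2 * (sdeg h)%:R + 1)^-1 *: sep (rdown gamma (sdeg h) u) (D i (spol h))))).
Proof.
move=> hu; apply: eq_bigr => i _; rewrite (angmom_sol i _ hu).
by rewrite (rungelenz_sep i hu (sharm h)).
Qed.

Lemma gact_gr (hR : HCfamily Rfam) (hR_act : regular_actions hR) X h :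
  gact hR X (gr h) = gsum cuR cdR gr X h.
Proof.
apply: rfun_inj => z.
have [/(_ X) e _] := hR_act (gr h) z (rfun (gr h) z) erefl.
rewrite -[LHS]/(Sol_fun (subval (subval (gact hR X (gr h)) z))) e rfun_gr (gop_sep _ (Freg_sol _ _ _)).
rewrite /gsum (big_morph (fun t => rfun t z) (fun _ _ => erefl) erefl).
apply: eq_bigr => i _; rewrite up_reg down_reg.
by rewrite rfunD !rfunZ rfunB !rfunZ !hornerC.
Qed.

Lemma gact_gs (hS : HCfamily Sfam) (hS_act : singular_actions hS) X h :
  gact hS X (gs h) = gsum cuS cdS gs X h.
Proof.
apply: sval_inj => z.
have [/(_ X) [psi e1 e2] _] := hS_act (gs h) z (Sol_fun (ssol gamma h z)) (ex_intro2 _ _ (ssol gamma h z) erefl erefl).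
rewrite -[LHS]/(subval (gact hS X (gs h)) z) e2 /gsum (big_morph (fun t => sval_at t z) (fun _ _ => erefl) erefl).
have [tu hu] := boolp.choice (fun i => up_sing i h z).
have [td hd] := boolp.choice (fun i => down_sing i h z).
(* A representative of the image with its regular parts, of unknown coefficients tu and td, kept
   explicit; the projection then removes them. *)
pose W i := (X.1 i 0).[z] *: ssol gamma (hrot i h) z + (X.2 i 0).[z] *: ('i%C *:
  (((cuS (sdeg h)).[z] *: ssol gamma (hraise i h) z + tu i *: rsol gamma (hraise i h) z)
  - ((cdS (sdeg h)).[z] *: ssol gamma (hder i h) z + td i *: rsol gamma (hder i h) z))).
have -> : psi = \sum_i W i.
  apply: val_inj; rewrite [LHS]e1 [LHS](gop_sep _ (Gsing_sol _ _ _)) -[RHS]/(Sol_fun _).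
  rewrite (big_morph (fun t : Sol gamma z => Sol_fun t) (fun _ _ => erefl) erefl).
  by apply: eq_bigr => i _; rewrite /W Sol_funD !Sol_funZ Sol_funB hu hd.
rewrite linear_sum; apply: eq_bigr => i _.
have q0 k : qproj (@reg_gen R gamma z) (rsol gamma k z) = 0.
  apply/eqP; rewrite -(linear0 (qproj _)) qproj_eq subr0; apply: linspan_gen; exact: rsol_gen.
have qE c k t : qproj (@reg_gen R gamma z) (c *: ssol gamma k z + t *: rsol gamma k z) = c *: sval_at (gs k) z.
  by rewrite linearD !linearZ /= q0 scaler0 addr0.
have qW a b c u v w : qproj (@reg_gen R gamma z) (a *: u + b *: (c *: (v - w))) =
    a *: qproj (@reg_gen R gamma z) u
    + b *: (c *: (qproj (@reg_gen R gamma z) v - qproj (@reg_gen R gamma z) w)).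
  exact: (linear_comb3 (@qproj C _ (@reg_gen R gamma z)) a b c u v w).
rewrite -[LHS]/(qproj (@reg_gen R gamma z) (W i)) /W qW !qE.
by rewrite svalD !svalZ svalB !svalZ !hornerC.
Qed.

Lemma cpol_cu l : cuS l * cpol gamma l.+1 = cpol gamma l * cuR l.
Proof.
rewrite /= /cuR /cuS /kcoef -!mul_polyC.
have aux (K : fieldType) (x : K) (c a : {poly K}) : x + 1 != 0 -> 2 * x + 1 != 0 -> 2 * x + 3 != 0 ->
   (- ((x + 1) * (2 * x + 1)))%:P * (c * ((((2 * x + 1) * (2 * x + 3) * (x + 1) ^+ 2)^-1)%:P * a)) =
   c * (((- ((2 * x + 3) * (x + 1)))^-1)%:P * a).
  move=> h1 h2 h3; rewrite mulrCA; congr (_ * _); rewrite mulrA -polyCM; congr (_%:P * _).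
  by field; rewrite oppr_eq0 mulf_neq0 ?h1 ?h2 ?h3.
rewrite (natCS _ l); apply: aux.
- by rewrite -(natCS _ l) natC_neq0.
- exact: (natC_odd_neq0 R l 0).
- exact: (natC_odd_neq0 R l 2).
Qed.

Lemma cpol_cd l : cdS l.+1 * cpol gamma l = cpol gamma l.+1 * cdR l.+1.
Proof.
rewrite /= /cdR /kcoef -!mul_polyC.
have aux (K : fieldType) (x : K) (c a : {poly K}) : x + 1 != 0 -> 2 * x + 1 != 0 -> 2 * x + 3 != 0 ->
   ((2 * (x + 1) + 1) * ((2 * x + 1) * (x + 1)))^-1%:P * a * c =
   (c * ((((2 * x + 1) * (2 * x + 3) * (x + 1) ^+ 2)^-1)%:P * a)) * (x + 1)%:P.
  move=> h1 h2 h3; have h4 : 2 * (x + 1) + 1 != 0 by rewrite (_ : _ + _ = 2 * x + 3) //; ring.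
  have -> : ((2 * (x + 1) + 1) * ((2 * x + 1) * (x + 1)))^-1 =
      ((2 * x + 1) * (2 * x + 3) * (x + 1) ^+ 2)^-1 * (x + 1) by field; rewrite h1 h2 h3.
  by rewrite polyCM; ring.
rewrite (natCS _ l); apply: aux.
- by rewrite -(natCS _ l) natC_neq0.
- exact: (natC_odd_neq0 R l 0).
- exact: (natC_odd_neq0 R l 2).
Qed.

Lemma gr_der0 i h : sdeg h = 0%N -> gr (hder i h) = 0.
Proof.
move=> h0; apply: rfun_inj => z; rewrite rfun_gr /=.
by have := sharm h; rewrite h0 => -[hh _]; rewrite homog0_D // sep0.
Qed.

Lemma Aop_gsum X h : Aop (gsum cuS cdS gs X h) = cpol gamma (sdeg h) *: gsum cuR cdR gr X h.
Proof.
pose f : {linear Sfam -> Rfam} := @Aop R gamma.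
have fgs k : f (gs k) = cpol gamma (sdeg k) *: gr k by exact: Aop_gs.
rewrite -[LHS]/(f _) /gsum linear_sum scaler_sumr; apply: eq_bigr => i _.
rewrite linear_comb4 !fgs -[sdeg (hraise i h)]/((sdeg h).+1) -[sdeg (hrot i h)]/(sdeg h).
rewrite (@comb4_scale _ _ _ _ _ _ _ (cpol gamma (sdeg h)) _ _ (cuR (sdeg h)) (cdR (sdeg h))) //.
  by rewrite cpol_cu.
rewrite -[sdeg (hder i h)]/((sdeg h).-1).
case E: (sdeg h) => [|l]; first by rewrite gr_der0 // !scaler0.
by rewrite !scalerA -[l.+1.-1]/l cpol_cd.
Qed.

Lemma Aop_gact (hS : HCfamily Sfam) (hS_act : singular_actions hS)
  (hR : HCfamily Rfam) (hR_act : regular_actions hR) X s :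
  Aop (gact hS X s) = gact hR X (Aop s).
Proof.
have [f fE] := Alin_exists gamma.
have [gS gSE] := linear_packed (gact_linearr hS X).
have [gR gRE] := linear_packed (gact_linearr hR X).
rewrite -[s]symSE -!fE -gSE -gRE /evS !linear_sum; apply: eq_bigr => t _.
rewrite !linearZ; congr (_ *: _).
by rewrite fE gSE gRE fE Aop_gs (gact_gs hS_act) Aop_gsum -gRE linearZ gRE (gact_gr hR_act).
Qed.

End LieAction.

(** * Zariski density of the real orthogonal group *)

Section OrthogonalDensity.

Lemma det_mx3 (F : comNzRingType) (A : 'M[F]_3) (a := fun m n => A (inord m) (inord n)) :
  \det A = a 0%N 0%N * (a 1%N 1%N * a 2%N 2%N - a 1%N 2%N * a 2%N 1%N)
         - a 0%N 1%N * (a 1%N 0%N * a 2%N 2%N - a 1%N 2%N * a 2%N 0%N)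
         + a 0%N 2%N * (a 1%N 0%N * a 2%N 1%N - a 1%N 1%N * a 2%N 0%N).
Proof.
have aE i j : A i j = a (val i) (val j) by rewrite /a !inord_val.
rewrite (expand_det_row _ 0) !big_ord_recl big_ord0 /cofactor !(expand_det_row _ 0).
rewrite !big_ord_recl !big_ord0 /cofactor !det_mx11 !mxE !aE /= /bump /=.
by rewrite !add0n !addn0 !add1n; ring.
Qed.

Definition sgn_mx (F : nzRingType) (s : 'I_3 -> bool) : 'M[F]_3 := diag_mx (\row_i (-1) ^+ s i).

(** The Cayley transform excludes k with eigenvalue -1, and a sign matrix avoids this. The
    determinant is affine in each of the three signs with top coefficient 1, so its sum over the
    eight choices, weighted by the product of the signs, is 8. *)
Lemma sgn_shift (F : numFieldType) (k : 'M[F]_3) : exists s, \det (sgn_mx F s + k) != 0.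
Proof.
apply: contrapT => h.
have h0 a b c : \det (sgn_mx F (fun i => nth false [:: a; b; c] i) + k) = 0.
  by apply/eqP/negP => /negP n; apply: h; eexists; exact: n.
have eD (b1 b2 b3 : bool) (m n : nat) : (m < 3)%N -> (n < 3)%N ->
  (sgn_mx F (fun i => nth false [:: b1; b2; b3] i) + k) (inord m) (inord n) =
   (if m == n then (-1) ^+ nth false [:: b1; b2; b3] m else 0) + k (inord m) (inord n).
  move=> m3 n3; rewrite !mxE -val_eqE /= (inordK m3) (inordK n3).
  by case: eqP => [->|]; rewrite ?mulr1n ?mulr0n.
have aux (x11 x12 x13 x21 x22 x23 x31 x32 x33 : F)
   (d := fun a b c => (a + x11) * ((b + x22) * (c + x33) - x23 * x32)
       - x12 * (x21 * (c + x33) - x23 * x31) + x13 * (x21 * x32 - (b + x22) * x31)) :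
   (forall a b c : bool, d ((-1) ^+ a) ((-1) ^+ b) ((-1) ^+ c) = 0) -> False.
  move=> e; have : d 1 1 1 - d 1 1 (-1) - d 1 (-1) 1 - d (-1) 1 1
     + d 1 (-1) (-1) + d (-1) 1 (-1) + d (-1) (-1) 1 - d (-1) (-1) (-1) = 8%:R by rewrite /d; ring.
  rewrite (e false false false) (e false false true) (e false true false) (e true false false).
  rewrite (e false true true) (e true false true) (e true true false) (e true true true).
  by rewrite !subr0 !addr0 => /esym/eqP; rewrite pnatr_eq0.
apply: (aux (k (inord 0) (inord 0)) (k (inord 0) (inord 1)) (k (inord 0) (inord 2))
  (k (inord 1) (inord 0)) (k (inord 1) (inord 1)) (k (inord 1) (inord 2))
  (k (inord 2) (inord 0)) (k (inord 2) (inord 1)) (k (inord 2) (inord 2))) => a b c.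
by have := h0 a b c; rewrite det_mx3 !eD //= !add0r.
Qed.

Lemma sgn_mx_sqr (F : comNzRingType) s : sgn_mx F s *m sgn_mx F s = 1%:M.
Proof.
rewrite mulmx_diag; apply/matrixP => i j; rewrite !mxE -expr2 -exprM mulnC exprM.
by rewrite sqrrN expr1n expr1n.
Qed.

Lemma sgn_mxT (F : nzRingType) s : (sgn_mx F s)^T = sgn_mx F s.
Proof. exact: tr_diag_mx. Qed.

(** If v + vS = 0 then v v^T = - v S v^T = 0 by skewness, and a vanishing sum of squares forces v =
    0. This argument needs real entries. *)
Lemma skew_shift_unit (F : realFieldType) n (S : 'M[F]_n) : S^T = - S -> 1%:M + S \in unitmx.
Proof.
move=> sk; rewrite -row_free_unit; apply: inj_row_free => v.
rewrite mulmxDr mulmx1 => hv.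
have vS0 : v *m S *m v^T = 0.
  have e : (v *m S *m v^T)^T = - (v *m S *m v^T).
    by rewrite !trmx_mul trmxK sk mulmxA mulmxN mulNmx.
  have e2 : (v *m S *m v^T)^T = v *m S *m v^T by apply/matrixP => i j; rewrite !ord1 mxE.
  move: (v *m S *m v^T) e e2 => x e e2; have e3 : x = - x by rewrite -{1}e2 e.
  by apply/matrixP => i j; have := congr1 (fun M : 'M[F]_1 => M i j) e3; rewrite !mxE; lra.
have : v *m v^T = 0 by rewrite -[LHS]addr0 -vS0 -mulmxDl hv mul0mx.
move/matrixP/(_ 0 0); rewrite !mxE => /eqP.
rewrite psumr_eq0 => [/allP h|i _]; last by rewrite mxE -expr2 sqr_ge0.
apply/rowP => i; have := h i (mem_index_enum _).
by rewrite !mxE -expr2 sqrf_eq0 => /eqP.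
Qed.

Lemma cayley_orth (F : fieldType) (S : 'M[F]_3) : S^T = - S -> 1%:M + S \in unitmx ->
  orthogonal_mx ((1%:M - S) *m invmx (1%:M + S)).
Proof.
move=> sk u; have t1 : (1%:M + S)^T = 1%:M - S by rewrite linearD /= trmx1 sk.
have t2 : (1%:M - S)^T = 1%:M + S by rewrite linearB /= trmx1 sk opprK.
have u' : 1%:M - S \in unitmx by rewrite -t1 unitmx_tr.
have cm : (1%:M + S) *m (1%:M - S) = (1%:M - S) *m (1%:M + S).
  by rewrite mulmxBr mulmx1 mulmxDl mul1mx mulmxDr mulmx1 mulmxDl mul1mx mulNmx opprD.
apply/eqP; rewrite trmx_mul trmx_inv t1 t2 mulmxA -[_ *m (1%:M + S) *m _]mulmxA cm.
by rewrite mulmxA mulVmx // mul1mx mulmxV.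
Qed.

(* A complex orthogonal k is, up to a diagonal sign matrix, the Cayley transform
   of a skew matrix b + i c with b, c real. On the curve of the transforms of
   b + t c, a polynomial vanishing at the real orthogonal matrices vanishes for
   all real t, hence, being rational in t, at t = i. *)
Lemma mpoly_curve (F : fieldType) n (p : mpoly.mpoly n F) (v : 'I_n -> {poly F}) (d : {poly F}) :
  exists q m, forall t, d.[t] != 0 ->
    q.[t] = d.[t] ^+ m * mpoly.meval (fun i => (v i).[t] / d.[t]) p.
Proof.
elim/mpoly_ring_ind: p => [c|i|P Q [q [m hq]] [q' [m' hq']]|P Q [q [m hq]] [q' [m' hq']]].
- by exists c%:P, 0%N => t _; rewrite mpoly.mevalC hornerC mul1r.
- by exists (v i), 1%N => t d0; rewrite mpoly.mevalXU mulrC divfK.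
- exists (q * d ^+ m' + q' * d ^+ m), (m + m')%N => t d0.
  rewrite hornerD !hornerM !horner_exp hq // hq' // mpoly.mevalD exprD; ring.
- exists (q * q'), (m + m')%N => t d0.
  by rewrite hornerM hq // hq' // mpoly.mevalM exprD; ring.
Qed.

Lemma cayley_inv (F : fieldType) (k : 'M[F]_3) : 2%:R != 0 :> F -> orthogonal_mx k ->
  1%:M + k \in unitmx ->
  exists S, [/\ S^T = - S, 1%:M + S \in unitmx & k = (1%:M - S) *m invmx (1%:M + S)].
Proof.
move=> n2 /eqP kTk uM; set M := 1%:M + k in uM *; exists ((1%:M - k) *m invmx M); set S := _ *m _.
have kkT : k *m k^T = 1%:M by exact: mulmx1C.
have SM : S *m M = 1%:M - k by rewrite /S mulmxKV.
have cm : M *m (1%:M - k) = (1%:M - k) *m M.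
  by rewrite /M mulmxBr mulmx1 mulmxDl mul1mx mulmxDr mulmx1 mulmxDl mul1mx mulNmx opprD.
have MS : M *m S = 1%:M - k by rewrite /S mulmxA cm mulmxK.
have MST : M *m S^T = - (1%:M - k).
  have e : M^T *m S^T = 1%:M - k^T by rewrite -trmx_mul SM linearB /= trmx1.
  have MT : k *m M^T = M by rewrite /M linearD /= trmx1 mulmxDr mulmx1 kkT addrC.
  by rewrite -MT -mulmxA e mulmxBr mulmx1 kkT opprB.
have sk : S^T = - S.
  by rewrite -[S^T](mulKmx uM) MST -MS -mulmxN mulKmx.
have e1 : (1%:M + S) *m M = 2%:R%:M.
  by rewrite mulmxDl mul1mx SM /M addrACA subrr addr0 -raddfD.
have e2 : (1%:M - S) *m M = 2%:R *: k.
  by rewrite mulmxBl mul1mx SM /M opprB addrC addrA subrK scaler_nat mulr2n.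
have e3 : (1%:M + S) *m (2%:R^-1 *: M) = 1%:M.
  by rewrite -scalemxAr e1 scale_scalar_mx mulVf.
have [u1 _] := mulmx1_unit e3.
have e4 : invmx (1%:M + S) = 2%:R^-1 *: M.
  by rewrite -[RHS](mulKmx u1) e3 mulmx1.
by split=> //; rewrite e4 -scalemxAr e2 scalerA mulVf // scale1r.
Qed.

(** The inverse is the adjugate over the determinant, both polynomial in t, so d clears all
    denominators along the curve. *)
Lemma cayley_curve (F : fieldType) n (D b c : 'M[F]_n) :
  exists (P : 'M[{poly F}]_n) (d : {poly F}), forall t,
    d.[t] = \det (1%:M + (b + t *: c)) /\
    (d.[t] != 0 -> D *m ((1%:M - (b + t *: c)) *m invmx (1%:M + (b + t *: c))) =
                   \matrix_(i, j) ((P i j).[t] / d.[t])).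
Proof.
pose S := map_mx polyC b + 'X *: map_mx polyC c.
pose P := map_mx polyC D *m ((1%:M - S) *m \adj (1%:M + S)).
exists P, (\det (1%:M + S)) => t.
have hC k m (A : 'M[F]_(k, m)) : map_mx (horner_eval t) (map_mx polyC A) = A.
  by apply/matrixP => i j; rewrite !mxE /horner_eval hornerC.
have hS : map_mx (horner_eval t) S = b + t *: c.
  by rewrite /S map_mxD hC map_mxZ hC /= /horner_eval hornerX.
have hd : (\det (1%:M + S)).[t] = \det (1%:M + (b + t *: c)).
  by rewrite -[LHS]/(horner_eval t _) -det_map_mx map_mxD map_mx1 hS.
split=> // d0; set N := 1%:M + (b + t *: c) in hd *.
have Nu : N \in unitmx by rewrite unitmxE -hd unitfE.
have -> : invmx N = (\det (1%:M + S)).[t]^-1 *: \adj N by rewrite /invmx Nu hd.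
rewrite -!scalemxAr; have -> : D *m ((1%:M - (b + t *: c)) *m \adj N) = map_mx (horner_eval t) P.
  by rewrite /P !map_mxM hC map_mxB map_mx1 hS map_mx_adj map_mxD map_mx1 hS.
by apply/matrixP => i j; rewrite !mxE mulrC.
Qed.

Lemma orthogonal_dense (R : realType) (p : mpoly.mpoly (3 * 3) R[i]) :
  (forall A : 'M[R]_3, orthogonal_mx A -> mxpoly_eval p (mxC A) = 0) ->
  forall k, orthogonal_mx k -> mxpoly_eval p k = 0.
Proof.
move=> hp k /eqP ok; have [s hs] := sgn_shift k.
pose D := sgn_mx R[i] s; have DD : D *m D = 1%:M by exact: sgn_mx_sqr.
have DT : D^T = D by exact: sgn_mxT.
have ok' : orthogonal_mx (D *m k).
  by apply/eqP; rewrite trmx_mul DT mulmxA -[_ *m D *m D]mulmxA DD mulmx1.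
have uD : 1%:M + D *m k \in unitmx.
  have -> : 1%:M + D *m k = D *m (D + k) by rewrite mulmxDr DD.
  rewrite unitmx_mul unitmxE unitfE; apply/andP; split.
    by have [] := mulmx1_unit DD; rewrite unitmxE unitfE.
  by rewrite unitmxE unitfE.
have [|S [sk uS ek]] := cayley_inv _ ok' uD; first by rewrite pnatr_eq0.
have {ek} ek : k = D *m ((1%:M - S) *m invmx (1%:M + S)).
  by rewrite -ek mulmxA DD mul1mx.
pose b : 'M[R]_3 := map_mx (@complex.Re R) S; pose c : 'M[R]_3 := map_mx (@complex.Im R) S.
have Sbc : S = mxC b + 'i%C *: mxC c.
  by apply/matrixP => i j; rewrite !mxE; case: (S i j) => x y; apply/eqP; rewrite eq_complex /= !mul0r !mul1r ?subr0 ?add0r ?addr0 !eqxx.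
have skS i j : S j i = - S i j by have := congr1 (fun M : 'M[R[i]]_3 => M i j) sk; rewrite !mxE.
have skb : b^T = - b by apply/matrixP => i j; rewrite !mxE skS raddfN.
have skc : c^T = - c by apply/matrixP => i j; rewrite !mxE skS raddfN.
have [P [d hd]] := cayley_curve D (mxC b) (mxC c).
have [q [m hq]] := mpoly_curve p (fun i => mxvec P 0 i) d.
have ev t : d.[t] != 0 -> q.[t] = d.[t] ^+ m *
    mxpoly_eval p (D *m ((1%:M - (mxC b + t *: mxC c)) *m invmx (1%:M + (mxC b + t *: mxC c)))).
  move=> d0; rewrite hq //; congr (_ * _); rewrite ((hd t).2 d0) /mxpoly_eval.
  by apply: mpoly.meval_eq => i; case/mxvec_indexP: i => i j; rewrite !mxvecE mxE.
have q0 : q = 0.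
  apply: poly_nat_eq0 => n; pose Sn := b + n%:R *: c.
  have eS : mxC b + n%:R *: mxC c = mxC Sn.
    by rewrite /mxC map_mxD map_mxZ rmorph_nat.
  have skn : Sn^T = - Sn by rewrite linearD linearZ /= skb skc opprD scalerN.
  have un := skew_shift_unit skn.
  have dn : d.[n%:R] != 0.
    rewrite (hd _).1 eS -(map_mx1 (real_complex R)) -map_mxD det_map_mx fmorph_eq0.
    by rewrite -unitfE -unitmxE.
  rewrite ev // eS -(map_mx1 (real_complex R)) -map_mxD -map_mxB -map_invmx -map_mxM.
  have -> : D = mxC (sgn_mx R s).
    by apply/matrixP => i j; rewrite !mxE rmorphMn rmorphXn rmorphN rmorph1.
  rewrite -map_mxM hp ?mulr0 //; apply/eqP; have /eqP o := cayley_orth skn un.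
  by rewrite trmx_mul sgn_mxT mulmxA -[_ *m sgn_mx _ _ *m sgn_mx _ _]mulmxA sgn_mx_sqr mulmx1.
have di : d.['i%C] != 0 by rewrite (hd _).1 -Sbc -unitfE -unitmxE.
have := ev 'i%C di; rewrite q0 horner0 -Sbc -ek => /esym/eqP.
by rewrite mulf_eq0 expf_eq0 (negbTE di) andbF => /eqP.
Qed.

End OrthogonalDensity.

(** * Equivariance under the orthogonal group *)

Section GroupAction.
Variables (R : realType) (gamma : R).
Notation C := R[i].
Notation solid := (solid R).
Notation Rfam := (regular_family gamma).
Notation Sfam := (singular_family gamma).
Notation gr := (@gr R gamma).
Notation gs := (@gs R gamma).
Implicit Types (h : solid) (z : C) (A : 'M[R]_3).

Definition hcomp A (oA : orthogonal_mx A) h :=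
  Solid (harm_compM (mxC_orth (real_act_orth oA).2) (sharm h)).

Lemma kact_gr (hR : HCfamily Rfam) (hR_act : regular_actions hR) A (oA : orthogonal_mx A) h :
  kact hR (mxC A) (gr h) = gr (hcomp oA h).
Proof.
apply: rfun_inj => z; have [_ /(_ A oA) e] := hR_act (gr h) z (rfun (gr h) z) erefl.
by rewrite -[LHS]/(Sol_fun (subval (subval (kact hR (mxC A) (gr h)) z))) e !rfun_gr fun_act_sep.
Qed.

Lemma kact_gs (hS : HCfamily Sfam) (hS_act : singular_actions hS) A (oA : orthogonal_mx A) h :
  kact hS (mxC A) (gs h) = gs (hcomp oA h).
Proof.
apply: sval_inj => z.
have [_ /(_ A oA) [psi e1 e2]] :=
  hS_act (gs h) z (Sol_fun (ssol gamma h z)) (ex_intro2 _ _ (ssol gamma h z) erefl erefl).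
rewrite -[LHS]/(subval (kact hS (mxC A) (gs h)) z) e2 -[RHS]/(qproj _ (ssol gamma (hcomp oA h) z)).
congr (qproj _ _); apply: val_inj; rewrite [LHS]e1.
exact: fun_act_sep.
Qed.

Lemma mxC_orthogonal A : orthogonal_mx A -> orthogonal_mx (mxC A).
Proof.
move=> /eqP o; apply/eqP; have -> : (mxC A)^T = mxC A^T by apply/matrixP => i j; rewrite !mxE.
by rewrite /mxC -map_mxM o map_mx1.
Qed.

Lemma Aop_kact_real (hS : HCfamily Sfam) (hS_act : singular_actions hS)
  (hR : HCfamily Rfam) (hR_act : regular_actions hR) A s : orthogonal_mx A ->
  Aop (kact hS (mxC A) s) = kact hR (mxC A) (Aop s).
Proof.
move=> oA; have oC := mxC_orthogonal oA.
have [f fE] := Alin_exists gamma.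
have [gS gSE] := linear_packed (kact_linear hS oC).
have [gR gRE] := linear_packed (kact_linear hR oC).
rewrite -[s]symSE -!fE -gSE -gRE /evS !linear_sum; apply: eq_bigr => t _.
rewrite !linearZ; congr (_ *: _); rewrite fE gSE gRE fE Aop_gs (kact_gs hS_act oA) Aop_gs.
by rewrite -gRE linearZ gRE (kact_gr hR_act oA).
Qed.

(** Algebraicity of the action in the form that density requires: along the orbit of one vector the
    coefficients are polynomials in the matrix entries. *)
Lemma kact_poly (M : lmodType {poly C}) (hM : HCfamily M) m : exists n (e : 'I_n -> M)
  (q : 'I_n -> mpoly.mpoly (3 * 3) C),
  forall k, orthogonal_mx k -> kact hM k m = \sum_i (mxpoly_eval (q i) k)%:P *: e i.
Proof.
have [n [e [rho [he [c ->]]]]] := kact_algebraic hM m.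
exists n, e, (fun i => \sum_j c j *: rho i j) => k ok.
have [g gE] := linear_packed (kact_linear hM ok).
rewrite -gE linear_sum.
transitivity (\sum_j \sum_i ((c j)%:P * (algebraic_mx rho k i j)%:P) *: e i).
  apply: eq_bigr => j _; rewrite linearZ_LR gE (he k ok) scaler_sumr.
  by apply: eq_bigr => i _; rewrite scalerA.
rewrite exchange_big; apply: eq_bigr => i _.
rewrite /mxpoly_eval (big_morph (mpoly.meval _) (mpoly.mevalD _) (mpoly.meval0 _)).
rewrite (big_morph polyC (@polyCD C) (erefl _)) scaler_suml.
by apply: eq_bigr => j _; rewrite mpoly.mevalZ polyCM mxE.
Qed.

Lemma Aop_kact (hS : HCfamily Sfam) (hS_act : singular_actions hS)
  (hR : HCfamily Rfam) (hR_act : regular_actions hR) k s : orthogonal_mx k ->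
  Aop (kact hS k s) = kact hR k (Aop s).
Proof.
move=> ok; have [n [e [q hq]]] := kact_poly hS s.
have [n' [e' [q' hq']]] := kact_poly hR (Aop s).
have [f fE] := Alin_exists gamma.
apply: rfun_inj => z; apply/funext => x.
have rsum m (F : 'I_m -> Rfam) : rfun (\sum_i F i) z x = \sum_i rfun (F i) z x.
  by rewrite (big_morph (fun t => rfun t z) (fun _ _ => erefl) erefl) fct_sumE.
have rZ c (t : Rfam) : rfun (c%:P *: t) z x = c * rfun t z x by rewrite rfunZ hornerC.
(* For fixed z and x, the value at x of the failure of equivariance is a polynomial in the entries
   of k; it vanishes at real points, hence on the complex group. *)
pose p := \sum_i rfun (f (e i)) z x *: q i - \sum_i rfun (e' i) z x *: q' i.
have hp k' : orthogonal_mx k' -> mxpoly_eval p k' =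
    rfun (Aop (kact hS k' s)) z x - rfun (kact hR k' (Aop s)) z x.
  move=> ok'; rewrite (hq _ ok') (hq' _ ok') -fE linear_sum !rsum /p /mxpoly_eval mpoly.mevalB.
  rewrite !(big_morph (mpoly.meval _) (mpoly.mevalD _) (mpoly.meval0 _)).
  congr (_ - _); apply: eq_bigr => i _; rewrite mpoly.mevalZ mulrC; last by rewrite rZ.
  by rewrite linearZ -[RHS]/(rfun (_%:P *: _) z x) rZ.
apply/eqP; rewrite -subr_eq0 -hp //; apply/eqP; apply: orthogonal_dense ok => A oA.
rewrite hp ?mxC_orthogonal // (Aop_kact_real hS_act hR_act) ?subrr //.
Qed.

End GroupAction.

(** * Uniqueness *)

Lemma linear_comb2 (K : pzRingType) (V W : lmodType K) (f : {linear V -> W}) (a b : K) (u v : V) :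
  f (a *: u + b *: v) = a *: f u + b *: f v.
Proof. by rewrite linearD !linearZ. Qed.

Lemma scaleC (K : comPzRingType) (V : lmodType K) (a b : K) (v : V) : a *: (b *: v) = b *: (a *: v).
Proof. by rewrite !scalerA mulrC. Qed.

Section GenericBijectivity.
Variables (D : idomainType) (M N : lmodType D) (A : {linear M -> N}).

(** Localization preserves injectivity, and surjectivity up to nonzero denominators becomes
    surjectivity. *)
Lemma genmap_bijective : injective A ->
  (forall n : N, exists d m, d != 0 /\ A m = d *: n) -> bijective (genmap A).
Proof.
move=> injA surjA.
have gi : injective (genmap A).
  elim/genW=> m d d0; elim/genW=> m' d' d0'; rewrite !genmapE => /genmk_eqP[s s0 e].
  by apply: genmk_eq; exists s => //; apply: injA; rewrite !linearZ_LR.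
have gs : forall y, exists x, genmap A x = y.
  elim/genW=> n d d0; have [e [m [e0 em]]] := surjA n.
  exists (genmk m (mulf_neq0 e0 d0)); rewrite genmapE; apply: genmk_eq.
  by exists 1; rewrite ?oner_eq0 // em !mul1r scalerA mulrC.
have [g hg] := boolp.choice gs.
by exists g => // x; apply: gi; rewrite hg.
Qed.

End GenericBijectivity.

(** In positive degree the Casimir eigenvalue is nonzero, so a harmonic polynomial is recovered from
    its double rotations. *)
Lemma harm_rot_eq0 (K : numFieldType) l (P : mpoly.mpoly 3 K) w : harm l.+1 P ->
  (forall i, mpoly.meval w (rot i (rot i P)) = 0) -> mpoly.meval w P = 0.
Proof.
move=> hP h; have := congr1 (mpoly.meval w) (casimir hP).
rewrite ev_sum big1 // mpoly.mevalN mpoly.mevalM rmorph_nat => /esym/eqP.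
by rewrite oppr_eq0 mulf_eq0 pnatr_eq0 => /eqP.
Qed.

Lemma homog0_const (K : numFieldType) (P : mpoly.mpoly 3 K) : harm 0 P ->
  exists c, P = mpoly.mpolyC 3 c.
Proof.
move=> [/mpoly.dhomogP hP _]; exists (mpoly.mcoeff mpoly.mnm0 P).
apply/mpoly.mpolyP => m; rewrite mpoly.mcoeffC.
have [->|m0] := eqVneq m mpoly.mnm0; first by rewrite mulr1.
rewrite mulr0; apply: contraTeq m0 => h.
have := hP m; rewrite mpoly.mcoeff_msupp h => /(_ isT) /eqP.
by rewrite negbK mpoly.mdeg_eq0.
Qed.

Lemma harm_const (K : numFieldType) (c : K) : harm 0 (mpoly.mpolyC 3 c).
Proof.
split.
  by rewrite -[mpoly.mpolyC 3 c](mulr1) mpoly.mul_mpolyC; apply: rpredZ; exact: mpoly.dhomog1.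
by rewrite /lapl big1 // => i _; rewrite mpoly.mderivC linear0.
Qed.

Section Uniqueness.
Variables (R : realType) (gamma : R).
Notation C := R[i].
Notation solid := (solid R).
Notation symbol := (symbol R).
Notation evR := (@evR R gamma).
Notation evS := (@evS R gamma).
Notation Rfam := (regular_family gamma).
Notation Sfam := (singular_family gamma).
Notation gr := (@gr R gamma).
Notation gs := (@gs R gamma).
Notation Alin := (Alin gamma).
Implicit Types (h : solid) (z : C) (i : 'I_3) (sg : symbol).

Lemma Alin_genmap_bij : bijective (genmap Alin).
Proof.
apply: genmap_bijective; first by move=> s s'; rewrite !AlinE; exact: Aop_inj.
move=> n; have [sg ->] := evR_surj n; rewrite /evR; elim: sg => [|t sg [d [m [d0 e]]]].
  by exists 1, 0; rewrite oner_eq0 big_nil scaler0 linear0.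
(* The denominators accumulate: each generator contributes the factor by which the operator
   multiplies it. *)
exists (cpol gamma (sdeg t.2) * d), ((t.1 * d) *: gs t.2 + cpol gamma (sdeg t.2) *: m).
split; first by rewrite mulf_neq0 // cpol_neq0.
rewrite (linear_comb2 Alin) e AlinE Aop_gs big_cons scalerDr !scalerA.
have mACB (K : comPzRingType) (a b c : K) : a * b * c = c * b * a by ring.
by rewrite [t.1 * d * _]mACB.
Qed.

Definition hone : solid := Solid (harm_const (1 : C)).

(** Evaluation at z kills multiples of X - z, hence factors through the fibre. A nonzero value
    therefore detects a nonzero element of the fibre. *)
Lemma rfun_fibre (t : Rfam) z : qproj (range (fun m : Rfam => ('X - z%:P) *: m)) t = 0 -> rfun t z = 0.
Proof.
move=> e; have : t - 0 \in linspan (range (fun m : Rfam => ('X - z%:P) *: m)).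
  by rewrite -qproj_eq e linear0.
rewrite subr0 => /asboolP[n [a [c [ha ->]]]].
rewrite (big_morph (fun t => rfun t z) (fun _ _ => erefl) erefl) big1 // => i _.
by have [m _ <-] := ha i; rewrite !rfunZ hornerXsubC subrr scale0r scaler0.
Qed.

Lemma gr_one_neq0 z : rfun (gr hone) z <> 0.
Proof.
rewrite rfun_gr /= => e; apply: (regular_not0 (Freg_regular gamma 0 z)) => r r0.
have x0 : const_mx 1 != 0 :> 'cV[R]_3.
  by apply/eqP => /matrixP/(_ 0 0); rewrite !mxE => /eqP; rewrite oner_eq0.
have [y [ey _]] := point_of_norm (exist (fun v : 'cV[R]_3 => v != 0) _ x0) r0.
have := congr1 (fun f : punctured R -> C => f y) e.
by rewrite sepE ey mpoly.mevalC mulr1.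
Qed.

Lemma Alin_fibre z : exists x, fibre_map Alin z x != 0.
Proof.
exists (qproj _ (gs hone)); apply/eqP; rewrite fibre_mapE AlinE Aop_gs scale1r => /rfun_fibre.
exact: gr_one_neq0.
Qed.

(** Linearity of [gs] in the harmonic polynomial, stated for finite sums because the degree is part
    of a [solid]. The case n = 0 gives the vanishing of [gs] on the zero polynomial. *)
Lemma gs_sum n (k : 'I_n -> solid) (c : 'I_n -> C) h :
  (forall j, sdeg (k j) = sdeg h) -> spol h = \sum_j c j *: spol (k j) ->
  gs h = \sum_j (c j)%:P *: gs (k j).
Proof.
move=> hk e; pose sg : symbol := [seq ((c j)%:P, k j) | j <- enum 'I_n].
have eS : evS sg = \sum_j (c j)%:P *: gs (k j) by rewrite /evS big_map big_enum.
have eS0 : evS ((-1, h) :: sg) = 0.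
  apply/evS_eq0P => z l; rewrite /scomp big_cons /= big_map big_enum_cond /=.
  under eq_bigl do rewrite hk; under eq_bigr do rewrite hornerC.
  case: eqP => _; last by rewrite big_pred0 //; exact: sph0_0.
  by rewrite -e hornerN hornerC scaleN1r addNr; exact: sph0_0.
rewrite -eS; apply/eqP; rewrite eq_sym -subr_eq0; apply/eqP; rewrite -eS0.
by rewrite /evS big_cons scaleN1r addrC.
Qed.

Definition Lgen i : lie_g C := (delta_mx i 0, 0).
Definition Rgen i : lie_g C := (0, delta_mx i 0).

Lemma gsum_L (M : lmodType {poly C}) cu cd (v : solid -> M) i h :
  gsum cu cd v (Lgen i) h = v (hrot i h).
Proof.
rewrite /gsum (bigD1 i) //= big1 => [|j ji]; last first.
  by rewrite !mxE (negbTE ji) scale0r scale0r addr0.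
by rewrite !mxE !eqxx scale1r scale0r !addr0.
Qed.

Lemma gsum_R (M : lmodType {poly C}) cu cd (v : solid -> M) i h :
  gsum cu cd v (Rgen i) h =
  'i%C%:P *: (cu (sdeg h) *: v (hraise i h) - cd (sdeg h) *: v (hder i h)).
Proof.
rewrite /gsum (bigD1 i) //= big1 => [|j ji]; last first.
  by rewrite !mxE (negbTE ji) scale0r scale0r addr0.
by rewrite !mxE !eqxx scale1r scale0r add0r addr0.
Qed.

(* Contracting the Runge-Lenz operators with the gradient of a solid harmonic
   generates the singular family from its degree 0 part. *)
Lemma rungelenz_generates (hS : HCfamily Sfam) (hS_act : singular_actions hS) h l :
  sdeg h = l.+1 -> exists2 c : C, c != 0 &
  c%:P *: gs h = \sum_i gact hS (Rgen i) (gs (hder i h)).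
Proof.
move=> hl; exists ('i%C * (- (l.+1%:R * (2 * l%:R + 1)) * l.+1%:R)).
  rewrite !mulf_neq0 ?oppr_eq0 ?natC_neq0 ?mulf_neq0 ?natC_neq0 //.
  by rewrite eq_complex /= oner_eq0 andbF.
have dl i : sdeg (hder i h) = l by rewrite /= hl.
have e1 : gs h = \sum_i (l.+1%:R^-1)%:P *: gs (hraise i (hder i h)).
  apply: gs_sum => [i|]; first by rewrite /= hl.
  rewrite -scaler_sumr /= hl /=; have := sharm h; rewrite hl => /sum_raise_deriv->.
  by rewrite scalerA mulVf ?natC_neq0 // scale1r.
(* The lowering terms add up to the section of the Laplacian of the harmonic polynomial, which is
   zero; only the raising terms survive the contraction. *)
have e2 : \sum_i gs (hder i (hder i h)) = 0.
  pose h0 := Solid (harm0 C l.-1).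
  have g0 : gs h0 = 0 by rewrite (@gs_sum 0 (fun=> h0) (fun=> 0) h0) ?big_ord0.
  transitivity (\sum_i (1 : C)%:P *: gs (hder i (hder i h))); first by apply: eq_bigr => i _; rewrite scale1r.
  rewrite -(@gs_sum 3 (fun i => hder i (hder i h)) (fun=> 1) h0) //= => [i|]; first by rewrite hl.
  by have [_ e] := sharm h; rewrite -[LHS]e; apply: eq_bigr => i _; rewrite scale1r.
transitivity (\sum_i 'i%C%:P *: (cuS R l *: gs (hraise i (hder i h)) - cdS gamma l *: gs (hder i (hder i h)))); last first.
  by apply: eq_bigr => i _; rewrite (gact_gs hS_act) gsum_R dl.
rewrite -scaler_sumr sumrB -!scaler_sumr e2 scaler0 subr0 {1}e1 -scaler_sumr scalerA scalerA.
congr (_ *: _); rewrite -!polyCM /cuS; congr (_%:P).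
by rewrite -!mulrA mulfV ?natC_neq0 ?mulr1.
Qed.

Section Intertwiner.
Variables (hS : HCfamily Sfam) (hS_act : singular_actions hS).
Variables (hR : HCfamily Rfam) (hR_act : regular_actions hR).
Variable B : {linear Sfam -> Rfam}.
Hypothesis hB : forall X s, B (gact hS X s) = gact hR X (B s).

Lemma gact_evR X sg : gact hR X (evR sg) = \sum_(t <- sg) t.1 *: gsum (cuR gamma) (@cdR R) gr X t.2.
Proof.
have [g gE] := linear_packed (gact_linearr hR X).
rewrite -gE /evR linear_sum; apply: eq_bigr => t _.
by rewrite linearZ_LR gE (gact_gr hR_act).
Qed.

Lemma gs_const_rot i : gs (hrot i hone) = 0.
Proof.
rewrite (@gs_sum 0 (fun=> hone) (fun=> 0)) ?big_ord0 //.
by rewrite /= /rot !mpoly.mderivC !mulr0 subrr.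
Qed.

Lemma intertwiner_one : exists p, B (gs hone) = p *: gr hone.
Proof.
have [sg e] := evR_surj (B (gs hone)).
have rot0 i : evR [seq (t.1, hrot i t.2) | t <- sg] = 0.
  have : gact hR (Lgen i) (B (gs hone)) = 0.
    by rewrite -hB (gact_gs hS_act) gsum_L gs_const_rot linear0.
  rewrite e gact_evR => E; rewrite -[RHS]E /evR big_map; apply: eq_bigr => t _.
  by rewrite gsum_L.
have srot i z l : sph0 (rot i (scomp sg z l)).
  have /evR_eq0P/(_ z l) := rot0 i; rewrite /scomp big_map /=; congr sph0.
  rewrite /rot !(big_morph (@mpoly.mderiv 3 C _) (mpoly.mderivD _) (mpoly.mderiv0 _ _)).
  rewrite !mulr_sumr -sumrB; apply: eq_bigr => t _.
  by rewrite !mpoly.mderivZ -!scalerAr -scalerBr.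
(* The component of degree 0 is a constant polynomial, so its value at the origin is its value
   everywhere. The components of positive degree vanish on the sphere because the L_i kill the
   image. *)
exists (sev sg 0 (fun=> 0)); rewrite e.
have : evR (sg ++ [:: (- sev sg 0 (fun=> 0), hone)]) = 0.
  apply/evR_eq0P => z l; rewrite scomp_cat /scomp [X in _ + X]big_cons big_nil addr0 -/(scomp sg z l) /=.
  case: l => [|l] /=.
    rewrite hornerN horner_sev; have [c ->] := homog0_const (harm_scomp sg z 0).
    rewrite mpoly.mevalC scaleNr -mpoly.mul_mpolyC mulr1 subrr; exact: sph0_0.
  rewrite addr0; apply/sph0P => x; apply: harm_rot_eq0 (harm_scomp sg z l.+1) _ => i.
  exact: ((sph0P _).1 (sph0_rot i (srot i z l.+1)) x).
rewrite evR_cat {2}/evR big_cons big_nil addr0 scaleNr => /eqP.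
by rewrite subr_eq0 => /eqP.
Qed.

Lemma intertwiner_scalar : exists p : {poly C}, forall s, B s = p *: Alin s.
Proof.
have [p hp] := intertwiner_one; exists p => s.
suff h h0 : B (gs h0) = p *: Alin (gs h0).
  have [sg ->] := evS_surj s; rewrite /evS !linear_sum; apply: eq_bigr => t _.
  rewrite -[RHS]/(p *: Alin _) (linearZ_LR B) (linearZ_LR Alin) h; exact: scaleC.
have [l hl] : exists l, sdeg h0 = l by exists (sdeg h0).
elim: l h0 hl => [|l IH] h hl.
  have := sharm h; rewrite hl => /homog0_const[c hc].
  rewrite (@gs_sum 1 (fun=> hone) (fun=> c) h) ?big_ord1 // => [|]; last first.
    by rewrite hc -mpoly.mul_mpolyC mulr1.
  rewrite (linearZ_LR B) (linearZ_LR Alin) hp AlinE Aop_gs scale1r; exact: scaleC.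
have [c c0 e] := rungelenz_generates hS_act hl.
have sc (u v : Rfam) : c%:P *: u = c%:P *: v -> u = v.
  move=> /(congr1 (fun w => (c^-1)%:P *: w)); rewrite !scalerA -polyCM mulVf //.
  by rewrite !scale1r.
apply: sc; rewrite -(linearZ_LR B) [RHS]scaleC -(linearZ_LR Alin) e.
rewrite !linear_sum; apply: eq_bigr => i _.
rewrite -[RHS]/(p *: Alin _) hB IH; last by rewrite /= hl.
rewrite (_ : Alin (gact hS _ _) = gact hR (Rgen i) (Alin (gs (hder i h)))); last by rewrite !AlinE (Aop_gact hS_act hR_act).
have [g gE] := linear_packed (gact_linearr hR (Rgen i)).
by rewrite -!gE (linearZ_LR g).
Qed.

End Intertwiner.

Lemma fibre_root (p : {poly C}) (B : {linear Sfam -> Rfam}) z : (forall s, B s = p *: Alin s) ->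
  root p z -> forall x, fibre_map B z x = 0.
Proof.
move=> hp /factor_theorem[q hq] x; have -> : x = qproj _ (repr x) by rewrite /qproj reprK.
rewrite fibre_mapE hp; apply/eqP; rewrite -(linear0 (qproj _)) qproj_eq subr0.
by apply: linspan_gen; exists (q *: Alin (repr x)) => //; rewrite hq -scalerA scaleC.
Qed.

Lemma nonzero_in_fibres_constant (p : {poly C}) (B : {linear Sfam -> Rfam}) :
  (forall s, B s = p *: Alin s) -> (forall z, exists x, fibre_map B z x != 0) ->
  exists2 c, c != 0 & p = c%:P.
Proof.
move=> hp hB; apply/size_poly1P; apply: contrapT => /negP s1.
(* The case p = 0 is included: its size is 0, not 1, and every z is a root. *)
have [z rz] := closed_rootP p s1; have [x] := hB z.
by rewrite (fibre_root hp rz) eqxx.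
Qed.

End Uniqueness.

Theorem mainTheorem3 (R : realType) (gamma : R) (gamma_gt0 : 0 < gamma)
    (hS : HCfamily (singular_family gamma)) (hS_act : singular_actions hS)
    (hR : HCfamily (regular_family gamma)) (hR_act : regular_actions hR) :
  exists A : {linear singular_family gamma -> regular_family gamma},
    [/\ intertwining hS hR A,
        bijective (genmap A),
        forall z : R[i], exists x, fibre_map A z x != 0 &
        forall B : {linear singular_family gamma -> regular_family gamma},
          intertwining hS hR B ->
          (forall z : R[i], exists x, fibre_map B z x != 0) ->
          exists2 c : R[i], c != 0 & forall s, B s = c%:P *: A s].
Proof.
exists (Alin gamma); split.
- split=> [k ok m|X m]; rewrite !AlinE; first exact: (Aop_kact hS_act hR_act m ok).
  exact: (Aop_gact hS_act hR_act X m).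
- exact: Alin_genmap_bij.
- exact: Alin_fibre.
- move=> B [_ hB] B0; have [p hp] := intertwiner_scalar hS_act hR_act hB.
  have [c c0 pc] := nonzero_in_fibres_constant hp B0.
  by exists c => // s; rewrite hp pc.
Qed.
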